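(* Let $T$ be a contraction on a complex Hilbert space with $\sigma(T)\cap\mathbb T\subset\{1\}$. Fix complex Hilbert spaces $E,F$ and a function $W\in A(\mathbb D;\mathcal B(E,F))$ satisfying $\|W(1)\|<\|W\|_\infty$. Then $$T\text{ is a Ritt operator}\quad\Longleftrightarrow\quad\sup_{n\ge1}\|W(T^n)\|<\|W\|_\infty .$$
   Context: $\mathbb D$ is the open unit disc, $\mathbb T$ the unit circle. A bounded operator $T$ is a Ritt operator if $\sigma(T)\subset\overline{\mathbb D}$ and $\sup_{|\lambda|>1}|\lambda-1|\,\|(\lambda-T)^{-1}\|<\infty$. $A(\mathbb D;\mathcal B(E,F))$ is the Banach space of functions $W:\overline{\mathbb D}\to\mathcal B(E,F)$ that are continuous in operator norm on $\overline{\mathbb D}$ and holomorphic on $\mathbb D$, with norm $\|W\|_\infty=\max_{\zeta\in\mathbb T}\|W(\zeta)\|$. For a contraction $S\in\mathcal B(H)$ and an operator-valued polynomial $W(z)=\sum_jW_jz^j$, put $W(S)=\sum_jW_j\otimes S^j:E\otimes H\to F\otimes H$ (completed Hilbert tensor products). One has $\|W(S)\|\le\|W\|_\infty$, operator-valued polynomials are dense in $A(\mathbb D;\mathcal B(E,F))$, and $W(S)$ is defined for all $W\in A(\mathbb D;\mathcal B(E,F))$ by continuous extension. *)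

(* Defs.v *)
From HB Require Import structures.
From mathcomp Require Import all_boot all_order all_algebra sesquilinear complex.
From mathcomp Require Import all_classical all_reals ereal topology normedtype.
From mathcomp Require Import sequences derive.

Set Implicit Arguments.
Unset Strict Implicit.
Unset Printing Implicit Defensive.

Import Order.TTheory GRing.Theory Num.Theory.
Import numFieldNormedType.Exports.

Local Open Scope classical_set_scope.
Local Open Scope ring_scope.
Local Open Scope complex_scope.

(* MathComp forms are linear in the first variable and conjugate-linear in the
   second one. *)
HB.mixin Record hasInnerProduct (R : realType) H
    & CompleteNormedModule R[i] H := {
  inner : {dot H for Num.conj};
  inner_norm : forall x : H, `|x| ^+ 2 = inner x x
}.

#[short(type="hilbertType")]
HB.structure Definition Hilbert (R : realType) :=
  {H of hasInnerProduct R H & CompleteNormedModule R[i] H}.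

(* Norms on a normedModType over R[i] take their values in R[i]; [rnorm] is the
   same number seen in R, where suprema are available. *)
Definition rnorm (R : realType) (V : normedModType R[i]) (x : V) : R :=
  complex.Re `|x|.

Section RealNorm.
Variables (R : realType) (V : normedModType R[i]).
Implicit Types x y : V.

Lemma rnormE x : (rnorm x)%:C = `|x|.
Proof. by apply: RRe_real; exact: normr_real. Qed.

Lemma rnorm_le x y : (rnorm x <= rnorm y) = (`|x| <= `|y|).
Proof. by rewrite -!rnormE lecR. Qed.

Lemma rnorm_ge0 x : 0 <= rnorm x.
Proof. by rewrite -lecR rnormE; exact: normr_ge0. Qed.

Lemma rnorm0 : rnorm (0 : V) = 0.
Proof. by rewrite /rnorm normr0. Qed.

Lemma rnorm_le1 x : (rnorm x <= 1) = (`|x| <= 1).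
Proof. by rewrite -rnormE lecR. Qed.

Lemma rnormD x y : rnorm (x + y) <= rnorm x + rnorm y.
Proof. by rewrite -lecR rmorphD /= !rnormE ler_normD. Qed.

Lemma rnormZ (a : R[i]) x : rnorm (a *: x) = complex.Re `|a| * rnorm x.
Proof.
by apply: (@complexI R); rewrite rmorphM /= !rnormE normrZ.
Qed.

Lemma rnorm_eq0 x : rnorm x = 0 -> x = 0.
Proof. by move=> x0; apply/normr0_eq0; rewrite -rnormE x0. Qed.

End RealNorm.

Section BoundedOperators.
Variable R : realType.

Definition is_bounded_op (E F : normedModType R[i]) : {pred E -> F} :=
  fun f => `[< linear f /\ exists M : R[i], forall x, `|f x| <= M * `|x| >].

Record bounded_op (E F : normedModType R[i]) : Type := BoundedOp {
  bounded_op_fun :> E -> F;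
  _ : bounded_op_fun \in @is_bounded_op E F
}.

Section Instances.
Variables E F : normedModType R[i].
Implicit Types f g : E -> F.

HB.instance Definition _ := [isSub for @bounded_op_fun E F].
HB.instance Definition _ := [Choice of bounded_op E F by <:].

Lemma is_bounded_op_submod : submod_closed (@is_bounded_op E F).
Proof.
split; first (apply/asboolP; split).
- by move=> a x y; rewrite /= scaler0 addr0.
- by exists 0 => x; rewrite normr0 mul0r.
move=> a f g /asboolP[lf [M fM]] /asboolP[lg [N gN]]; apply/asboolP; split.
  move=> b x y; change (a *: f (b *: x + y) + g (b *: x + y) =
    b *: (a *: f x + g x) + (a *: f y + g y)).
  by rewrite lf lg !scalerDr !scalerA (mulrC a b) addrACA.
exists (`|a| * M + N) => x.
change (`|a *: f x + g x| <= (`|a| * M + N) * `|x|).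
apply: (le_trans (ler_normD _ _)); rewrite mulrDl -mulrA normrZ.
by apply: lerD (gN x); apply: ler_wpM2l.
Qed.

HB.instance Definition _ :=
  GRing.isSubmodClosed.Build _ _ (@is_bounded_op E F) is_bounded_op_submod.
HB.instance Definition _ := [SubChoice_isSubLmodule of bounded_op E F by <:].

Lemma bounded_op_linear (A : bounded_op E F) : linear A.
Proof. by case: A => f /= /asboolP[]. Qed.

Lemma bounded_op_bounded (A : bounded_op E F) :
  exists M : R[i], forall x, `|A x| <= M * `|x|.
Proof. by case: A => f /= /asboolP[]. Qed.

Definition opnorm (A : bounded_op E F) : R :=
  sup [set rnorm (A x) | x in [set x : E | `|x| <= 1]].

Lemma has_sup_opnorm (A : bounded_op E F) :
  has_sup [set rnorm (A x) | x in [set x : E | `|x| <= 1]].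
Proof.
split; first by exists (rnorm (A 0)), 0; rewrite //= normr0.
have [M AM] := bounded_op_bounded A; exists (complex.Re `|M|) => _ [x x1 <-].
rewrite -lecR rnormE RRe_real //; apply: le_trans (AM x) _.
have [->|x0] := eqVneq x 0; first by rewrite normr0 mulr0.
have M0 : 0 <= M.
  by have := le_trans (normr_ge0 _) (AM x); rewrite pmulr_lge0 // normr_gt0.
by rewrite ger0_norm // ler_piMr.
Qed.

Lemma opnorm_ub (A : bounded_op E F) x : `|x| <= 1 -> rnorm (A x) <= opnorm A.
Proof. by move=> x1; apply: (ub_le_sup (has_sup_opnorm A).2); exists x. Qed.

Lemma opnorm_lub (A : bounded_op E F) c :
  (forall x, `|x| <= 1 -> rnorm (A x) <= c) -> opnorm A <= c.
Proof.
move=> Ac; apply: (ge_sup (has_sup_opnorm A).1) => _ [x x1 <-].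
exact: Ac.
Qed.

Lemma opnorm_ge0 (A : bounded_op E F) : 0 <= opnorm A.
Proof.
by apply: le_trans (rnorm_ge0 (A 0)) (opnorm_ub _ _); rewrite normr0.
Qed.

Lemma bounded_opZ (A : bounded_op E F) a x : A (a *: x) = a *: A x.
Proof. exact: (scalable_linear (bounded_op_linear A)). Qed.

Lemma opnorm_bound (A : bounded_op E F) x : rnorm (A x) <= opnorm A * rnorm x.
Proof.
have [->|x0] := eqVneq x 0.
  have -> : A 0 = 0 by rewrite -(scale0r (0 : E)) bounded_opZ scale0r.
  by rewrite !rnorm0 mulr0.
have nx0 : `|x| != 0 by rewrite normr_eq0.
have rx0 : 0 < rnorm x by rewrite -ltcR rnormE normr_gt0.
have := @opnorm_ub A (`|x|^-1 *: x).
rewrite normrZ normfV normr_id mulVf // lexx => /(_ isT).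
rewrite bounded_opZ rnormZ normfV normr_id -rnormE -fmorphV /=.
by rewrite ler_pdivrMl // mulrC.
Qed.

Let norm (A : bounded_op E F) : R[i] := (opnorm A)%:C.

Lemma opnormD (A B : bounded_op E F) : norm (A + B) <= norm A + norm B.
Proof.
rewrite -rmorphD lecR; apply: opnorm_lub => x x1.
by apply: le_trans (rnormD _ _) _; apply: lerD; apply: opnorm_ub.
Qed.

Lemma opnormZ (a : R[i]) (A : bounded_op E F) : norm (a *: A) = `|a| * norm A.
Proof.
have aE : (complex.Re `|a|)%:C = `|a| by apply: RRe_real; exact: normr_real.
rewrite -aE -rmorphM; congr _%:C.
have a0 : 0 <= complex.Re `|a| by rewrite -lecR aE; exact: normr_ge0.
apply/le_anti/andP; split.
  apply: opnorm_lub => x x1.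
  have -> : (a *: A) x = a *: A x by [].
  by rewrite rnormZ ler_wpM2l // opnorm_ub.
have [->|an0] := eqVneq a 0.
  by rewrite normr0 /= mul0r opnorm_ge0.
have {}a0 : 0 < complex.Re `|a| by rewrite -ltcR aE normr_gt0.
rewrite mulrC -ler_pdivlMr //; apply: opnorm_lub => x x1.
rewrite ler_pdivlMr // mulrC -rnormZ.
exact: (@opnorm_ub (a *: A)).
Qed.

Lemma opnorm_eq0 (A : bounded_op E F) : norm A = 0 -> A = 0.
Proof.
move=> /(@complexI R) A0; apply/val_inj/funext => x /=.
apply: rnorm_eq0; apply/le_anti/andP; split; last exact: rnorm_ge0.
by have := opnorm_bound A x; rewrite A0 mul0r.
Qed.

HB.instance Definition _ := Lmodule_isNormed.Build R[i] (bounded_op E F)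
  opnormD opnormZ opnorm_eq0.

End Instances.

Section Algebra.
Variable H : normedModType R[i].
Implicit Types S T : bounded_op H H.

Lemma is_bounded_op_id : (@id H : H -> H) \in @is_bounded_op H H.
Proof.
by apply/asboolP; split => //; exists 1 => x; rewrite mul1r.
Qed.

Lemma is_bounded_op_comp S T : (S \o T : H -> H) \in @is_bounded_op H H.
Proof.
apply/asboolP; split; first by move=> a x y /=; rewrite !bounded_op_linear.
exists ((opnorm S)%:C * (opnorm T)%:C) => x /=.
rewrite -!rnormE -!rmorphM lecR -mulrA.
apply: le_trans (opnorm_bound _ _) _.
by rewrite ler_wpM2l ?opnorm_ge0 ?opnorm_bound.
Qed.

Definition id_op := BoundedOp is_bounded_op_id.
Definition comp_op S T := BoundedOp (is_bounded_op_comp S T).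

Lemma comp_opA : associative comp_op.
Proof. by move=> S T U; apply: val_inj. Qed.

Lemma comp_1op : left_id id_op comp_op.
Proof. by move=> S; apply: val_inj. Qed.

Lemma comp_op1 : right_id id_op comp_op.
Proof. by move=> S; apply: val_inj. Qed.

Lemma comp_opDl : left_distributive comp_op +%R.
Proof. by move=> S T U; apply: val_inj. Qed.

Lemma comp_opDr : right_distributive comp_op +%R.
Proof.
move=> S T U; apply/val_inj/funext => x /=.
by have := bounded_op_linear S 1 (T x) (U x); rewrite !scale1r.
Qed.

(* Only a [pzRingType]: the identity is 0 when H is trivial. *)
HB.instance Definition _ := GRing.Zmodule_isPzRing.Build (bounded_op H H)
  comp_opA comp_1op comp_op1 comp_opDl comp_opDr.

End Algebra.
End BoundedOperators.

Section Spectrum.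
Variables (R : realType) (H : hilbertType R).
Implicit Types S T : bounded_op H H.

Definition is_inverse S T := S * T = 1 /\ T * S = 1.

Definition spectrum T : set R[i] :=
  [set lambda | ~ exists S, is_inverse S (lambda *: (1 : bounded_op H H) - T)].

(* The value 0 at points of the spectrum is a default. *)
Definition resolvent T (lambda : R[i]) : bounded_op H H :=
  xget 0 [set S | is_inverse S (lambda *: (1 : bounded_op H H) - T)].

Definition ritt T :=
  spectrum T `<=` [set lambda | `|lambda| <= 1] /\
  has_ubound [set complex.Re `|lambda - 1| * opnorm (resolvent T lambda) |
              lambda in [set lambda : R[i] | 1 < `|lambda|]].

Definition contraction_op T := opnorm T <= 1.

End Spectrum.

Definition unit_circle (R : realType) : set R[i]^o := [set z | `|z| = 1].
Definition unit_disc (R : realType) : set R[i]^o := [set z | `|z| < 1].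
Definition closed_unit_disc (R : realType) : set R[i]^o := [set z | `|z| <= 1].

Section DiscAlgebra.
Variables (R : realType) (E F : hilbertType R).
Implicit Types W : R[i]^o -> bounded_op E F.

(* Membership in the operator-valued disc algebra; the values of [W] outside
   the closed disc are irrelevant. *)
Definition disc_algebra W :=
  {within @closed_unit_disc R, continuous W} /\
  forall z, unit_disc z -> derivable W z 1.

(* A maximum when [W] is continuous on the circle. *)
Definition disc_norm W : R := sup [set opnorm (W z) | z in @unit_circle R].

(* The operator-valued polynomial whose j-th coefficient is [p`_j]. *)
Definition op_poly (p : seq (bounded_op E F)) : R[i]^o -> bounded_op E F :=
  fun z => \sum_(j < size p) z ^+ j *: p`_j.

End DiscAlgebra.

(* The Hilbert space tensor product of E and H, characterised up to a unitary
   isomorphism: a Hilbert space that completes the span of the elementary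
   tensors for the inner product with
   <e ⊗ h, e' ⊗ h'> = <e, e'> <h, h'>. *)
Record hilbert_tensor (R : realType) (E H : hilbertType R) := HilbertTensor {
  tensor_space :> hilbertType R;
  tensor : {bilinear E -> H -> tensor_space};
  tensor_inner : forall e e' h h',
    inner (tensor e h) (tensor e' h') = inner e e' * inner h h';
  tensor_dense : dense [set \sum_(eh <- s) tensor eh.1 eh.2 |
                        s in [set: seq (E * H)]]
}.

Section Calculus.
Variables (R : realType) (E F H : hilbertType R).
Variables (EH : hilbert_tensor E H) (FH : hilbert_tensor F H).
Implicit Type S : bounded_op H H.

(* The unique bounded operator with (A ⊗ S)(e ⊗ h) = A e ⊗ S h. *)
Definition tensor_op (A : bounded_op E F) S : bounded_op EH FH :=
  xget 0 [set G : bounded_op EH FH |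
          forall e h, G (tensor EH e h) = tensor FH (A e) (S h)].

Definition poly_calculus (p : seq (bounded_op E F)) S : bounded_op EH FH :=
  \sum_(j < size p) tensor_op p`_j (S ^+ j).

(* W(S): the limit in operator norm of P_n(S) for polynomials P_n tending to W
   in the norm of the disc algebra. For a contraction S, von Neumann's
   inequality makes it exist and be independent of the choice of the P_n. *)
Definition calculus (W : R[i]^o -> bounded_op E F) S : bounded_op EH FH :=
  xget 0 [set A : bounded_op EH FH |
    exists p : nat -> seq (bounded_op E F),
      disc_norm (fun z => op_poly (p n) z - W z) @[n --> \oo] --> (0 : R) /\
      poly_calculus (p n) S @[n --> \oo] --> A].

End Calculus.

(* Main.v *)
(** If [T] is a Ritt contraction, then [|(z - T) x| >= c |z - 1| |x|] for
    [|z| >= 1], and Parseval's identity over the roots of [z] gives the same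
    bound for all powers of [T] with one constant. A Cayley transform followed
    by a discrete Gearhart-Pruss argument turns the bound into a polynomial [Q]
    with [|Q| <= 2] on the circle off a small arc around 1 while
    [|Q(T^n) x| >= 3 |x|] for all [n]. Von Neumann's inequality for the column
    [(W, beta Q)], whose norm on the circle hardly exceeds that of [W] since
    [W] is small on the arc, then leaves a uniform gap below the norm of [W].

    If [T] is not Ritt, it has unit approximate eigenvectors [x] with
    [|(mu - T) x| <= e |mu - 1|] for some [mu != 1] on the circle arbitrarily
    close to 1. About [t / arg mu] steps move such an [x] close to [cis t x], so
    some power of [T] has any given point [z] of the circle as an approximate
    eigenvalue, and [|W(T^n)|] comes close to [|W(z)|].

    Polynomials are dense in the disc algebra by discrete Fejer means: Goursat's
    theorem provides primitives, which kill the negative frequencies. *)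
Require Import Defs.
From mathcomp Require Import all_boot all_order all_algebra complex sesquilinear.
From mathcomp Require Import all_classical all_reals ereal topology normedtype.
From mathcomp Require Import sequences derive trigo.
From mathcomp Require Import measure lebesgue_measure lebesgue_integral ftc.
From mathcomp Require Import ring lra zify.

Set Implicit Arguments.
Unset Strict Implicit.
Unset Printing Implicit Defensive.

Import Order.TTheory GRing.Theory Num.Theory.
Import numFieldNormedType.Exports.

Local Open Scope classical_set_scope.
Local Open Scope ring_scope.
Local Open Scope complex_scope.

(** * Complex numbers and positive semidefinite forms *)

(** The Cayley transform [B = (1 + z) / (1 - z)] maps the circle without 1 to the imaginary axis, so
    [exp (t B)] has modulus 1 there. For an operator [S], the Ritt bound on the circle becomes a
    uniform resolvent bound for [B(S)] on the imaginary axis. Hence the contraction semigroup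
    [exp (- t B(S))] decays exponentially and [exp (t B(S))] is bounded below by a large constant:
    this is the source of a function that is bounded on the circle off 1 and large on [S]. Its
    growth near 1 is paid for by the gap between [|W(1)|] and the norm of [W]. The thresholds 2 and
    3 only have to be separated; the gain is [beta^2 (3^2 - 2^2)]. They are reached with constants
    that depend only on the Ritt bound and the arc, so one [Q] serves every power. Integrals over
    the circle are replaced by sums over roots of unity. In the Parseval arguments the order of the
    roots exceeds all degrees involved, so that no two degrees are confused. Norm inequalities on
    tensor products are proved on finite sums of elementary tensors, where they express that a Schur
    product of positive semidefinite forms is nonnegative. *)

Section ComplexModulus.
Variable R : realType.
Implicit Types (z w : R[i]) (r t : R).

Definition cabs z : R := complex.Re `|z|.

Lemma cabsE z : (cabs z)%:C = `|z|.
Proof. by apply: RRe_real; exact: normr_real. Qed.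

Lemma cabs_ge0 z : 0 <= cabs z.
Proof. by rewrite -lecR cabsE normr_ge0. Qed.

Lemma cabs0 : cabs 0 = 0.
Proof. by rewrite /cabs normr0. Qed.

Lemma cabs1 : cabs 1 = 1.
Proof. by rewrite /cabs normr1. Qed.

Lemma cabsM z w : cabs (z * w) = cabs z * cabs w.
Proof. by apply: (@complexI R); rewrite rmorphM /= !cabsE normrM. Qed.

Lemma cabsX z n : cabs (z ^+ n) = cabs z ^+ n.
Proof. by apply: (@complexI R); rewrite rmorphXn /= !cabsE normrX. Qed.

Lemma cabsN z : cabs (- z) = cabs z.
Proof. by rewrite /cabs normrN. Qed.

Lemma cabsB z w : cabs (z - w) = cabs (w - z).
Proof. by rewrite -opprB cabsN. Qed.

Lemma cabsD z w : cabs (z + w) <= cabs z + cabs w.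
Proof. by rewrite -lecR rmorphD /= !cabsE ler_normD. Qed.

Lemma cabsBD z w : cabs z <= cabs w + cabs (z - w).
Proof. by have := cabsD w (z - w); rewrite addrC subrK. Qed.

Lemma cabsV z : cabs z^-1 = (cabs z)^-1.
Proof. by apply: (@complexI R); rewrite fmorphV /= !cabsE normfV. Qed.

Lemma cabs_real r : cabs r%:C = `|r|.
Proof.
by rewrite /cabs normc_def /= expr0n /= addr0 sqrtr_sqr.
Qed.

Lemma cabs_eq0 z : (cabs z == 0) = (z == 0).
Proof. by rewrite -(inj_eq (@complexI R)) cabsE normr_eq0. Qed.

Lemma cabs_gt0 z : (0 < cabs z) = (z != 0).
Proof. by rewrite lt_neqAle cabs_ge0 andbT eq_sym cabs_eq0. Qed.

Lemma cabs_conj z : cabs (Num.conj z) = cabs z.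
Proof. by rewrite /cabs norm_conjC. Qed.

Lemma cabs_sum I (s : seq I) (P : pred I) (F : I -> R[i]) :
  cabs (\sum_(i <- s | P i) F i) <= \sum_(i <- s | P i) cabs (F i).
Proof.
elim/big_rec2: _ => [|i x y _ le]; first by rewrite cabs0.
by apply: le_trans (cabsD _ _) _; rewrite lerD2l.
Qed.

Lemma cabs_sqr z : cabs z ^+ 2 = complex.Re z ^+ 2 + complex.Im z ^+ 2.
Proof. by apply: (@complexI R); rewrite rmorphXn /= cabsE -add_Re2_Im2. Qed.

Lemma cabs_Re z : `|complex.Re z| <= cabs z.
Proof. by rewrite -lecR cabsE normc_ge_Re. Qed.

Lemma cabs_Im z : `|complex.Im z| <= cabs z.
Proof.
rewrite -(ler_pXn2r (n := 2)) ?nnegrE ?cabs_ge0 // cabs_sqr real_normK ?num_real //.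
by rewrite lerDr sqr_ge0.
Qed.

Lemma cabs_ReIm z : cabs z <= `|complex.Re z| + `|complex.Im z|.
Proof.
rewrite -(ler_pXn2r (n := 2)) ?nnegrE ?cabs_ge0 ?addr_ge0 // cabs_sqr.
rewrite sqrrD !real_normK ?num_real // -addrA lerD2l lerDr.
by rewrite mulrn_wge0 // mulr_ge0.
Qed.

Lemma unit_circleE z : unit_circle (z : R[i]^o) <-> cabs z = 1.
Proof.
rewrite /unit_circle /=; split => [e|e]; first by rewrite /cabs e.
by rewrite -cabsE e.
Qed.

Lemma conj_unit z : cabs z = 1 -> Num.conj z = z^-1.
Proof.
move=> z1; have z0 : z != 0 by rewrite -cabs_gt0 z1.
by apply: (mulfI z0); rewrite -normCK -cabsE z1 expr1n divff.
Qed.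

Definition cis t : R[i] := cos t +i* sin t.

Lemma cis0 : cis 0 = 1.
Proof. by rewrite /cis cos0 sin0. Qed.

Lemma cisD t r : cis (t + r) = cis t * cis r.
Proof. by rewrite /cis cosD sinD; simpc; congr (_ +i* _); rewrite addrC. Qed.

Lemma cisX t n : cis t ^+ n = cis (t *+ n).
Proof.
by elim: n => [|n IH]; rewrite ?expr0 ?mulr0n ?cis0 // exprS IH mulrS cisD.
Qed.

Lemma cabs_cis t : cabs (cis t) = 1.
Proof.
apply/eqP; rewrite -(eqrXn2 (n := 2)) ?cabs_ge0 // cabs_sqr /= cos2Dsin2.
by rewrite expr1n.
Qed.

Lemma cis2pi : cis (pi *+ 2) = 1.
Proof. by rewrite /cis cos2pi sin2pi. Qed.

Lemma cis_eq1 t : 0 < t < pi *+ 2 -> cis t != 1.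
Proof.
move=> /andP[t0 t2]; apply/eqP => /(congr1 (@complex.Re R)) /=.
have -> : t = (t / 2) *+ 2 by rewrite -mulr_natr divfK ?pnatr_eq0.
have s0 : 0 < sin (t / 2).
  apply: sin_gt0_pi; rewrite divr_gt0 //= ltr_pdivrMr // mulr_natr //.
rewrite cos_mulr2n cos2sin2 => e.
have : sin (t / 2) ^+ 2 > 0 by rewrite exprn_gt0.
by move: e; rewrite mulr2n; lra.
Qed.

Lemma cis_onto z : cabs z = 1 -> exists2 t, `|t| <= pi & z = cis t.
Proof.
move=> z1; have := cabs_sqr z; rewrite z1 expr1n => e.
have Rz : -1 <= complex.Re z <= 1 by rewrite -ler_norml -z1 cabs_Re.
have sE : sin (acos (complex.Re z)) ^+ 2 = complex.Im z ^+ 2.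
  by rewrite sin2cos2 acosK // e addrAC subrr add0r.
have pi0 := pi_ge0 R.
have a0 := acos_ge0 Rz; have a1 := acos_lepi Rz.
move/eqP: sE; rewrite eqf_sqr => /orP[] /eqP sE.
  exists (acos (complex.Re z)); first by rewrite ger0_norm.
  by rewrite /cis sE acosK //; case: (z).
exists (- acos (complex.Re z)); first by rewrite normrN ger0_norm.
by rewrite /cis sinN sE opprK cosN acosK //; case: (z).
Qed.

Definition uroot M : R[i] := cis (pi *+ 2 / M%:R).

Lemma cabs_uroot M : cabs (uroot M) = 1.
Proof. exact: cabs_cis. Qed.

Lemma uroot_expr M : (0 < M)%N -> uroot M ^+ M = 1.
Proof.
move=> M0; rewrite cisX -(mulr_natr (pi *+ 2 / _)) divfK ?cis2pi //.
by rewrite pnatr_eq0 -lt0n.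
Qed.

Lemma uroot_neq1 M k : (0 < k < M)%N -> uroot M ^+ k != 1.
Proof.
move=> /andP[k0 kM]; rewrite cisX; apply: cis_eq1.
have M0 : (0 : R) < M%:R by rewrite ltr0n (leq_trans _ kM).
have p0 : 0 < (pi : R) *+ 2 by rewrite pmulrn_lgt0 // pi_gt0.
rewrite -[_ *+ k]mulr_natr.
apply/andP; split; first by rewrite mulr_gt0 ?divr_gt0 // ltr0n.
by rewrite mulrAC ltr_pdivrMr // ltr_pM2l // ltr_nat.
Qed.

Lemma uroot_neq0 M : uroot M != 0.
Proof. by rewrite -cabs_gt0 cabs_uroot. Qed.

(** The terms form a geometric progression; for [n != m] its ratio is an [M]-th root of unity
    different from 1, because both exponents are below [M]. *)
Lemma uroot_orth M n m : (n < M)%N -> (m < M)%N ->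
  \sum_(j < M) (uroot M ^+ (j * n) * Num.conj (uroot M ^+ (j * m))) =
  (M * (n == m))%:R.
Proof.
wlog le : n m / (m <= n)%N => [H nM mM|nM mM].
  have [/H->//|/ltnW/H H'] := leqP m n.
  have := congr1 Num.conj (H' mM nM); rewrite conjC_nat eq_sym => <-.
  by rewrite rmorph_sum /=; apply: eq_bigr => j _; rewrite rmorphM /= conjCK mulrC.
have uX k : cabs (uroot M ^+ k) = 1 by rewrite cabsX cabs_uroot expr1n.
transitivity (\sum_(j < M) (uroot M ^+ (n - m)) ^+ j).
  apply: eq_bigr => j _; rewrite conj_unit // -{1}[n](subnK le) mulnDr exprD.
  by rewrite mulfK ?expf_neq0 ?uroot_neq0 // mulnC exprM.
have [e|ne] := eqVneq n m.
  rewrite e subnn muln1; under eq_bigr do rewrite expr0 expr1n.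
  by rewrite sumr_const card_ord.
rewrite muln0; have k0 : (0 < n - m < M)%N.
  by rewrite subn_gt0 ltn_neqAle eq_sym ne le (leq_ltn_trans (leq_subr _ _)).
have := subrX1 (uroot M ^+ (n - m)) M.
rewrite -exprM mulnC exprM uroot_expr ?(leq_trans _ nM) // expr1n subrr.
move/esym/eqP; rewrite mulf_eq0 subr_eq0 (negbTE (uroot_neq1 k0)) /= => /eqP.
by [].
Qed.

End ComplexModulus.

Section PsdForms.
Variables (R : realType) (V : lmodType R[i]).

(** No definiteness and no norm: the defect forms [<x, y> - <T x, T y>] are degenerate in
    general. *)
Record psd (D : V -> V -> R[i]) : Prop := Psd {
  psd_lin : forall a x y z, D (a *: x + y) z = a * D x z + D y z;
  psdC : forall x y, D x y = Num.conj (D y x);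
  psd_ge0 : forall x, 0 <= D x x
}.

Variables (D : V -> V -> R[i]) (DP : psd D).

Lemma psdDl x y z : D (x + y) z = D x z + D y z.
Proof. by have := psd_lin DP 1 x y z; rewrite scale1r mul1r. Qed.

Lemma psd0l z : D 0 z = 0.
Proof. by have := psdDl 0 0 z; rewrite addr0 => /eqP; rewrite addrC -subr_eq subrr => /eqP. Qed.

Lemma psdZl a x z : D (a *: x) z = a * D x z.
Proof. by have := psd_lin DP a x 0 z; rewrite addr0 psd0l addr0. Qed.

Lemma psdDr x y z : D z (x + y) = D z x + D z y.
Proof. by rewrite !(psdC DP z) psdDl rmorphD. Qed.

Lemma psdZr a x z : D z (a *: x) = Num.conj a * D z x.
Proof. by rewrite !(psdC DP z) psdZl rmorphM. Qed.

Lemma psd0r z : D z 0 = 0.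
Proof. by rewrite (psdC DP) psd0l rmorph0. Qed.

Lemma psd_suml I (s : seq I) (P : pred I) (F : I -> V) z :
  D (\sum_(i <- s | P i) F i) z = \sum_(i <- s | P i) D (F i) z.
Proof.
by apply: (big_morph (D^~ z)) => [x y|]; rewrite ?psdDl ?psd0l.
Qed.

Lemma psd_sumr I (s : seq I) (P : pred I) (F : I -> V) z :
  D z (\sum_(i <- s | P i) F i) = \sum_(i <- s | P i) D z (F i).
Proof.
by apply: (big_morph (D z)) => [x y|]; rewrite ?psdDr ?psd0r.
Qed.

Lemma psdBl x y z : D (x - y) z = D x z - D y z.
Proof. by rewrite -scaleN1r psdDl psdZl mulN1r. Qed.

Lemma psdBr x y z : D z (x - y) = D z x - D z y.
Proof. by rewrite -scaleN1r psdDr psdZr rmorphN1 mulN1r. Qed.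

Lemma psd_conj x : Num.conj (D x x) = D x x.
Proof. by rewrite -(psdC DP). Qed.

Lemma psd_eq0 x y : D x x = 0 -> D y x = 0.
Proof.
move=> x0; apply/eqP/negPn/negP => yx0.
(* With this [t] the form takes the negative value [- (D y y + 2)] at [y - t D(y, x) x]. *)
pose t : R[i] := (D y y + 1) / `|D y x| ^+ 2.
have n0 : 0 < `|D y x| ^+ 2 by rewrite exprn_gt0 // normr_gt0.
have tr : Num.conj t = t.
  by apply: CrealP; apply: ger0_real; rewrite divr_ge0 ?addr_ge0 ?psd_ge0 // ltW.
have := psd_ge0 DP (y - (t * D y x) *: x).
rewrite psdBl !psdBr !psdZl !psdZr x0 !mulr0 subr0 (psdC DP x y) rmorphM /= tr.
have e1 : t * Num.conj (D y x) * D y x = D y y + 1.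
  by rewrite -mulrA [_ * D y x]mulrC -normCK /t divfK // gt_eqF.
have e2 : t * D y x * Num.conj (D y x) = D y y + 1 by rewrite -e1 mulrAC.
rewrite e1 e2 (_ : _ - _ - _ = - (D y y + 2)); last by ring.
by rewrite oppr_ge0 lt_geF // ltr_wpDl ?(psd_ge0 DP) // ltr0n.
Qed.

Lemma psd_CS x y : `|D x y| ^+ 2 <= D x x * D y y.
Proof.
have [y0|y0] := eqVneq (D y y) 0; first by rewrite psd_eq0 // normr0 expr0n y0 mulr0.
have yp : 0 < D y y by rewrite lt_neqAle eq_sym y0 psd_ge0.
have := psd_ge0 DP (D y y *: x - D x y *: y).
rewrite psdBl !psdBr !psdZl !psdZr psd_conj (psdC DP y x) normCK.
set a := D x x; set b := D x y; set c := D y y; set b' := Num.conj b.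
have -> : c * (c * a) - c * (b' * b) - (b * (c * b') - b * (b' * c)) =
  c * (a * c - b * b') by ring.
by rewrite pmulr_rge0 // subr_ge0.
Qed.

(** Stated for forms, so that it serves both vectors ([parseval]) and scalars
    ([parseval_scalar]). *)
Lemma psd_parseval M (a : nat -> V) :
  \sum_(j < M) D (\sum_(n < M) uroot R M ^+ (j * n) *: a n)
                 (\sum_(n < M) uroot R M ^+ (j * n) *: a n) =
  M%:R * \sum_(n < M) D (a n) (a n).
Proof.
under eq_bigr => j _.
  rewrite psd_suml; under eq_bigr => n _.
    rewrite psd_sumr; under eq_bigr => m _ do rewrite psdZl psdZr mulrCA mulrA [Num.conj _ * _]mulrC.
    over.
  over.
rewrite exchange_big /= mulr_sumr; apply: eq_bigr => n _.
rewrite exchange_big /= (bigD1 n) //= [X in _ + X]big1 => [|m mn].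
  rewrite -mulr_suml uroot_orth // eqxx muln1 addr0 //.
rewrite -mulr_suml uroot_orth //.
by rewrite eq_sym (_ : (m == n :> nat) = false) ?muln0 ?mul0r //; exact: negbTE.
Qed.

End PsdForms.

Section Schur.
Variables (R : realType) (E H : lmodType R[i]).
Variables (K : E -> E -> R[i]) (D : H -> H -> R[i]).
Hypotheses (KP : psd K) (DP : psd D).

(* Gram-Schmidt for D alone, carrying the coefficients over to the E side,
   reduces the positivity of the Schur product to diagonal terms. *)
Lemma schur_ge0 (s : seq (E * H)) :
  0 <= \sum_(x <- s) \sum_(y <- s) K x.1 y.1 * D x.2 y.2.
Proof.
have [n] := ubnP (size s); elim: n s => // n IH [|[e h] s] /=.
  by rewrite big_nil.
rewrite ltnS => ns; have [h0|h0] := eqVneq (D h h) 0.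
  rewrite big_cons big1 => [|y _]; last first.
    by rewrite /= (psdC DP) (psd_eq0 DP _ h0) conjC0 mulr0.
  rewrite add0r; under eq_bigr do rewrite big_cons /= (psd_eq0 DP _ h0) mulr0 add0r.
  exact: IH.
pose c (y : E * H) := D y.2 h / D h h.
pose p (y : E * H) := (y.1, y.2 - c y *: h).
pose e' := e + \sum_(y <- s) c y *: y.1.
have cr : Num.conj (D h h) = D h h by exact: psd_conj.
have Dh y : D h y.2 = Num.conj (c y) * D h h.
  by rewrite /c rmorphM fmorphV /= cr divfK // -(psdC DP).
have Dy y : D y.2 h = c y * D h h by rewrite /c divfK.
have -> : \sum_(x <- (e, h) :: s) \sum_(y <- (e, h) :: s) K x.1 y.1 * D x.2 y.2 =
  K e' e' * D h h + \sum_(x <- map p s) \sum_(y <- map p s) K x.1 y.1 * D x.2 y.2.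
  rewrite big_map; under [in RHS]eq_bigr do rewrite big_map /=.
  rewrite big_cons big_cons /=.
  under [\sum_(j <- s) \sum_(y <- _ :: _) _]eq_bigr do rewrite big_cons /=.
  rewrite big_split /= -addrA; rewrite /e' (psdDl KP) !(psdDr KP).
  rewrite !mulrDl -!addrA; congr (_ + _).
  rewrite (psd_suml KP) (psd_sumr KP) !mulr_suml ; congr (_ + _).
    by apply: eq_bigr => y _; rewrite (psdZr KP) Dh [_ * K e _]mulrC -mulrA.
  rewrite (psd_suml KP) mulr_suml; congr (_ + _).
    by apply: eq_bigr => y _; rewrite (psdZl KP) Dy mulrCA !mulrA.
  rewrite -big_split /=; apply: eq_bigr => x _.
  rewrite (psd_sumr KP) mulr_suml -big_split /=; apply: eq_bigr => y _.
  rewrite (psdZl KP) (psdZr KP) (psdBl DP) !(psdBr DP) !(psdZl DP) !(psdZr DP) Dh Dy.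
  by ring.
apply: addr_ge0; first by rewrite mulr_ge0 ?(psd_ge0 KP) ?(psd_ge0 DP).
by apply: IH; rewrite size_map.
Qed.

End Schur.

(** * Bounded operators *)

Section GeometricDecay.
Variable R : realType.

Lemma expr_small (r e : R) : 0 <= r < 1 -> 0 < e -> exists k, r ^+ k <= e.
Proof.
move=> /andP[r0 r1] e0.
have r1' : `|r| < 1 by rewrite ger0_norm.
have /cvgrPdist_le /(_ _ e0) [k _ kP] := cvg_expr r1'.
by exists k; have := kP k (leqnn k); rewrite /= sub0r normrN ger0_norm ?exprn_ge0.
Qed.

End GeometricDecay.

Section RealEps.
Variables (R : realType).

Lemma pos_complexP (e : R[i]) : 0 < e -> exists2 r : R, 0 < r & e = r%:C.
Proof.
move=> e0; have eE : (complex.Re e)%:C = e by apply: RRe_real; exact: gtr0_real.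
by exists (complex.Re e) => //; rewrite -ltcR eE.
Qed.

Variable V : normedModType R[i].
Implicit Types (x y : V) (u : nat -> V).

Lemma rnormN x : rnorm (- x) = rnorm x.
Proof. by rewrite /rnorm normrN. Qed.

Lemma rnormB x y : rnorm (x - y) = rnorm (y - x).
Proof. by rewrite -opprB rnormN. Qed.

Lemma rnorm_leD x y : rnorm (x - y) <= rnorm x + rnorm y.
Proof. by apply: le_trans (rnormD _ _) _; rewrite rnormN. Qed.

Lemma rnorm_leBD x y : rnorm x <= rnorm y + rnorm (x - y).
Proof. by have := rnormD y (x - y); rewrite addrC subrK. Qed.

Lemma rnorm_sum I (s : seq I) (P : pred I) (F : I -> V) :
  rnorm (\sum_(i <- s | P i) F i) <= \sum_(i <- s | P i) rnorm (F i).
Proof.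
elim/big_rec2: _ => [|i a b _ le]; first by rewrite rnorm0.
by apply: le_trans (rnormD _ _) _; rewrite lerD2l.
Qed.

Lemma rnormZc (a : R[i]) x : rnorm (a *: x) = cabs a * rnorm x.
Proof. exact: rnormZ. Qed.

Lemma rnorm_scale1 (a : R[i]) x : cabs a = 1 -> rnorm (a *: x) = rnorm x.
Proof. by move=> a1; rewrite rnormZc a1 mul1r. Qed.

Definition rcvg u x := forall e : R, 0 < e ->
  exists N, forall n, (N <= n)%N -> rnorm (u n - x) <= e.

Lemma rcvgP u x : rcvg u x <-> u @ \oo --> x.
Proof.
split=> [ux|/cvgrPdist_le ux].
  apply/cvgrPdist_le => _ /pos_complexP[e e0 ->].
  have [N uN] := ux _ e0; exists N => // n /= Nn.
  by rewrite -rnormE lecR rnormB uN.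
move=> e e0; have [|N _ uN] := ux e%:C; first by rewrite ltcR.
by exists N => n Nn; rewrite -lecR rnormE distrC uN.
Qed.

Lemma rcvg_unique u x y : rcvg u x -> rcvg u y -> x = y.
Proof.
move=> ux uy; apply/eqP/negPn/negP => xy.
have r0 : 0 < rnorm (x - y).
  rewrite lt_neqAle rnorm_ge0 andbT eq_sym; apply/negP => /eqP /rnorm_eq0 /eqP.
  by rewrite subr_eq0 (negbTE xy).
have [N uN] := ux (rnorm (x - y) / 3) ltac:(lra).
have [M uM] := uy (rnorm (x - y) / 3) ltac:(lra).
have h1 := uN (maxn N M) (leq_maxl _ _); have h2 := uM (maxn N M) (leq_maxr _ _).
have := rnorm_leD (u (maxn N M) - y) (u (maxn N M) - x).
rewrite opprB addrC addrA subrK; lra.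
Qed.

End RealEps.

Lemma rcauchy (R : realType) (V : completeNormedModType R[i]) (u : nat -> V) :
  (forall e : R, 0 < e -> exists N, forall m n, (N <= m)%N -> (N <= n)%N ->
     rnorm (u m - u n) <= e) -> exists x, rcvg u x.
Proof.
move=> uc; exists (lim (u @ \oo)); apply/rcvgP; apply: cauchy_cvg.
apply/cauchy_ballP => _ /pos_complexP[e e0 ->]; near_simpl.
have [N uN] := uc (e / 2) ltac:(lra).
exists ([set n | (N <= n)%N], [set n | (N <= n)%N]); first by split; exists N.
move=> [m n] [/= Nm Nn]; rewrite -ball_normE /ball_ /= -rnormE ltcR.
by apply: le_lt_trans (uN _ _ Nm Nn) _; lra.
Qed.

Section HilbertBasics.
Variables (R : realType) (H : hilbertType R).
Implicit Types (x y z : H).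

Lemma inner_psd : psd (inner : H -> H -> R[i]).
Proof.
split=> [a x y z|x y|x]; first by rewrite linearDl linearZl_LR.
  by rewrite hermC expr0 mul1r.
by rewrite -inner_norm exprn_ge0.
Qed.

Lemma rnorm_sqr x : (rnorm x ^+ 2)%:C = inner x x.
Proof. by rewrite rmorphXn /= rnormE inner_norm. Qed.

Lemma rnorm_sqrE x : rnorm x ^+ 2 = complex.Re (inner x x).
Proof. by rewrite -rnorm_sqr. Qed.

Lemma rnorm_sqrD x y :
  rnorm (x + y) ^+ 2 = rnorm x ^+ 2 + rnorm y ^+ 2 + 2 * complex.Re (inner x y).
Proof.
rewrite !rnorm_sqrE !(psdDl inner_psd) !(psdDr inner_psd) (psdC inner_psd y x).
by case: (inner x x) (inner x y) (inner y y) => [a b] [c d] [e f] /=; ring.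
Qed.

Lemma inner_CS x y : cabs (inner x y) <= rnorm x * rnorm y.
Proof.
rewrite -(ler_pXn2r (n := 2)) ?nnegrE ?cabs_ge0 ?mulr_ge0 ?rnorm_ge0 //.
rewrite exprMn; have := psd_CS inner_psd x y.
by rewrite -!rnorm_sqr -rmorphM -cabsE -rmorphXn lecR.
Qed.

Lemma parseval M (a : nat -> H) :
  \sum_(j < M) rnorm (\sum_(n < M) uroot R M ^+ (j * n) *: a n) ^+ 2 =
  M%:R * \sum_(n < M) rnorm (a n) ^+ 2.
Proof.
apply: (@complexI R); rewrite rmorphM rmorph_nat !rmorph_sum /=.
under eq_bigr do rewrite rnorm_sqr.
by under [in RHS]eq_bigr do rewrite rnorm_sqr; rewrite (psd_parseval inner_psd).
Qed.

End HilbertBasics.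

Section OpBasics.
Variables (R : realType) (E F : normedModType R[i]).
Implicit Types (A B : bounded_op E F).

Lemma opD A x y : A (x + y) = A x + A y.
Proof. by have := bounded_op_linear A 1 x y; rewrite !scale1r. Qed.

Lemma op0 A : A 0 = 0.
Proof. by rewrite -(scale0r (0 : E)) bounded_opZ scale0r. Qed.

Lemma opN A x : A (- x) = - A x.
Proof. by rewrite -scaleN1r bounded_opZ scaleN1r. Qed.

Lemma opB A x y : A (x - y) = A x - A y.
Proof. by rewrite opD opN. Qed.

Lemma op_sum A I (s : seq I) (P : pred I) (f : I -> E) :
  A (\sum_(i <- s | P i) f i) = \sum_(i <- s | P i) A (f i).
Proof. by apply: (big_morph A) => [x y|]; rewrite ?opD ?op0. Qed.

Lemma add_opE A B x : (A + B) x = A x + B x. Proof. by []. Qed.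
Lemma sub_opE A B x : (A - B) x = A x - B x. Proof. by []. Qed.
Lemma scale_opE (a : R[i]) A x : (a *: A) x = a *: A x. Proof. by []. Qed.

Lemma sum_opE I (s : seq I) (P : pred I) (f : I -> bounded_op E F) x :
  (\sum_(i <- s | P i) f i) x = \sum_(i <- s | P i) f i x.
Proof. by apply: (big_morph (fun A : bounded_op E F => A x)). Qed.

Lemma opP A B : (forall x, A x = B x) -> A = B.
Proof. by move=> AB; apply/val_inj/funext. Qed.

Lemma rnorm_op A : rnorm A = opnorm A.
Proof. by []. Qed.

Lemma opnorm_le_bound A (c : R) :
  0 <= c -> (forall x, rnorm (A x) <= c * rnorm x) -> opnorm A <= c.
Proof.
move=> c0 Ac; apply: opnorm_lub => x x1; apply: le_trans (Ac x) _.
by rewrite ler_piMr // rnorm_le1.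
Qed.

Lemma mk_bounded (f : E -> F) (c : R) : linear f ->
  (forall x, rnorm (f x) <= c * rnorm x) -> exists A : bounded_op E F, A =1 f.
Proof.
move=> fl fc; have fb : f \in @is_bounded_op R E F.
  apply/asboolP; split => //; exists c%:C => x.
  by rewrite -!rnormE -rmorphM lecR.
by exists (BoundedOp fb).
Qed.

End OpBasics.

Section OpComplete.
Variables (R : realType) (E : normedModType R[i]) (F : completeNormedModType R[i]).

Lemma op_cauchy (A : nat -> bounded_op E F) :
  (forall e : R, 0 < e -> exists N, forall m n, (N <= m)%N -> (N <= n)%N ->
     opnorm (A m - A n) <= e) -> exists B, rcvg A B.
Proof.
move=> Ac.
have [f fP] : {f : E -> F & forall x, rcvg (fun n => A n x) (f x)}.
  suff h x : exists y, rcvg (fun n => A n x) y by exact: (choice h).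
  apply: rcauchy => e e0.
  have x0 : 0 < rnorm x + 1 by rewrite ltr_wpDl ?rnorm_ge0.
  have [N AN] := Ac (e / (rnorm x + 1)) (divr_gt0 e0 x0).
  exists N => m n Nm Nn; rewrite -sub_opE; apply: le_trans (opnorm_bound _ _) _.
  apply: le_trans (_ : e / (rnorm x + 1) * (rnorm x + 1) <= _).
    by apply: ler_pM; rewrite ?opnorm_ge0 ?rnorm_ge0 ?AN // lerDl.
  by rewrite divfK // gt_eqF.
have fl : linear f.
  move=> a x y; apply: (rcvg_unique (fP _)) => e e0.
  have a0 : 0 < cabs a + 1 by rewrite ltr_wpDl ?cabs_ge0.
  have [N1 h1] := fP x (e / 2 / (cabs a + 1)) ltac:(by rewrite !divr_gt0).
  have [N2 h2] := fP y (e / 2) ltac:(by rewrite !divr_gt0).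
  exists (maxn N1 N2) => n; rewrite geq_max => /andP[n1 n2].
  rewrite bounded_op_linear opprD addrACA -scalerBr.
  apply: le_trans (rnormD _ _) _; rewrite rnormZc.
  suff : cabs a * rnorm (A n x - f x) <= e / 2 by have := h2 _ n2; lra.
  apply: le_trans (_ : (cabs a + 1) * (e / 2 / (cabs a + 1)) <= _).
    by apply: ler_pM; rewrite ?cabs_ge0 ?rnorm_ge0 ?h1 // lerDl.
  by rewrite mulrC divfK // gt_eqF.
have unif e : 0 < e -> exists N, forall n, (N <= n)%N ->
    forall x, rnorm (A n x - f x) <= e * rnorm x.
  move=> e0; have [N AN] := Ac e e0; exists N => n Nn x.
  apply/ler_addgt0Pr => d d0; have [M hM] := fP x d d0.
  have := hM _ (leq_maxr N M); have := AN _ _ Nn (leq_maxl N M).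
  set m := maxn N M => AA Am; rewrite -(subrK (A m x) (A n x)) -addrA.
  apply: le_trans (rnormD _ _) _; apply: lerD => //.
  rewrite -sub_opE; apply: le_trans (opnorm_bound _ _) _.
  by rewrite ler_wpM2r ?rnorm_ge0.
have [N hN] := unif 1 ltr01.
have [|B BE] := @mk_bounded _ _ _ f (opnorm (A N) + 1) fl.
  move=> x; apply: le_trans (rnorm_leBD _ (A N x)) _.
  rewrite rnormB mulrDl lerD ?opnorm_bound //; exact: hN.
exists B => e e0; have [N' hN'] := unif e e0; exists N' => n Nn.
rewrite rnorm_op; apply: opnorm_le_bound => [|x]; first exact: ltW.
by rewrite sub_opE BE; exact: hN'.
Qed.

End OpComplete.

Section OpAlgebra.
Variables (R : realType) (H : normedModType R[i]).
Implicit Types S T : bounded_op H H.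

Lemma mul_opE S T x : (S * T) x = S (T x). Proof. by []. Qed.
Lemma one_opE x : (1 : bounded_op H H) x = x. Proof. by []. Qed.
Lemma expS_opE S n x : (S ^+ n.+1) x = S ((S ^+ n) x).
Proof. by rewrite exprS. Qed.

Lemma opnormX S n x : rnorm ((S ^+ n) x) <= opnorm S ^+ n * rnorm x.
Proof.
elim: n => [|n IH]; first by rewrite mul1r.
rewrite expS_opE exprS -mulrA; apply: le_trans (opnorm_bound _ _) _.
by rewrite ler_wpM2l ?opnorm_ge0.
Qed.

Lemma contr_le S x : opnorm S <= 1 -> rnorm (S x) <= rnorm x.
Proof.
move=> S1; apply: le_trans (opnorm_bound _ _) _.
by rewrite ler_piMl ?rnorm_ge0.
Qed.

Lemma contrX_le S n x : opnorm S <= 1 -> rnorm ((S ^+ n) x) <= rnorm x.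
Proof.
move=> S1; elim: n => // n IH; rewrite expS_opE.
exact: le_trans (contr_le _ S1) IH.
Qed.

Lemma contrX S n : opnorm S <= 1 -> opnorm (S ^+ n) <= 1.
Proof.
by move=> S1; apply: opnorm_le_bound => // x; rewrite mul1r; exact: contrX_le.
Qed.

Lemma scale_opM (a : R[i]) S T : (a *: S) * T = a *: (S * T).
Proof. exact/opP. Qed.

Lemma scale_opMr (a : R[i]) S T : S * (a *: T) = a *: (S * T).
Proof. by apply/opP => x; rewrite mul_opE !scale_opE bounded_opZ. Qed.

Lemma scale_opX (a : R[i]) S n : (a *: S) ^+ n = a ^+ n *: S ^+ n.
Proof.
elim: n => [|n IH]; first by rewrite !expr0 scale1r.
by rewrite !exprS IH scale_opM scale_opMr scalerA.
Qed.

End OpAlgebra.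

(** * Operators on tensor products *)

Section PsdOps.
Variable R : realType.

Lemma psd_pull (V W : normedModType R[i]) (D : W -> W -> R[i])
    (A : bounded_op V W) : psd D -> psd (fun x y => D (A x) (A y)).
Proof.
move=> DP; split=> [a x y z|x y|x].
- by rewrite bounded_op_linear (psd_lin DP).
- exact: psdC.
- exact: psd_ge0.
Qed.

Lemma psd_sub (V : lmodType R[i]) (D1 D2 : V -> V -> R[i]) : psd D1 -> psd D2 ->
  (forall x, D2 x x <= D1 x x) -> psd (fun x y => D1 x y - D2 x y).
Proof.
move=> P1 P2 le; split=> [a x y z|x y|x].
- by rewrite (psd_lin P1) (psd_lin P2); ring.
- by rewrite (psdC P1) (psdC P2 x) rmorphB.
- by rewrite subr_ge0.
Qed.

Lemma psd_add (V : lmodType R[i]) (D1 D2 : V -> V -> R[i]) : psd D1 -> psd D2 ->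
  psd (fun x y => D1 x y + D2 x y).
Proof.
move=> P1 P2; split=> [a x y z|x y|x].
- by rewrite (psd_lin P1) (psd_lin P2); ring.
- by rewrite (psdC P1) (psdC P2 x) rmorphD.
- by rewrite addr_ge0 ?(psd_ge0 P1) ?(psd_ge0 P2).
Qed.

Lemma psd_scale (V : lmodType R[i]) (D : V -> V -> R[i]) (c : R) : psd D ->
  0 <= c -> psd (fun x y => c%:C * D x y).
Proof.
move=> P c0; split=> [a x y z|x y|x].
- by rewrite (psd_lin P); ring.
- rewrite (psdC P) rmorphM; congr (_ * _) => /=.
  by rewrite conj_Creal //; apply: ger0_real; rewrite ler0c.
- by rewrite mulr_ge0 ?(psd_ge0 P) // ler0c.
Qed.

End PsdOps.

Section DenseExtension.
Variables (R : realType) (V : normedModType R[i]) (W : completeNormedModType R[i]).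
Variables (G : V -> W -> Prop) (c : R).
Hypothesis G_lin : forall (a : R[i]) v w v' w', G v w -> G v' w' ->
  G (a *: v + v') (a *: w + w').
Hypothesis G_bound : forall v w, G v w -> rnorm w <= c * rnorm v.
Hypothesis c0 : 0 <= c.
Hypothesis G_dense : forall v (e : R), 0 < e ->
  exists v' w', G v' w' /\ rnorm (v - v') <= e.

Lemma graph_dist v w v' w' : G v w -> G v' w' -> rnorm (w - w') <= c * rnorm (v - v').
Proof.
move=> Gv Gv'; have := G_bound (G_lin (-1) Gv' Gv).
by rewrite !scaleN1r ![- _ + _]addrC.
Qed.

(** [G] is a relation because a vector of the tensor product has many expressions by elementary
    tensors. Linearity and [G_bound] make it single-valued, and the extension is a limit along
    points of the graph. *)
Lemma dense_extension : exists B : bounded_op V W, forall v w, G v w -> B v = w.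
Proof.
have c1 : 0 < c + 1 by rewrite ltr_wpDl.
(* The value [g v] is pinned down by its distance to every point of the graph; linearity and
   boundedness then follow from this estimate and density. *)
have [g gP] : {g : V -> W & forall v v' w', G v' w' ->
    rnorm (g v - w') <= c * rnorm (v - v')}.
  suff h v : exists y, forall v' w', G v' w' -> rnorm (y - w') <= c * rnorm (v - v').
    exact: (choice h).
  have [s sP] : {s : nat -> V * W & forall n,
      G (s n).1 (s n).2 /\ rnorm (v - (s n).1) <= n.+1%:R^-1}.
    suff h n : exists p : V * W, G p.1 p.2 /\ rnorm (v - p.1) <= n.+1%:R^-1.
      exact: (choice h).
    have n0 : (0 : R) < n.+1%:R^-1 by rewrite invr_gt0 ltr0n.
    by have [v' [w' ?]] := G_dense v n0; exists (v', w').
  have small (e : R) : 0 < e -> exists N, forall n, (N <= n)%N ->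
      c * rnorm (v - (s n).1) <= e.
    move=> e0; have NP := archi_boundP (ltW (divr_gt0 c1 e0)).
    exists (Num.bound ((c + 1) / e)) => n Nn; have [_ sn] := sP n.
    apply: le_trans (_ : (c + 1) * n.+1%:R^-1 <= _).
      by apply: ler_pM; rewrite ?rnorm_ge0 // lerDl.
    rewrite ler_pdivrMr ?ltr0n // mulrC -ler_pdivrMr //.
    apply: le_trans (ltW NP) _; rewrite ler_nat.
    by apply: leq_trans Nn _.
  have [|y yP] := @rcauchy _ _ (fun n => (s n).2).
    move=> e e0; have [N NP] := small (e / 2) ltac:(lra); exists N => m n Nm Nn.
    apply: le_trans (graph_dist (sP m).1 (sP n).1) _.
    have := NP _ Nm; have := NP _ Nn.
    have := rnorm_leD (v - (s n).1) (v - (s m).1).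
    rewrite opprB addrC addrA subrK.
    move=> /(ler_wpM2l c0); lra.
  exists y => v' w' Gv'; apply/ler_addgt0Pr => e e0.
  have [N NP] := small (e / 2) ltac:(lra); have [M MP] := yP (e / 2) ltac:(lra).
  have := NP _ (leq_maxl N M); have := MP _ (leq_maxr N M).
  set m := maxn N M => h1 h2.
  have h3 := graph_dist (sP m).1 Gv'.
  have h4 := rnormD (y - (s m).2) ((s m).2 - w'); rewrite addrA subrK in h4.
  have := rnorm_leD (v - v') (v - (s m).1).
  rewrite opprB addrC addrA subrK => /(ler_wpM2l c0).
  by rewrite rnormB in h1; lra.
have gl : linear g.
  move=> a x y; apply/eqP; rewrite -subr_eq0; apply/eqP/rnorm_eq0.
  apply/le_anti; rewrite rnorm_ge0 andbT; apply/ler_addgt0Pr => e e0; rewrite add0r.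
  pose K := 2 * (c + 1) * (cabs a + 1).
  have a1 : 0 < cabs a + 1 by rewrite ltr_wpDl ?cabs_ge0.
  have K0 : 0 < K by rewrite !mulr_gt0.
  have [x' [u' [Gx dx]]] := G_dense x (divr_gt0 e0 K0).
  have [y' [v' [Gy dy]]] := G_dense y (divr_gt0 e0 K0).
  have h1 := gP (a *: x + y) _ _ (G_lin a Gx Gy).
  have h2 := gP x _ _ Gx; have h3 := gP y _ _ Gy.
  have -> : g (a *: x + y) - (a *: g x + g y) =
      (g (a *: x + y) - (a *: u' + v')) - (a *: (g x - u') + (g y - v')).
    rewrite (_ : a *: (g x - u') + _ = (a *: g x + g y) - (a *: u' + v')).
      by rewrite opprB addrA subrK.
    by rewrite scalerBr addrACA opprD.
  apply: le_trans (rnorm_leD _ _) _.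
  have h4 := rnormD (a *: (g x - u')) (g y - v').
  have h5 : rnorm (a *: x + y - (a *: x' + y')) <=
      cabs a * rnorm (x - x') + rnorm (y - y').
    by rewrite opprD addrACA -scalerBr; apply: le_trans (rnormD _ _) _; rewrite rnormZc.
  rewrite rnormZc in h4.
  have ca := cabs_ge0 a.
  have h6 := ler_wpM2l ca h2; have h7 := ler_wpM2l c0 h5.
  have h8 := ler_wpM2l ca dx.
  have h9 := ler_wpM2l c0 h8; have h10 := ler_wpM2l c0 dy.
  have : e / K * (2 * (c + 1) * (cabs a + 1)) = e by rewrite divfK ?gt_eqF.
  have eK : 0 < e / K by rewrite divr_gt0.
  have h11 := ler_wpM2l c0 dx.
  have h12 := mulr_ge0 (mulr_ge0 ca (ltW eK)) c0.
  have h13 := mulr_ge0 (ltW eK) c0.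
  have h14 := mulr_ge0 (ltW eK) ca.
  nra.
have G00 : G 0 0.
  have [v [w [Gv _]]] := G_dense 0 ltr01.
  by have := G_lin (-1) Gv Gv; rewrite !scaleN1r !addNr.
have [|B BE] := @mk_bounded _ _ _ g c gl.
  by move=> v; have := gP v _ _ G00; rewrite !subr0.
exists B => v w Gv; rewrite BE; apply/eqP; rewrite -subr_eq0; apply/eqP/rnorm_eq0.
apply/le_anti; rewrite rnorm_ge0 andbT; have := gP v _ _ Gv.
by rewrite subrr rnorm0 mulr0.
Qed.

End DenseExtension.

Section Elementary.
Variables (R : realType) (E H : hilbertType R) (EH : hilbert_tensor E H).
Implicit Types (s : seq (E * H)).

Definition elem s : EH := \sum_(x <- s) tensor EH x.1 x.2.

Lemma elem_cat s t : elem (s ++ t) = elem s + elem t.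
Proof. by rewrite /elem big_cat. Qed.

Lemma elem_scale (a : R[i]) s : elem [seq (a *: x.1, x.2) | x <- s] = a *: elem s.
Proof.
rewrite /elem big_map scaler_sumr; apply: eq_bigr => x _ /=.
by rewrite linearZl_LR.
Qed.

Lemma inner_elem s t : inner (elem s) (elem t) =
  \sum_(x <- s) \sum_(y <- t) inner x.1 y.1 * inner x.2 y.2.
Proof.
rewrite (psd_suml (inner_psd EH)); apply: eq_bigr => x _.
rewrite (psd_sumr (inner_psd EH)); apply: eq_bigr => y _.
exact: tensor_inner.
Qed.

Lemma elem_dense (v : EH) (e : R) : 0 < e -> exists s, rnorm (v - elem s) <= e.
Proof.
move=> e0; have [||y [vy [s _ sy]]] := @tensor_dense _ _ _ EH (ball v e%:C).
- by exists v; apply: ballxx; rewrite ltcR.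
- exact: ball_open; rewrite ltcR.
exists s; rewrite /elem sy; move: vy; rewrite -ball_normE /ball_ /=.
by rewrite -rnormE ltcR => /ltW.
Qed.

Lemma rnorm_tensor e h : rnorm (tensor EH e h) = rnorm e * rnorm h.
Proof.
apply/eqP; rewrite -(eqrXn2 (n := 2)) ?mulr_ge0 ?rnorm_ge0 // exprMn.
apply/eqP/(@complexI R); rewrite rnorm_sqr tensor_inner rmorphM.
by rewrite -!rnorm_sqr.
Qed.

Lemma op_elem_le (X : normedModType R[i]) (B : bounded_op EH X) (c : R) :
  0 <= c -> (forall s, rnorm (B (elem s)) <= c * rnorm (elem s)) -> opnorm B <= c.
Proof.
move=> c0 Bc; apply: opnorm_le_bound => // v; apply/ler_addgt0Pr => e e0.
have d0 : 0 < opnorm B + c + 1 by rewrite ltr_wpDl // addr_ge0 ?opnorm_ge0.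
have [s vs] := elem_dense v (divr_gt0 e0 d0).
have h1 := rnorm_leBD (B v) (B (elem s)); rewrite -opB in h1.
have h2 := opnorm_bound B (v - elem s).
have h3 := rnorm_leBD (elem s) v; rewrite rnormB in h3.
have h4 := Bc s; have h5 := ler_wpM2l c0 h3.
have h6 : (opnorm B + c) * rnorm (v - elem s) <= e.
  apply: le_trans (_ : (opnorm B + c + 1) * (e / (opnorm B + c + 1)) <= _).
    by apply: ler_pM; rewrite ?rnorm_ge0 ?addr_ge0 ?opnorm_ge0 // lerDl.
  by rewrite mulrC divfK // gt_eqF.
nra.
Qed.

Lemma op_elem_eq (X : normedModType R[i]) (B C : bounded_op EH X) :
  (forall e h, B (tensor EH e h) = C (tensor EH e h)) -> B = C.
Proof.
move=> BC; apply/eqP; rewrite -subr_eq0; apply/eqP/rnorm_eq0; rewrite rnorm_op.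
apply/le_anti; rewrite opnorm_ge0 andbT; apply: op_elem_le => // s.
rewrite mul0r sub_opE !op_sum -sumrB big1 ?rnorm0 // => x _.
by rewrite BC subrr.
Qed.

End Elementary.

Section TensorOp.
Variables (R : realType) (E F H : hilbertType R).
Variables (EH : hilbert_tensor E H) (FH : hilbert_tensor F H).
Implicit Types (A B : bounded_op E F) (S T : bounded_op H H).

Definition elem_map A S (s : seq (E * H)) := [seq (A x.1, S x.2) | x <- s].

(** [|A|^2 |S|^2 <,> <,> - <A, A> <S, S>] is the sum of [(|A|^2 <,> - <A, A>) <S, S>] and
    [|A|^2 <,> (|S|^2 <,> - <S, S>)], two Schur products of positive semidefinite forms. *)
Lemma elem_map_le A S s :
  rnorm (elem FH (elem_map A S s)) <= opnorm A * opnorm S * rnorm (elem EH s).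
Proof.
rewrite -(ler_pXn2r (n := 2)) ?nnegrE ?mulr_ge0 ?opnorm_ge0 ?rnorm_ge0 //.
rewrite !exprMn -lecR.
have -> (a b c : R) : (a * b * c)%:C = a%:C * b%:C * c%:C by rewrite -!rmorphM.
rewrite !rnorm_sqr !inner_elem.
have sq (X Y : hilbertType R) (B : bounded_op X Y) :
    psd (fun x y => (opnorm B ^+ 2)%:C * inner x y - inner (B x) (B y)).
  apply: psd_sub; first by apply: psd_scale; rewrite ?sqr_ge0 //; exact: inner_psd.
    exact: psd_pull (inner_psd Y).
  move=> x; rewrite -!rnorm_sqr -rmorphM lecR -exprMn ler_pXn2r ?nnegrE ?rnorm_ge0 //.
    exact: opnorm_bound.
  by rewrite mulr_ge0 ?opnorm_ge0 ?rnorm_ge0.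
have h1 := schur_ge0 (sq _ _ A) (psd_pull S (inner_psd H)) s.
have h2 := schur_ge0 (inner_psd E) (sq _ _ S) s.
have a0 : 0 <= (opnorm A ^+ 2)%:C by rewrite ler0c sqr_ge0.
have h := addr_ge0 h1 (mulr_ge0 a0 h2).
rewrite -subr_ge0; move: h; congr (_ <= _); rewrite big_map.
rewrite !mulr_sumr -big_split -sumrB; apply: eq_bigr => x _ /=.
rewrite big_map !mulr_sumr -big_split -sumrB; apply: eq_bigr => y _ /=.
by ring.
Qed.

Lemma tensor_op_ex A S : exists G : bounded_op EH FH,
  forall e h, G (tensor EH e h) = tensor FH (A e) (S h).
Proof.
have [|v w [s [-> ->]]|||B BE] := @dense_extension _ EH FH
  (fun v w => exists s, v = elem EH s /\ w = elem FH (elem_map A S s))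
  (opnorm A * opnorm S).
- move=> a _ _ _ _ [s [-> ->]] [t [-> ->]].
  exists ([seq (a *: x.1, x.2) | x <- s] ++ t); rewrite elem_cat elem_scale; split => //.
  rewrite /elem_map map_cat elem_cat -elem_scale -!map_comp; congr (elem _ _ + _).
  by apply: eq_map => x /=; rewrite bounded_opZ.
- exact: elem_map_le.
- by rewrite mulr_ge0 ?opnorm_ge0.
- move=> v e e0; have [s vs] := elem_dense v e0.
  by exists (elem EH s), (elem FH (elem_map A S s)); split=> //; exists s.
exists B => e h; apply: BE; exists [:: (e, h)].
by rewrite /elem /= !big_cons !big_nil !addr0.
Qed.

Lemma tensor_opE A S e h :
  tensor_op EH FH A S (tensor EH e h) = tensor FH (A e) (S h).
Proof.
rewrite /tensor_op; case: xgetP => [G _ GP|no]; first exact: GP.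
by have [G GP] := tensor_op_ex A S; case: (no G).
Qed.

Lemma tensor_op_elem A S s :
  tensor_op EH FH A S (elem EH s) = elem FH (elem_map A S s).
Proof.
by rewrite /elem op_sum big_map; apply: eq_bigr => x _; rewrite tensor_opE.
Qed.

Lemma tensor_op_le A S : opnorm (tensor_op EH FH A S) <= opnorm A * opnorm S.
Proof.
apply: op_elem_le => [|s]; first by rewrite mulr_ge0 ?opnorm_ge0.
by rewrite tensor_op_elem elem_map_le.
Qed.

Lemma tensor_opDl A B S :
  tensor_op EH FH (A + B) S = tensor_op EH FH A S + tensor_op EH FH B S.
Proof.
by apply: op_elem_eq => e h; rewrite add_opE !tensor_opE add_opE linearDl.
Qed.

Lemma tensor_opZl (a : R[i]) A S : tensor_op EH FH (a *: A) S = a *: tensor_op EH FH A S.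
Proof.
by apply: op_elem_eq => e h; rewrite scale_opE !tensor_opE scale_opE linearZl_LR.
Qed.

Lemma tensor_op0l S : tensor_op EH FH 0 S = 0.
Proof.
have := tensor_opZl 0 0 S; by rewrite !scale0r.
Qed.

Lemma tensor_opZr (a : R[i]) A S : tensor_op EH FH A (a *: S) = a *: tensor_op EH FH A S.
Proof.
by apply: op_elem_eq => e h; rewrite scale_opE !tensor_opE scale_opE linearZr_LR.
Qed.

Lemma tensor_op_suml I (r : seq I) (P : pred I) (A : I -> bounded_op E F) S :
  tensor_op EH FH (\sum_(i <- r | P i) A i) S =
  \sum_(i <- r | P i) tensor_op EH FH (A i) S.
Proof.
apply: (big_morph (fun A => tensor_op EH FH A S)) => [A1 A2|]; first exact: tensor_opDl.
exact: tensor_op0l.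
Qed.

End TensorOp.

Section TensorOpMul.
Variables (R : realType) (E F H : hilbertType R).
Variables (EH : hilbert_tensor E H) (FH : hilbert_tensor F H).
Implicit Types (A : bounded_op E F) (S T : bounded_op H H).

(** The factors act between different spaces, so their composite is no ring product; it is rebuilt
    as a bounded operator to be compared on elementary tensors. *)
Lemma tensor_op_mul1 A S T (v : EH) :
  tensor_op FH FH 1 S (tensor_op EH FH A T v) = tensor_op EH FH A (S * T) v.
Proof.
have [f fE] := @mk_bounded _ _ _ (fun v => tensor_op FH FH 1 S (tensor_op EH FH A T v))
  (opnorm (tensor_op FH FH 1 S) * opnorm (tensor_op EH FH A T))
  ltac:(by move=> a x y; rewrite !bounded_op_linear)
  ltac:(by move=> x; rewrite -mulrA (le_trans (opnorm_bound _ _)) // ler_wpM2l ?opnorm_ge0 ?opnorm_bound).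
rewrite -fE; congr (bounded_op_fun _ _); apply: op_elem_eq => e h.
by rewrite fE !tensor_opE.
Qed.

Lemma tensor_op_mul2 A S T (v : EH) :
  tensor_op EH FH A S (tensor_op EH EH 1 T v) = tensor_op EH FH A (S * T) v.
Proof.
have [f fE] := @mk_bounded _ _ _ (fun v => tensor_op EH FH A S (tensor_op EH EH 1 T v))
  (opnorm (tensor_op EH FH A S) * opnorm (tensor_op EH EH 1 T))
  ltac:(by move=> a x y; rewrite !bounded_op_linear)
  ltac:(by move=> x; rewrite -mulrA (le_trans (opnorm_bound _ _)) // ler_wpM2l ?opnorm_ge0 ?opnorm_bound).
rewrite -fE; congr (bounded_op_fun _ _); apply: op_elem_eq => e h.
by rewrite fE !tensor_opE.
Qed.

End TensorOpMul.

(** * Von Neumann's inequality for columns *)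

Section PolyPadding.
Variables (R : realType) (E F H : hilbertType R).
Variables (EH : hilbert_tensor E H) (FH : hilbert_tensor F H).
Implicit Types (p : seq (bounded_op E F)) (S : bounded_op H H).

Lemma op_poly_pad p d z : (size p <= d)%N -> op_poly p z = \sum_(j < d) z ^+ j *: p`_j.
Proof.
move=> pd; rewrite /op_poly (big_ord_widen _ (fun j => z ^+ j *: p`_j) pd) big_mkcond /=.
apply: eq_bigr => j _; case: ltnP => // pj.
by rewrite nth_default // scaler0.
Qed.

Lemma poly_calculus_pad p d S : (size p <= d)%N ->
  poly_calculus EH FH p S = \sum_(j < d) tensor_op EH FH p`_j (S ^+ j).
Proof.
move=> pd; rewrite /poly_calculus.
rewrite (big_ord_widen _ (fun j => tensor_op EH FH p`_j (S ^+ j)) pd) big_mkcond /=.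
apply: eq_bigr => j _; case: ltnP => // pj.
by rewrite nth_default // tensor_op0l.
Qed.

Lemma opnorm_one_le (X : normedModType R[i]) : opnorm (1 : bounded_op X X) <= 1.
Proof. by apply: opnorm_le_bound => // x; rewrite mul1r. Qed.

Lemma tensor_op_contr S (v : EH) : opnorm S <= 1 ->
  rnorm (tensor_op EH EH 1 S v) <= rnorm v.
Proof.
move=> S1; apply: contr_le; apply: le_trans (tensor_op_le _ _ _ _) _.
by apply: mulr_ile1; rewrite ?opnorm_ge0 ?opnorm_one_le.
Qed.

End PolyPadding.

Section Parseval.
Variables (R : realType) (H : hilbertType R).

(** Several vectors may share a degree: this covers a product of two polynomials, indexed by pairs
    of exponents. *)
Lemma parseval_deg (I : finType) (deg : I -> nat) (N : nat) (v : I -> H) :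
  (forall i, (deg i < N)%N) ->
  \sum_(j < N) rnorm (\sum_i uroot R N ^+ (j * deg i) *: v i) ^+ 2 =
  N%:R * \sum_(l < N) rnorm (\sum_(i | deg i == l) v i) ^+ 2.
Proof.
move=> dN; rewrite -(parseval N (fun l => \sum_(i | deg i == l) v i)).
apply: eq_bigr => j _; congr (rnorm _ ^+ 2).
rewrite (partition_big (fun i => Ordinal (dN i)) xpredT) //=.
apply: eq_bigr => l _; rewrite scaler_sumr; apply: eq_big => [i|i /eqP <- //].
by rewrite -val_eqE.
Qed.

Lemma sum_ord_deg (f : H -> R) (a : nat -> H) M N : f 0 = 0 -> (M <= N)%N ->
  \sum_(l < N) f (\sum_(i < M | i == l :> nat) a i) = \sum_(l < M) f (a l).
Proof.
move=> f0 MN; rewrite (big_ord_widen _ (fun l => f (a l)) MN) [RHS]big_mkcond /=.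
apply: eq_bigr => l _; case: ltnP => lM.
  rewrite (bigD1 (Ordinal lM)) //= big1 ?addr0 // => i /andP[/eqP il].
  by rewrite -val_eqE /= il eqxx.
by rewrite big1 // => i /eqP il; move: (ltn_ord i); rewrite il ltnNge lM.
Qed.

End Parseval.

Section ColumnSchur.
Variables (R : realType) (E F G H : hilbertType R).
Variables (EH : hilbert_tensor E H) (FH : hilbert_tensor F H) (GH : hilbert_tensor G H).

(** The difference of the two sides is the Schur product of [c <,> - <A, A> - <B, B>] on [E] with
    the defect form [<,> - <T, T>] on [H]. *)
Lemma column_schur (A : bounded_op E F) (B : bounded_op E G) (T : bounded_op H H)
    (c : R) s : 0 <= c ->
  (forall e, rnorm (A e) ^+ 2 + rnorm (B e) ^+ 2 <= c * rnorm e ^+ 2) ->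
  opnorm T <= 1 ->
  let X := elem EH s in
  rnorm (tensor_op EH FH A 1 X) ^+ 2 - rnorm (tensor_op EH FH A T X) ^+ 2 +
  (rnorm (tensor_op EH GH B 1 X) ^+ 2 - rnorm (tensor_op EH GH B T X) ^+ 2) <=
  c * (rnorm X ^+ 2 - rnorm (tensor_op EH EH 1 T X) ^+ 2).
Proof.
move=> c0 AB T1 /=.
have KP : psd (fun x y : E => c%:C * inner x y - (inner (A x) (A y) + inner (B x) (B y))).
  apply: psd_sub; first exact: psd_scale (inner_psd E) _.
    by apply: psd_add; apply: psd_pull; exact: inner_psd.
  by move=> x; rewrite -!rnorm_sqr -rmorphD -rmorphM lecR.
have DP : psd (fun x y : H => inner x y - inner (T x) (T y)).
  apply: psd_sub; first exact: inner_psd.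
    by apply: psd_pull; exact: inner_psd.
  by move=> x; rewrite -!rnorm_sqr lecR ler_pXn2r ?nnegrE ?rnorm_ge0 ?contr_le.
have h := schur_ge0 KP DP s; rewrite -subr_ge0 -ler0c.
move: h; congr (0 <= _).
have -> (a a' b b' x x' : R) : (c * (x - x') - (a - a' + (b - b')))%:C =
  c%:C * (x%:C - x'%:C) - (a%:C - a'%:C + (b%:C - b'%:C)).
  by rewrite !(rmorphB, rmorphD, rmorphM).
rewrite !tensor_op_elem !rnorm_sqr !inner_elem /elem_map !big_map.
rewrite mulrBr !mulr_sumr -!sumrB -big_split -sumrB.
apply: eq_bigr => x _; rewrite !big_map !mulr_sumr -!sumrB -big_split -sumrB.
by apply: eq_bigr => y _ /=; ring.
Qed.

End ColumnSchur.

Section VonNeumannLower.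
Variables (R : realType) (E F H : hilbertType R).
Variables (EH : hilbert_tensor E H) (FH : hilbert_tensor F H).
Variables (T : bounded_op H H) (T1 : opnorm T <= 1) (u : EH) (d M : nat).
(** Large enough for the product of the orbit polynomial, of degree below [M], with a polynomial of
    size at most [d]. *)
Let N := (M + d)%N.
Let x n := tensor_op EH EH 1 (T ^+ n) u.
Let X (j : nat) := \sum_(n < M) uroot R N ^+ (j * n) *: x (M - n.+1).

(* The [X j] are the values at the [N]-th roots of unity of the polynomial
   whose coefficients are the orbit of [u] in reverse order, so that Parseval
   makes the defects of the [X j] telescope. *)
Lemma vn_upper : \sum_(j < N) (rnorm (X j) ^+ 2 - rnorm (tensor_op EH EH 1 T (X j)) ^+ 2) =
  N%:R * (rnorm u ^+ 2 - rnorm (tensor_op EH EH 1 (T ^+ M) u) ^+ 2).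
Proof.
have MN : (M <= N)%N by rewrite leq_addr.
have mN (i : 'I_M) : (i < N)%N by rewrite (leq_trans _ MN).
have f0 (L : hilbertType R) : rnorm (0 : L) ^+ 2 = 0 by rewrite rnorm0 expr0n.
have TX j : tensor_op EH EH 1 T (X j) = \sum_(n < M) uroot R N ^+ (j * n) *: x (M - n).
  rewrite op_sum; apply: eq_bigr => n _; rewrite bounded_opZ; congr (_ *: _).
  by rewrite tensor_op_mul1 -exprS subnSK.
rewrite sumrB; under [X in _ - X]eq_bigr do rewrite TX.
rewrite (parseval_deg (fun i : 'I_M => x (M - i.+1)) mN).
rewrite (parseval_deg (fun i : 'I_M => x (M - i)) mN).
rewrite (sum_ord_deg (f := fun v => rnorm v ^+ 2) (fun i => x (M - i.+1))) //.
rewrite (sum_ord_deg (f := fun v => rnorm v ^+ 2) (fun i => x (M - i))) //.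
rewrite -mulrBr -sumrB; congr (_ * _).
rewrite -(big_mkord xpredT (fun i => rnorm (x (M - i.+1)) ^+ 2 - rnorm (x (M - i)) ^+ 2)).
rewrite (telescope_sumr (fun i => rnorm (x (M - i)) ^+ 2)) // subnn subn0.
congr (rnorm _ ^+ 2 - _); rewrite /x expr0.
have -> : tensor_op EH EH 1 1 = 1; last by [].
by apply: op_elem_eq => e h; rewrite tensor_opE.
Qed.

(** By Parseval the sum is [N] times the total defect of the coefficients [c l] of the product. For
    [d <= l < M] the coefficient is the full convolution [T^(M - l - 1) y], and these defects
    telescope; the remaining ones are nonnegative since [T] is a contraction. *)
Lemma vn_lower (p : seq (bounded_op E F)) : (size p <= d)%N -> (d <= M)%N ->
  let y := poly_calculus EH FH p T u in
  N%:R * (rnorm y ^+ 2 - rnorm (tensor_op FH FH 1 (T ^+ (M - d)) y) ^+ 2) <=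
  \sum_(j < N) (rnorm (tensor_op EH FH (op_poly p (uroot R N ^+ j)) 1 (X j)) ^+ 2 -
                rnorm (tensor_op EH FH (op_poly p (uroot R N ^+ j)) T (X j)) ^+ 2).
Proof.
move=> pd dM /=; set y := poly_calculus EH FH p T u.
pose I : finType := ('I_d * 'I_M)%type.
pose deg (i : I) := (i.1 + i.2)%N.
have degN i : (deg i < N)%N by rewrite /deg /N addnC -addnS leq_add // ltnW.
have PX U j : tensor_op EH FH (op_poly p (uroot R N ^+ j)) U (X j) =
    \sum_(i : I) uroot R N ^+ (j * deg i) *: tensor_op EH FH p`_i.1 U (x (M - i.2.+1)).
  rewrite (op_poly_pad _ pd) tensor_op_suml sum_opE /=.
  rewrite -(pair_bigA _ (fun (a : 'I_d) (b : 'I_M) => uroot R N ^+ (j * (a + b)) *: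
     tensor_op EH FH p`_a U (x (M - b.+1)))) /=.
  apply: eq_bigr => a _; rewrite tensor_opZl scale_opE op_sum scaler_sumr.
  apply: eq_bigr => b _; rewrite bounded_opZ scalerA -exprM -exprD.
  by rewrite -mulnDr.
pose c l : FH := \sum_(i : I | deg i == l) tensor_op EH FH p`_i.1 1 (x (M - i.2.+1)).
rewrite sumrB.
under eq_bigr do rewrite PX.
under [X in _ <= _ - X]eq_bigr do rewrite PX.
rewrite !(parseval_deg _ degN) -mulrBr ler_wpM2l // -sumrB.
have Tc l : \sum_(i : I | deg i == l) tensor_op EH FH p`_i.1 T (x (M - i.2.+1)) =
    tensor_op FH FH 1 T (c l).
  by rewrite op_sum; apply: eq_bigr => i _; rewrite tensor_op_mul1 mulr1.
under eq_bigr do rewrite Tc -/(c _).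
have cE l : (d <= l < M)%N -> c l = tensor_op FH FH 1 (T ^+ (M - l.+1)) y.
  move=> /andP[dl lM]; rewrite /y (poly_calculus_pad _ _ _ pd) sum_opE op_sum /c.
  rewrite -(pair_big_dep xpredT (fun (a : 'I_d) (b : 'I_M) => (a + b)%N == l)
    (fun a b => tensor_op EH FH p`_a 1 (x (M - b.+1)))) /=.
  apply: eq_bigr => a _.
  have al : (a <= l)%N by rewrite ltnW // (leq_trans (ltn_ord a)).
  have laM : (l - a < M)%N by rewrite (leq_ltn_trans (leq_subr _ _)).
  rewrite (bigD1 (Ordinal laM)) /=; last by rewrite subnKC.
  rewrite big1 => [|b /andP[/eqP abl]]; last by rewrite -val_eqE /= -abl addKn eqxx.
  rewrite addr0 /x tensor_op_mul2 mul1r tensor_op_mul1 -exprD.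
  by congr (tensor_op _ _ _ (T ^+ _) _); lia.
pose g l := rnorm (c l) ^+ 2 - rnorm (tensor_op FH FH 1 T (c l)) ^+ 2.
have g0 l : 0 <= g l.
  by rewrite subr_ge0 ler_pXn2r ?nnegrE ?rnorm_ge0 // tensor_op_contr.
rewrite -(big_mkord xpredT g) (big_cat_nat (n := d)) //=; last exact: leq_addl.
rewrite [\sum_(d <= i < N) g i](big_cat_nat (n := M)) //=; last exact: leq_addr.
apply: ler_wpDl; first exact: sumr_ge0.
apply: ler_wpDr; first exact: sumr_ge0.
have gE l : (d <= l < M)%N -> g l =
    rnorm (tensor_op FH FH 1 (T ^+ (M - l.+1)) y) ^+ 2 -
    rnorm (tensor_op FH FH 1 (T ^+ (M - l)) y) ^+ 2.
  move=> lM; rewrite /g cE // tensor_op_mul1 -exprS subnSK //.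
  by case/andP: lM.
rewrite (eq_big_nat _ _ gE).
rewrite (telescope_sumr (fun i => rnorm (tensor_op FH FH 1 (T ^+ (M - i)) y) ^+ 2)) //.
rewrite subnn expr0.
have -> : tensor_op FH FH 1 1 = 1; last by [].
by apply: op_elem_eq => e h; rewrite tensor_opE.
Qed.

End VonNeumannLower.

Section VonNeumann.
Variables (R : realType) (E F G H : hilbertType R).
Variables (EH : hilbert_tensor E H) (FH : hilbert_tensor F H) (GH : hilbert_tensor G H).

Lemma is_elem_sum (I : Type) (r : seq I) (f : I -> EH) :
  (forall i, exists s, f i = elem EH s) -> exists s, \sum_(i <- r) f i = elem EH s.
Proof.
move=> fP; elim: r => [|i r [s sP]]; first by exists [::]; rewrite /elem !big_nil.
by have [t tP] := fP i; exists (t ++ s); rewrite big_cons tP sP elem_cat.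
Qed.

(** [column_schur] compares [vn_lower] for [p] and [q] with [vn_upper], root by root. After division
    by [N] the remainders [|T^k y|^2] are at most [r^(2 k) |y|^2] and vanish as [k] grows. *)
Lemma vn_strict (p : seq (bounded_op E F)) (q : seq (bounded_op E G)) (c r : R)
    (T : bounded_op H H) s : 0 <= c -> 0 <= r < 1 -> opnorm T <= r ->
  (forall z, cabs z = 1 -> forall e,
    rnorm (op_poly p z e) ^+ 2 + rnorm (op_poly q z e) ^+ 2 <= c * rnorm e ^+ 2) ->
  rnorm (poly_calculus EH FH p T (elem EH s)) ^+ 2 +
  rnorm (poly_calculus EH GH q T (elem EH s)) ^+ 2 <= c * rnorm (elem EH s) ^+ 2.
Proof.
move=> c0 /andP[r0 r1] Tr pq; set u := elem EH s.
have T1 : opnorm T <= 1 by rewrite (le_trans Tr) // ltW.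
set y := poly_calculus EH FH p T u; set y' := poly_calculus EH GH q T u.
(* The successor keeps the number of roots positive even when both lists are empty. *)
pose d := (maxn (size p) (size q)).+1.
have pd : (size p <= d)%N by rewrite leqW // leq_maxl.
have qd : (size q <= d)%N by rewrite leqW // leq_maxr.
have step k : rnorm y ^+ 2 - (r ^+ k * rnorm y) ^+ 2 +
    (rnorm y' ^+ 2 - (r ^+ k * rnorm y') ^+ 2) <= c * rnorm u ^+ 2.
  have dM : (d <= k + d)%N by rewrite leq_addl.
  have small (L : hilbertType R) (LH : hilbert_tensor L H) (v : LH) :
      rnorm (tensor_op LH LH 1 (T ^+ k) v) ^+ 2 <= (r ^+ k * rnorm v) ^+ 2.
    rewrite ler_pXn2r ?nnegrE ?rnorm_ge0 ?mulr_ge0 ?exprn_ge0 ?rnorm_ge0 //.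
    apply: le_trans (opnorm_bound _ _) _; rewrite ler_wpM2r ?rnorm_ge0 //.
    apply: le_trans (tensor_op_le _ _ _ _) _.
    apply: le_trans (_ : 1 * r ^+ k <= _); last by rewrite mul1r.
    apply: ler_pM; rewrite ?opnorm_ge0 ?opnorm_one_le //.
    apply: opnorm_le_bound => [|x]; first exact: exprn_ge0.
    apply: le_trans (opnormX _ _ _) _; rewrite ler_wpM2r ?rnorm_ge0 //.
    by rewrite lerXn2r ?nnegrE ?opnorm_ge0.
  have h1 := vn_lower FH T1 u pd dM; have h2 := vn_lower GH T1 u qd dM.
  have h3 := vn_upper T u d (k + d).
  rewrite -/y -/y' addnK /= in h1 h2.
  set N := (k + d + d)%N in h1 h2 h3.
  have N0 : (0 : R) < N%:R by rewrite ltr0n /N /d addnS.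
  have e1 := small _ FH y; have e2 := small _ GH y'.
  have e3 : 0 <= c * rnorm (tensor_op EH EH 1 (T ^+ (k + d)) u) ^+ 2.
    by rewrite mulr_ge0 ?sqr_ge0.
  suff : N%:R * (rnorm y ^+ 2 - rnorm (tensor_op FH FH 1 (T ^+ k) y) ^+ 2) +
      N%:R * (rnorm y' ^+ 2 - rnorm (tensor_op GH GH 1 (T ^+ k) y') ^+ 2) <=
      N%:R * (c * (rnorm u ^+ 2 - rnorm (tensor_op EH EH 1 (T ^+ (k + d)) u) ^+ 2)).
    by rewrite -mulrDr ler_pM2l //; lra.
  apply: le_trans (lerD h1 h2) _.
  rewrite mulrCA -h3 mulr_sumr -big_split /=; apply: ler_sum => j _.
  have [t ->] : exists t, \sum_(n < k + d) uroot R N ^+ (j * n) *: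
      tensor_op EH EH 1 (T ^+ (k + d - n.+1)) u = elem EH t.
    apply: is_elem_sum => n.
    exists [seq (uroot R N ^+ (j * n) *: x.1, x.2) | x <- elem_map 1 (T ^+ (k + d - n.+1)) s].
    by rewrite elem_scale tensor_op_elem.
  apply: column_schur => //; apply: pq.
  by rewrite cabsX cabs_uroot expr1n.
apply/ler_addgt0Pr => e e0.
set K := rnorm y ^+ 2 + rnorm y' ^+ 2 + 1.
have K0 : 0 < K by rewrite ltr_wpDl // addr_ge0 ?sqr_ge0.
have [k kP] := @expr_small R (r ^+ 2) (e / K) ltac:(by rewrite sqr_ge0 /= expr_lt1)
  (divr_gt0 e0 K0).
have := step k; rewrite !exprMn -exprM mulnC exprM.
have : (r ^+ 2) ^+ k * K <= e by rewrite -ler_pdivlMr.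
have rk : 0 <= (r ^+ 2) ^+ k by rewrite exprn_ge0 // sqr_ge0.
rewrite /K; nra.
Qed.

(** Serves to replace a contraction [S] by the strict contraction [(1 - t) S]; the weights [j] come
    from [1 - (1 - t)^j <= j t]. *)
Lemma sum_scale_close (X : normedModType R[i]) n (b : nat -> X) (e : R) : 0 < e ->
  exists2 t0 : R, 0 < t0 & forall t, 0 <= t <= t0 -> t <= 1 ->
    rnorm (\sum_(j < n) b j - \sum_(j < n) ((1 - t)%:C) ^+ j *: b j) <= e.
Proof.
move=> e0; pose C := \sum_(j < n) j%:R * rnorm (b j) + 1.
have C0 : 0 < C by rewrite ltr_wpDl // sumr_ge0 // => j _; rewrite mulr_ge0 ?rnorm_ge0.
exists (e / C) => [|t /andP[t0 tC] t1]; first exact: divr_gt0.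
rewrite ler_pdivlMr // in tC.
rewrite -sumrB; apply: le_trans (rnorm_sum _ _ _) _.
apply: le_trans tC; rewrite /C mulrDr mulr1 mulr_sumr ler_wpDr //.
apply: ler_sum => j _; rewrite -[X in X - _]scale1r -scalerBl rnormZc mulrA.
rewrite ler_wpM2r ?rnorm_ge0 //.
rewrite -rmorphXn -(rmorph1 (real_complex R)) -rmorphB cabs_real.
have r0 : 0 <= 1 - t by lra.
have r1 : 1 - t <= 1 by lra.
elim: (j : nat) => [|i IH]; first by rewrite expr0 subrr normr0 mulr0.
rewrite exprS mulrS mulrDr mulr1.
have rn : 0 <= (1 - t) ^+ i by rewrite exprn_ge0.
have rn1 : (1 - t) ^+ i <= 1 by rewrite exprn_ile1.
move: IH; rewrite !ger0_norm ?subr_ge0 ?mulr_ile1 //.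
by nra.
Qed.

Theorem column_von_neumann (p : seq (bounded_op E F)) (q : seq (bounded_op E G))
    (c : R) (S : bounded_op H H) s : 0 <= c -> opnorm S <= 1 ->
  (forall z, cabs z = 1 -> forall e,
    rnorm (op_poly p z e) ^+ 2 + rnorm (op_poly q z e) ^+ 2 <= c * rnorm e ^+ 2) ->
  rnorm (poly_calculus EH FH p S (elem EH s)) ^+ 2 +
  rnorm (poly_calculus EH GH q S (elem EH s)) ^+ 2 <= c * rnorm (elem EH s) ^+ 2.
Proof.
move=> c0 S1 pq; set u := elem EH s.
pose X := tensor_op EH EH (1 : bounded_op E E) S.
set K := c * rnorm u ^+ 2; have K0 : 0 <= K by rewrite mulr_ge0 ?sqr_ge0.
apply/ler_addgt0Pr => e e0.
(* Both norms for the strict contraction are at most [K + 1], so an error [dl] in each adds at most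
   [4 dl (K + 1) + 2 dl^2 <= dl (4 K + 6)] to the sum of squares. *)
pose dl := Num.min 1 (e / (4 * K + 6)).
have dl0 : 0 < dl by rewrite lt_min ltr01 divr_gt0 //; lra.
have dl1 : dl <= 1 by rewrite ge_min lexx.
have dle : dl * (4 * K + 6) <= e by rewrite -ler_pdivlMr ?ge_min ?lexx ?orbT //; lra.
pose n := maxn (size p) (size q).
have pn : (size p <= n)%N by exact: leq_maxl.
have qn : (size q <= n)%N by exact: leq_maxr.
have close (L : hilbertType R) (LH : hilbert_tensor L H) (t : seq (bounded_op E L)) :
    (size t <= n)%N -> exists2 t0 : R, 0 < t0 & forall t', 0 <= t' <= t0 -> t' <= 1 ->
   rnorm (poly_calculus EH LH t S u - poly_calculus EH LH t ((1 - t')%:C *: S) u) <= dl.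
  move=> tn; have [t0 t00 tP] :=
    sum_scale_close n (fun j => tensor_op EH LH t`_j (S ^+ j) u) dl0.
  exists t0 => // t' t't0 t'1; apply: le_trans (tP _ t't0 t'1).
  rewrite !(poly_calculus_pad _ _ _ tn) !sum_opE le_eqVlt; apply/orP; left.
  apply/eqP; congr (rnorm (_ - _)).
  by apply: eq_bigr => j _; rewrite scale_opX tensor_opZr.
have [t1 t10 P1] := close _ FH p pn; have [t2 t20 P2] := close _ GH q qn.
pose t := Num.min (1 / 2) (Num.min t1 t2).
have tp : 0 < t by rewrite !lt_min t10 t20 divr_gt0.
have th : t <= 1 / 2 by rewrite ge_min lexx.
have tt1 : t <= t1 by rewrite !ge_min lexx !orbT.
have tt2 : t <= t2 by rewrite !ge_min lexx !orbT.
have := P1 t ltac:(by rewrite (ltW tp)) ltac:(lra).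
have := P2 t ltac:(by rewrite (ltW tp)) ltac:(lra).
have r01 : 0 <= 1 - t < 1 by lra.
have Tr : opnorm ((1 - t)%:C *: S) <= 1 - t.
  rewrite -rnorm_op rnormZc cabs_real ger0_norm; last by case/andP: r01.
  by rewrite ler_piMr //; case/andP: r01.
have := vn_strict s c0 r01 Tr pq; rewrite -/u -/K.
set y := poly_calculus EH FH p S u; set y' := poly_calculus EH GH q S u.
set z := poly_calculus EH FH p _ u; set z' := poly_calculus EH GH q _ u.
move=> zz yz' yz.
have h1 := rnorm_leBD y z; have h2 := rnorm_leBD y' z'.
have := rnorm_ge0 y; have := rnorm_ge0 y'; have := rnorm_ge0 z; have := rnorm_ge0 z'.
set a := rnorm y in yz h1 *; set b := rnorm y' in yz' h2 *.
set a' := rnorm z in zz h1 *; set b' := rnorm z' in zz h2 *.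
move=> b'0 a'0 b0 a0.
have ha : a ^+ 2 <= (a' + dl) ^+ 2 by rewrite ler_pXn2r ?nnegrE //; lra.
have hb : b ^+ 2 <= (b' + dl) ^+ 2 by rewrite ler_pXn2r ?nnegrE //; lra.
have ea : a' <= K + 1 by nra.
have eb : b' <= K + 1 by nra.
have h3 := ler_wpM2l (ltW dl0) ea; have h4 := ler_wpM2l (ltW dl0) eb.
have h5 := ler_wpM2l (ltW dl0) dl1; rewrite mulr1 in h5.
have sq (x : R) : (x + dl) ^+ 2 = x ^+ 2 + 2 * (dl * x) + dl * dl by ring.
by rewrite !sq in ha hb; lra.
Qed.

End VonNeumann.

(** * Resolvent bounds for the powers of a Ritt contraction *)

Section RittLower.
Variables (R : realType) (H : hilbertType R).
Implicit Types (S T A B : bounded_op H H) (c : R).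

(** The resolvent bound read as a lower bound: it makes sense at spectral points of the circle,
    where there is no resolvent, and it passes to powers and dilates. *)
Definition ritt_lower c S := forall z : R[i], 1 <= cabs z -> forall x,
  c * cabs (z - 1) * rnorm x <= rnorm (z *: x - S x).

Lemma contr_lower S (z : R[i]) x : opnorm S <= 1 ->
  (cabs z - 1) * rnorm x <= rnorm (z *: x - S x).
Proof.
move=> S1; have := rnorm_leBD (z *: x) (S x); rewrite rnormZc.
by have := contr_le x S1; lra.
Qed.

(** Off the closed disc this is the resolvent bound applied to [(z - T) x]; points of the circle are
    reached along [(1 + t) z] as [t] tends to 0. *)
Lemma ritt_lower_of_ritt T : contraction_op T -> ritt T ->
  exists c, 0 < c <= 1 /\ ritt_lower c T.
Proof.
move=> T1 [sp [C0 CP]].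
(* Raising the constant to at least 1 gives [c <= 1]. *)
pose C := Num.max C0 1; have C1 : 1 <= C by rewrite le_max lexx orbT.
have Cp : 0 < C by lra.
have strict z x : 1 < cabs z -> cabs (z - 1) * rnorm x <= C * rnorm (z *: x - T x).
  move=> z1; have z1' : 1 < `|z| by rewrite -cabsE ltcR.
  have [U UP] : exists U, is_inverse U (z *: (1 : bounded_op H H) - T).
    apply: contrapT => no; have := sp z no; rewrite /= => /(lt_le_trans z1').
    by rewrite ltxx.
  have rE : is_inverse (resolvent T z) (z *: (1 : bounded_op H H) - T).
    by rewrite /resolvent; case: xgetP => [V _ //|/(_ U)].
  have h1 : cabs (z - 1) * opnorm (resolvent T z) <= C.
    by rewrite le_max; apply/orP; left; apply: CP; exists z.
  have xE : x = resolvent T z (z *: x - T x).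
    by case: rE => /(congr1 (fun V : bounded_op H H => V x)).
  rewrite {1}xE; apply: le_trans (ler_wpM2l (cabs_ge0 _) (opnorm_bound _ _)) _.
  by rewrite mulrA ler_wpM2r ?rnorm_ge0.
exists C^-1; split; first by rewrite invr_gt0 Cp invf_le1.
move=> z z1 x; rewrite -mulrA mulrC ler_pdivrMr // [_ * C]mulrC.
apply/ler_addgt0Pr => e e0.
pose n := rnorm x; have n0 : 0 <= n := rnorm_ge0 x.
have z0 := cabs_ge0 z.
pose K := (C + 1) * cabs z * n + 1.
have K0 : 0 < K by rewrite ltr_wpDl // !mulr_ge0 //; lra.
pose t := e / K; have t0 : 0 < t by rewrite divr_gt0.
have tK : t * K = e by rewrite divfK // gt_eqF.
have ct : cabs (1 + t%:C) = 1 + t.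
  by rewrite -(rmorph1 (real_complex R)) -rmorphD cabs_real ger0_norm //; lra.
have h := strict ((1 + t%:C) * z) x ltac:(by rewrite cabsM ct; nra).
have h1 : cabs (z - 1) <= cabs ((1 + t%:C) * z - 1) + t * cabs z.
  have -> : z - 1 = ((1 + t%:C) * z - 1) - t%:C * z by ring.
  apply: le_trans (cabsD _ _) _; rewrite cabsN cabsM cabs_real ger0_norm //.
  exact: ltW.
have h2 : rnorm (((1 + t%:C) * z) *: x - T x) <= rnorm (z *: x - T x) + t * cabs z * n.
  have -> : ((1 + t%:C) * z) *: x - T x = (z *: x - T x) + (t%:C * z) *: x.
    by rewrite mulrDl mul1r scalerDl addrAC.
  apply: le_trans (rnormD _ _) _; rewrite rnormZc cabsM cabs_real ger0_norm //.
  exact: ltW.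
have h3 := ler_wpM2r n0 h1; have h4 := ler_wpM2l (ltW Cp) h2.
have : t * ((C + 1) * cabs z * n) <= e.
  by rewrite -tK ler_wpM2l ?(ltW t0) // lerDl.
rewrite -/n in h *; nra.
Qed.

Lemma psd_mul : psd (fun x y : R[i]^o => x * Num.conj y).
Proof.
split=> [a x y z|x y|x]; first by rewrite mulrDl mulrA.
  by rewrite rmorphM /= conjCK mulrC.
by rewrite -normCK exprn_ge0.
Qed.

Lemma parseval_scalar M (a : nat -> R[i]) :
  \sum_(j < M) cabs (\sum_(n < M) uroot R M ^+ (j * n) * a n) ^+ 2 =
  M%:R * \sum_(n < M) cabs (a n) ^+ 2.
Proof.
apply: (@complexI R); rewrite rmorphM rmorph_nat !rmorph_sum /=.
under eq_bigr do rewrite rmorphXn /= cabsE normCK.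
under [in RHS]eq_bigr do rewrite rmorphXn /= cabsE normCK.
exact: (psd_parseval psd_mul).
Qed.

Lemma geo_sum_op T (u : R[i]) n x :
  let y := \sum_(k < n) u ^+ k *: (T ^+ k) x in
  y - u *: T y = x - u ^+ n *: (T ^+ n) x.
Proof.
rewrite /= op_sum scaler_sumr -sumrB.
under eq_bigr => k _ do rewrite bounded_opZ scalerA -exprS -expS_opE -opprB.
rewrite sumrN -(big_mkord xpredT (fun k => u ^+ k.+1 *: (T ^+ k.+1) x - u ^+ k *: (T ^+ k) x)).
by rewrite (telescope_sumr (fun k => u ^+ k *: (T ^+ k) x)) // expr0 scale1r opprB.
Qed.

Lemma root_unit (z : R[i]) n : (0 < n)%N -> cabs z = 1 ->
  exists2 w, cabs w = 1 & w ^+ n = z.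
Proof.
move=> n0 /cis_onto[t _ ->]; exists (cis (t / n%:R)); first exact: cabs_cis.
by rewrite cisX -(mulr_natr (t / _)) divfK // pnatr_eq0 -lt0n.
Qed.

Lemma contrX_dec T k n x : opnorm T <= 1 -> (k <= n)%N ->
  rnorm ((T ^+ n) x) <= rnorm ((T ^+ k) x).
Proof. by move=> T1 kn; rewrite -(subnK kn) exprD; exact: contrX_le. Qed.

(* [x] is split along the [n]-th roots [mu_j] of [z]: [y_j], the average of the
   [mu_j^-k T^k x], has [(mu_j - T) y_j] proportional to [(z - T^n) x], and
   [sum_j |1 - mu_j|^-2 = n^2 |1 - z|^-2] by Parseval. *)
Lemma ritt_lower_pow_circle c T n (z : R[i]) x : opnorm T <= 1 -> 0 < c ->
  (forall w, cabs w = 1 -> forall y, c * cabs (w - 1) * rnorm y <= rnorm (w *: y - T y)) ->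
  (0 < n)%N -> cabs z = 1 ->
  c * cabs (z - 1) * rnorm ((T ^+ n) x) <= rnorm (z *: x - (T ^+ n) x).
Proof.
move=> T1 c0 cT n0 z1; set dl := rnorm (z *: x - _).
have dl0 : 0 <= dl := rnorm_ge0 _.
have [w w1 wn] := root_unit n0 z1.
have nz (v : R[i]) : cabs v = 1 -> v != 0 by move=> v1; rewrite -cabs_gt0 v1.
have u1 : cabs w^-1 = 1 by rewrite cabsV w1 invr1.
pose u j := w^-1 * uroot R n ^+ j.
have uj1 j : cabs (u j) = 1 by rewrite cabsM u1 cabsX cabs_uroot expr1n mulr1.
have ujn j : u j ^+ n = z^-1.
  by rewrite exprMn -exprM mulnC exprM uroot_expr // expr1n mulr1 exprVn wn.
pose Y (j : nat) := \sum_(k < n) (u j) ^+ k *: (T ^+ k) x.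
pose s (j : nat) := \sum_(k < n) (u j) ^+ k.
have sj j : cabs (s j) * cabs ((u j)^-1 - 1) = cabs (z - 1).
  rewrite -cabsM mulrBr mulr1.
  have -> : s j * (u j)^-1 - s j = (u j)^-1 * (s j * (1 - u j)).
    by rewrite mulrCA mulrBr mulr1 mulVf ?nz // mulrBr mulr1 mulrC.
  rewrite cabsM cabsV uj1 invr1 mul1r mulrC -opprB mulNr cabsN -subrX1 ujn.
  have -> : z^-1 - 1 = - z^-1 * (z - 1) by rewrite mulNr mulrBr mulVf ?nz // mulr1 opprB.
  by rewrite cabsM cabsN cabsV z1 invr1 mul1r.
have Yj j : c * cabs ((u j)^-1 - 1) * rnorm (Y j) <= dl.
  have -> : dl = rnorm ((u j)^-1 *: Y j - T (Y j)); last first.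
    by apply: cT; rewrite cabsV uj1 invr1.
  have -> : (u j)^-1 *: Y j - T (Y j) = (u j)^-1 *: (Y j - u j *: T (Y j)).
    by rewrite scalerBr scalerA mulVf ?nz // scale1r.
  rewrite rnorm_scale1 ?cabsV ?uj1 ?invr1 // geo_sum_op ujn.
  by rewrite /dl -(rnorm_scale1 (x - _) z1) scalerBr scalerA divff ?nz // scale1r.
have key j : (c * cabs (z - 1)) ^+ 2 * rnorm (Y j) ^+ 2 <= dl ^+ 2 * cabs (s j) ^+ 2.
  rewrite -!exprMn ler_pXn2r ?nnegrE ?mulr_ge0 ?cabs_ge0 ?rnorm_ge0 ?(ltW c0) //.
  have := ler_wpM2r (cabs_ge0 (s j)) (Yj j); congr (_ <= _).
  by rewrite -(sj j); ring.
have : (c * cabs (z - 1)) ^+ 2 * \sum_(j < n) rnorm (Y j) ^+ 2 <=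
    dl ^+ 2 * \sum_(j < n) cabs (s j) ^+ 2.
  by rewrite !mulr_sumr; apply: ler_sum => j _; exact: key.
have -> : \sum_(j < n) cabs (s j) ^+ 2 = n%:R * n%:R.
  have <- : n%:R * \sum_(k < n) cabs (w^-1 ^+ k) ^+ 2 = n%:R * n%:R :> R.
    congr (_ * _); under eq_bigr do rewrite cabsX u1 !expr1n.
    by rewrite sumr_const card_ord.
  rewrite -parseval_scalar; apply: eq_bigr => j _; congr (cabs _ ^+ 2).
  by apply: eq_bigr => k _; rewrite exprMn -exprM mulrC.
have -> : \sum_(j < n) rnorm (Y j) ^+ 2 = n%:R * \sum_(k < n) rnorm ((T ^+ k) x) ^+ 2.
  have <- : n%:R * \sum_(k < n) rnorm ((w^-1 ^+ k) *: (T ^+ k) x) ^+ 2 =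
     n%:R * \sum_(k < n) rnorm ((T ^+ k) x) ^+ 2.
    congr (_ * _); apply: eq_bigr => k _; rewrite rnorm_scale1 //.
    by rewrite cabsX u1 expr1n.
  rewrite -(parseval n (fun k => w^-1 ^+ k *: (T ^+ k) x)).
  apply: eq_bigr => j _; congr (rnorm _ ^+ 2).
  by apply: eq_bigr => k _; rewrite scalerA exprMn -exprM mulrC.
have nn : (0 : R) < n%:R by rewrite ltr0n.
(* Orbit norms decrease, so [|T^n x|] is at most the quadratic mean of the earlier ones. *)
have : n%:R * rnorm ((T ^+ n) x) ^+ 2 <= \sum_(k < n) rnorm ((T ^+ k) x) ^+ 2.
  have -> : n%:R * rnorm ((T ^+ n) x) ^+ 2 = \sum_(k < n) rnorm ((T ^+ n) x) ^+ 2.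
    by rewrite sumr_const card_ord mulr_natl.
  apply: ler_sum => k _; rewrite ler_pXn2r ?nnegrE ?rnorm_ge0 //.
  exact: contrX_dec T1 (ltnW (ltn_ord k)).
move=> h1 h2; rewrite -(ler_pXn2r (n := 2)) ?nnegrE ?mulr_ge0 ?cabs_ge0 ?rnorm_ge0 ?(ltW c0) //.
rewrite [X in X <= _]exprMn -(ler_pM2r (mulr_gt0 nn nn)).
apply: le_trans h2; rewrite -mulrA ler_wpM2l ?sqr_ge0 //.
by rewrite mulrC -mulrA ler_pM2l.
Qed.

(** On the circle, [|x| <= |T^n x| + |(w - T^n) x|] and [c |w - 1| <= 2] recover [|x|] at the cost
    of a factor 3. Outside, [z] is compared with [z / |z|]; the error [(|z| - 1) |x|] is controlled
    because [T^n] is a contraction. A factor 12 covers all losses. *)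
Lemma ritt_lower_pow c T n : opnorm T <= 1 -> 0 < c <= 1 -> ritt_lower c T ->
  (0 < n)%N -> ritt_lower (c / 12) (T ^+ n).
Proof.
move=> T1 /andP[c0 c1] cT n0 z z1 x.
have Tn1 := contrX n T1.
have circle w : cabs w = 1 -> c / 3 * cabs (w - 1) * rnorm x <= rnorm (w *: x - (T ^+ n) x).
  move=> w1; have := ritt_lower_pow_circle x T1 c0 _ n0 w1.
  move=> /(_ ltac:(by move=> v v1; apply: cT; rewrite v1)).
  have := rnorm_leBD (w *: x) ((T ^+ n) x); rewrite rnorm_scale1 //.
  set d := rnorm (w *: x - _); set t := rnorm ((T ^+ n) x); set r := rnorm x.
  have := cabsD w (-1); rewrite cabsN w1 cabs1.
  have := cabs_ge0 (w - 1); have := rnorm_ge0 (w *: x - (T ^+ n) x); rewrite -/d.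
  set m := cabs (w - 1) => d0 m0 m2 h1 h2.
  have h3 := ler_wpM2l (mulr_ge0 (ltW c0) m0) h1.
  have h4 : c * m <= 2 by nra.
  have h5 := ler_wpM2r d0 h4.
  by lra.
set r := rnorm x; set d := rnorm (z *: x - _).
have r0 : 0 <= r := rnorm_ge0 x.
have zz : (0 : R) < cabs z by lra.
have h1 := contr_lower z x Tn1; rewrite -/r -/d in h1.
pose w := (cabs z)^-1%:C * z.
have w1 : cabs w = 1.
  by rewrite cabsM cabs_real ger0_norm ?invr_ge0 ?cabs_ge0 // mulVf // gt_eqF.
have zw : cabs (z - w) = cabs z - 1.
  have -> : z - w = (1 - (cabs z)^-1)%:C * z by rewrite rmorphB rmorph1 mulrBl mul1r.
  rewrite cabsM cabs_real ger0_norm ?subr_ge0 ?invf_le1 //.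
  by rewrite mulrBl mul1r mulVf // gt_eqF.
have h2 : c / 3 * cabs (w - 1) * r <= d + (cabs z - 1) * r.
  apply: le_trans (circle w w1) _.
  have -> : w *: x - (T ^+ n) x = (z *: x - (T ^+ n) x) - (z - w) *: x.
    by rewrite scalerBl opprB [_ - _ + _]addrC addrA subrK.
  by apply: le_trans (rnorm_leD _ _) _; rewrite rnormZc zw.
have h3 : cabs (z - 1) <= cabs (w - 1) + (cabs z - 1).
  rewrite -zw; have -> : z - 1 = (w - 1) + (z - w) by ring.
  exact: cabsD.
have h4 := ler_wpM2r r0 h3.
have d0 : 0 <= d := rnorm_ge0 _.
have h5 := ler_wpM2l (ltW c0) h4.
have h6 : c * ((cabs z - 1) * r) <= (cabs z - 1) * r.
  by rewrite ler_piMl // mulr_ge0 // subr_ge0.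
by lra.
Qed.

(** [z - s S] is [s (z / s - S)], and [|z - 1| <= 2 |z - s|] because
    [1 - s <= |z| - s <= |z - s|]. *)
Lemma ritt_lower_scale c S (s : R) : ritt_lower c S -> 0 <= c -> 0 < s < 1 ->
  ritt_lower (c / 2) (s%:C *: S).
Proof.
move=> cS c0 /andP[s0 s1] z z1 x.
have sz : cabs (s%:C^-1 * z) = s^-1 * cabs z.
  by rewrite cabsM -fmorphV cabs_real ger0_norm // invr_ge0 ltW.
have sn : s%:C != 0 :> R[i] by rewrite -cabs_gt0 cabs_real normr_gt0 gt_eqF.
have zs : 1 <= cabs (s%:C^-1 * z).
  by rewrite sz mulrC ler_pdivlMr // mul1r (le_trans _ z1) // ltW.
have := cS _ zs x.
have -> : rnorm (z *: x - (s%:C *: S) x) = s * rnorm ((s%:C^-1 * z) *: x - S x).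
  have -> : z *: x - (s%:C *: S) x = s%:C *: ((s%:C^-1 * z) *: x - S x).
    by rewrite scalerBr scalerA mulrA divff // mul1r.
  by rewrite rnormZc cabs_real gtr0_norm.
move=> /(ler_wpM2l (ltW s0)); apply: le_trans.
have -> : s * (c * cabs (s%:C^-1 * z - 1) * rnorm x) = c * cabs (z - s%:C) * rnorm x.
  have -> : z - s%:C = s%:C * (s%:C^-1 * z - 1) by rewrite mulrBr mulrA divff // mul1r mulr1.
  by rewrite cabsM cabs_real gtr0_norm //; ring.
rewrite ler_wpM2r ?rnorm_ge0 // -mulrA ler_wpM2l //.
have h1 := cabsD (z - s%:C) (s%:C - 1); rewrite addrA subrK in h1.
have h2 := cabsBD z s%:C; rewrite cabs_real gtr0_norm // in h2.
have : cabs (s%:C - 1) = 1 - s.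
  by rewrite -(rmorph1 (real_complex R)) -rmorphB cabs_real ler0_norm ?opprB //; lra.
lra.
Qed.

End RittLower.

(** * Polynomials localized at 1 *)

Section Gearhart.
Variables (R : realType) (H : hilbertType R).
Implicit Types (S T A B : bounded_op H H) (c : R).

(** A triangle of slopes 1 and -1 that vanishes at 0 and [4 m] and is at least [m] on the middle
    half. *)
Definition tent (m k : nat) : nat := minn k (4 * m - k).

Lemma comm_pow A B n x : A * B = B * A -> A ((B ^+ n) x) = (B ^+ n) (A x).
Proof.
move=> AB; elim: n x => // n IH x; rewrite !expS_opE -IH.
by have := congr1 (fun U : bounded_op H H => U ((B ^+ n) x)) AB.
Qed.

(* Decay for the contraction [B / A], whose resolvent on the circle is bounded
   by [1 / kappa], in time of order [1 / kappa]. Parseval is applied to the orbit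
   cut off by a tent of length [4 m]: the cut-off derivative is bounded by 1
   while the cut-off itself is of order [m]. *)
Lemma gearhart A B (kappa : R) m : A * B = B * A ->
  (forall x, rnorm (B x) <= rnorm (A x)) ->
  (forall w, cabs w = 1 -> forall x, kappa * rnorm (A x) <= rnorm (w *: A x - B x)) ->
  0 < kappa -> 13 <= kappa * m%:R ->
  forall y, rnorm ((B ^+ (4 * m)) y) <= 8^-1 * rnorm ((A ^+ (4 * m)) y).
Proof.
move=> AB BA kAB k0 km y.
have m0 : (0 < m)%N.
  by rewrite lt0n; apply/negP => /eqP m0; move: km; rewrite m0 mulr0; lra.
pose N := (4 * m)%N; pose M := N.+1.
(* The orbit of [B / A] with denominators cleared by [A^N]. *)
pose v k := (A ^+ (N - k)) ((B ^+ k) y).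
pose phi k : R := (tent m k)%:R.
pose psi k : R := phi k - phi k.-1.
pose om := uroot R M.
have om1 j : cabs (om ^+ j) = 1 by rewrite cabsX cabs_uroot expr1n.
have omM : om ^+ M = 1 by apply: uroot_expr.
pose Y (j : nat) := \sum_(k < M) om ^+ (j * k) *: ((phi k)%:C *: v k).
pose Z (j : nat) := \sum_(k < M) om ^+ (j * k) *: ((psi k)%:C *: v k).
(* [Y j] with one factor [A] removed; at [k = N] the truncated exponent is harmless since
   [phi N = 0]. *)
pose U (j : nat) := \sum_(k < M) om ^+ (j * k) *:
  ((phi k)%:C *: (A ^+ (N - k.+1)) ((B ^+ k) y)).
have phi0 : phi 0%N = 0 by rewrite /phi /tent min0n.
have phiN : phi N = 0 by rewrite /phi /tent subnn minn0.
have AU j : A (U j) = Y j.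
  rewrite op_sum; apply: eq_bigr => k _; rewrite !bounded_opZ; congr (_ *: _).
  have := ltn_ord k; rewrite ltnS leq_eqVlt => /orP[/eqP ->|kN].
    by rewrite phiN !scale0r.
  by rewrite /v -expS_opE subnSK.
have BU j : om ^+ j *: B (U j) = \sum_(k < M) om ^+ (j * k) *: ((phi k.-1)%:C *: v k).
  rewrite big_ord_recl /= phi0 scale0r scaler0 add0r op_sum scaler_sumr.
  rewrite big_ord_recr /= phiN scale0r scaler0 op0 scaler0 addr0.
  apply: eq_bigr => k _; rewrite bounded_opZ [LHS]scalerA.
  rewrite -exprD bounded_opZ /bump /= add1n mulnS.
  by rewrite /v expS_opE (comm_pow _ _ (esym AB)).
have Zj j : Z j = Y j - om ^+ j *: B (U j).
  rewrite BU -sumrB; apply: eq_bigr => k _.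
  by rewrite -scalerBr -scalerBl -rmorphB.
have YZ j : kappa ^+ 2 * rnorm (Y j) ^+ 2 <= rnorm (Z j) ^+ 2.
  rewrite -exprMn ler_pXn2r ?nnegrE ?mulr_ge0 ?rnorm_ge0 ?(ltW k0) //.
  have -> : rnorm (Z j) = rnorm ((om ^+ j)^-1 *: A (U j) - B (U j)).
    rewrite Zj -AU -(rnorm_scale1 (_ *: A _ - _) (om1 j)) scalerBr scalerA divff ?scale1r //.
    by rewrite -cabs_gt0 om1.
  by rewrite -AU; apply: kAB; rewrite cabsV om1 invr1.
have vdec k : (k < N)%N -> rnorm (v k.+1) <= rnorm (v k).
  move=> kN; rewrite /v -(subnSK kN) expS_opE -(comm_pow _ _ (esym AB)) expS_opE.
  exact: BA.
have v0 k : (k <= N)%N -> rnorm (v k) <= rnorm (v 0%N).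
  by elim: k => // k IH kN; apply: le_trans (vdec _ kN) (IH (ltnW kN)).
have vN k : (k <= N)%N -> rnorm (v N) <= rnorm (v k).
  move=> kN; rewrite -(subKn kN); elim: (N - k)%N (leq_subr k N) => [|i IH] iN.
    by rewrite subn0.
  apply: le_trans (IH (ltnW iN)) _; rewrite -(subnSK iN).
  by apply: vdec; rewrite ltn_subrL (leq_trans _ iN).
have sumY : kappa ^+ 2 * \sum_(k < M) rnorm ((phi k)%:C *: v k) ^+ 2 <=
    \sum_(k < M) rnorm ((psi k)%:C *: v k) ^+ 2.
  have Mp : (0 : R) < M%:R by rewrite ltr0n.
  rewrite -(ler_pM2l Mp) mulrCA.
  rewrite -(parseval M (fun k => (phi k)%:C *: v k)) -(parseval M (fun k => (psi k)%:C *: v k)).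
  rewrite mulr_sumr; apply: ler_sum => j _; exact: YZ.
have upper : \sum_(k < M) rnorm ((psi k)%:C *: v k) ^+ 2 <= (5 * m)%:R * rnorm (v 0%N) ^+ 2.
  apply: le_trans (_ : \sum_(k < M) rnorm (v 0%N) ^+ 2 <= _); last first.
    rewrite sumr_const card_ord -[leLHS]mulr_natl ler_wpM2r ?sqr_ge0 // ler_nat.
    by rewrite /M /N; lia.
  apply: ler_sum => k _; rewrite ler_pXn2r ?nnegrE ?rnorm_ge0 // rnormZc cabs_real.
  apply: le_trans (_ : 1 * rnorm (v k) <= _); last by rewrite mul1r v0 // -ltnS.
  rewrite ler_wpM2r ?rnorm_ge0 // /psi /phi /tent.
  have : (minn k (4 * m - k) <= (minn k.-1 (4 * m - k.-1)).+1)%N by lia.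
  have : (minn k.-1 (4 * m - k.-1) <= (minn k (4 * m - k)).+1)%N by lia.
  rewrite -!(ler_nat R) ler_norml -!natr1; lra.
have lower : (2 * m)%:R * m%:R ^+ 2 * rnorm (v N) ^+ 2 <=
    \sum_(k < M) rnorm ((phi k)%:C *: v k) ^+ 2.
  rewrite -(big_mkord xpredT (fun k => rnorm ((phi k)%:C *: v k) ^+ 2)).
  have h1 : (m <= M)%N by rewrite /M /N; lia.
  have h2 : (3 * m <= M)%N by rewrite /M /N; lia.
  have h3 : (m <= 3 * m)%N by lia.
  rewrite (big_cat_nat (n := m)) //= [\sum_(m <= i < M) _](big_cat_nat (n := (3 * m)%N)) //=.
  apply: ler_wpDl; first by apply: sumr_ge0 => k _; rewrite sqr_ge0.
  apply: ler_wpDr; first by apply: sumr_ge0 => k _; rewrite sqr_ge0.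
  have -> : (2 * m = 3 * m - m)%N by lia.
  rewrite -mulrA mulr_natl -sumr_const_nat; apply: ler_sum_nat => k /andP[mk k3].
  rewrite -exprMn ler_pXn2r ?nnegrE ?mulr_ge0 ?rnorm_ge0 // rnormZc cabs_real.
  rewrite ger0_norm; last by rewrite /phi.
  apply: ler_pM; rewrite ?rnorm_ge0 //; last by apply: vN; rewrite /N; lia.
  by rewrite /phi ler_nat /tent; lia.
have mp : (0 : R) < m%:R by rewrite ltr0n.
have k20 : 0 <= kappa ^+ 2 by exact: sqr_ge0.
have := le_trans (ler_wpM2l k20 lower) (le_trans sumY upper).
rewrite !natrM; set a := rnorm (v N); set b := rnorm (v 0%N).
have a0 : 0 <= a := rnorm_ge0 _; have b0 : 0 <= b := rnorm_ge0 _.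
move=> h.
(* The upper sum has [4 m + 1 <= 5 m] terms; in the lower one the middle [2 m] terms weigh at least
   [m^2] each. With [kappa m >= 13], the inequality [2 * 169 >= 5 * 64] gives the factor 8. *)
have h1 : 2 * (kappa * m%:R) ^+ 2 * a ^+ 2 <= 5 * b ^+ 2.
  rewrite -(ler_pM2l mp); move: h; congr (_ <= _); ring.
have h2 : 169 <= (kappa * m%:R) ^+ 2.
  have -> : 169 = 13 ^+ 2 :> R by ring.
  by rewrite ler_pXn2r ?nnegrE //; lra.
have h3 : 64 * a ^+ 2 <= b ^+ 2.
  have := ler_wpM2r (sqr_ge0 a) h2; have := sqr_ge0 b; have := sqr_ge0 a; lra.
have : (8 * a) ^+ 2 <= b ^+ 2 by rewrite exprMn; move: h3; congr (_ * _ <= _); ring.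
rewrite ler_pXn2r ?nnegrE // ?mulr_ge0 //.
rewrite /a /b /v subnn !expr0 /N => h4.
by rewrite -ler_pdivlMl // in h4; rewrite subn0 in h4; apply: h4.
Qed.

End Gearhart.

Section CayleyPair.
Variables (R : realType) (H : hilbertType R).
Implicit Types (S : bounded_op H H) (a : R).

(** [(1 + a) / 2] normalizes [(1 - z) / (1 - a z)] to modulus 1 at [z = -1], where it is largest on
    the disc. For operators the difference of squares is a nonnegative combination of
    [|x|^2 - |S x|^2] and [|x + S x|^2]. *)
Lemma cayley_contr S a x : opnorm S <= 1 -> 0 <= a < 1 ->
  rnorm (((1 + a) / 2)%:C *: (x - S x)) <= rnorm (x - a%:C *: S x).
Proof.
move=> S1 /andP[a0 a1].
set b := (1 + a) / 2; have b0 : 0 <= b by rewrite /b; lra.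
rewrite rnormZc cabs_real ger0_norm //.
rewrite -(ler_pXn2r (n := 2)) ?nnegrE ?rnorm_ge0 //; last by rewrite mulr_ge0 ?rnorm_ge0.
rewrite exprMn.
have Sx := contr_le x S1.
have Sx2 : rnorm (S x) ^+ 2 <= rnorm x ^+ 2 by rewrite ler_pXn2r ?nnegrE ?rnorm_ge0.
have := sqr_ge0 (rnorm (x + S x)).
have Re_opp (w : R[i]) : complex.Re (- w) = - complex.Re w by case: w.
have Re_scale (w : R[i]) : complex.Re (a%:C * w) = a * complex.Re w.
  by case: w => u v /=; rewrite mul0r subr0.
have e1 : rnorm (x - S x) ^+ 2 =
    rnorm x ^+ 2 + rnorm (S x) ^+ 2 - 2 * complex.Re (inner x (S x)).
  by rewrite rnorm_sqrD rnormN -scaleN1r (psdZr (inner_psd H)) rmorphN1 mulN1r Re_opp mulrN.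
have e2 : rnorm (x - a%:C *: S x) ^+ 2 =
    rnorm x ^+ 2 + a ^+ 2 * rnorm (S x) ^+ 2 - 2 * a * complex.Re (inner x (S x)).
  rewrite rnorm_sqrD rnormN rnormZc cabs_real ger0_norm // exprMn -scaleNr.
  rewrite (psdZr (inner_psd H)) rmorphN mulNr Re_opp /=.
  have -> : Num.conj a%:C = a%:C :> R[i] by rewrite conj_Creal //; apply: ger0_real; rewrite ler0c.
  by rewrite Re_scale; ring.
rewrite rnorm_sqrD e1 e2; set n := rnorm x ^+ 2 in Sx2 *.
set n' := rnorm (S x) ^+ 2 in Sx2 *; set t := complex.Re _ => h.
have h1 : 0 <= (1 - a) * (2 + 2 * a) * (n - n').
  by rewrite !mulr_ge0 ?subr_ge0 //; lra.
have h2 : 0 <= (1 - a) * (1 - a) * (n + n' + 2 * t) by rewrite !mulr_ge0 ?subr_ge0 //; lra.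
rewrite -subr_ge0.
suff -> : n + a ^+ 2 * n' - 2 * a * t - b ^+ 2 * (n + n' - 2 * t) =
  ((1 - a) * (2 + 2 * a) * (n - n') + (1 - a) * (1 - a) * (n + n' + 2 * t)) / 4.
  by rewrite divr_ge0 ?addr_ge0.
by rewrite /b; field.
Qed.

(** The vector on the right is [- d (z - S) x], where [z] is the preimage of [w] under the Moebius
    map of [cayley_contr] and lies outside the open disc. Since [|d| |z - 1| = 1 - a], the Ritt
    bound at [z] loses just this factor; [|x - a S x| <= 2 |x|] accounts for the 2. *)
Lemma cayley_lower S c a (w : R[i]) x : opnorm S <= 1 -> ritt_lower c S -> 0 <= c ->
  0 <= a < 1 -> cabs w = 1 ->
  c * (1 - a) / 2 * rnorm (x - a%:C *: S x) <=
  rnorm (w *: (x - a%:C *: S x) - ((1 + a) / 2)%:C *: (x - S x)).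
Proof.
move=> S1 cS c0 /andP[a0 a1] w1; set b := (1 + a) / 2.
have b0 : 0 < b by rewrite /b; lra.
pose d := b%:C - a%:C * w.
have d0 : d != 0.
  rewrite -cabs_gt0; have := cabsBD b%:C (a%:C * w).
  rewrite cabsM w1 mulr1 !cabs_real !ger0_norm ?(ltW b0) //.
  rewrite -/d; move: b0; rewrite /b; lra.
pose z := - (w - b%:C) / d.
have eq1 : w *: (x - a%:C *: S x) - b%:C *: (x - S x) = - d *: (z *: x - S x).
  have dz : d * z = - (w - b%:C) by rewrite /z mulrC divfK.
  rewrite [RHS]scalerBr scalerA mulNr dz opprK scaleNr opprK /d !scalerBr scalerA !scalerBl.
  by rewrite opprD opprK addrACA [w * _]mulrC [- _ + _]addrC.
have eq2 : z - 1 = - (w * (1 - a)%:C) / d.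
  rewrite /z; apply: (mulIf d0); rewrite mulrBl !divfK // mul1r /d rmorphB rmorph1.
  ring.
have z1 : 1 <= cabs z.
  rewrite /z cabsM cabsN cabsV ler_pdivlMr ?cabs_gt0 // mul1r.
  rewrite -(ler_pXn2r (n := 2)) ?nnegrE ?cabs_ge0 // !cabs_sqr.
  have := cabs_sqr w; rewrite w1 expr1n.
  have := cabs_Re w; rewrite w1 => /ler_normlP[_].
  rewrite /d; case: w {w1 d d0 z eq1 eq2} => u v /= u1 uv.
  have -> : a * v + 0 * u = a * v by ring.
  have -> : a * u - 0 * v = a * u by ring.
  rewrite -subr_ge0.
  have -> : (u - b) ^+ 2 + (v - 0) ^+ 2 - ((b - a * u) ^+ 2 + (0 - a * v) ^+ 2) =
    (1 - a) * (1 + a) * (1 - u).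
    have vE : v ^+ 2 = 1 - u ^+ 2 by rewrite uv; ring.
    transitivity (u ^+ 2 - 2 * u * b + v ^+ 2 - a ^+ 2 * u ^+ 2
      + 2 * b * a * u - a ^+ 2 * v ^+ 2); first by ring.
    by rewrite vE /b; field.
  by rewrite !mulr_ge0 //; lra.
rewrite eq1 rnormZc cabsN.
apply: le_trans (ler_wpM2l (cabs_ge0 d) (cS z z1 x)).
rewrite eq2 cabsM cabsN cabsM w1 mul1r cabsV cabs_real ger0_norm ?subr_ge0 ?(ltW a1) //.
have -> : cabs d * (c * ((1 - a) / cabs d) * rnorm x) = c * (1 - a) * rnorm x.
  by field; rewrite cabs_eq0.
have := rnorm_leD x (a%:C *: S x); rewrite rnormZc cabs_real ger0_norm //.
have := contr_le x S1; have r0 := rnorm_ge0 x => h1 h2.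
have h3 : rnorm (x - a%:C *: S x) <= 2 * rnorm x.
  have := ler_wpM2l a0 h1; have : a * rnorm x <= rnorm x by rewrite ler_piMl // ltW.
  lra.
have k0 : 0 <= c * (1 - a) by rewrite mulr_ge0 // subr_ge0 ltW.
have := ler_wpM2l k0 h3; lra.
Qed.

End CayleyPair.

Section PolyEval.
Variables (R : realType) (H : normedModType R[i]).
Implicit Types (S : bounded_op H H) (P Q : {poly R[i]}) (c : R[i]).

Definition poly_op Q S : bounded_op H H := \sum_(j < size Q) Q`_j *: S ^+ j.

Lemma poly_op_pad Q S d : (size Q <= d)%N -> poly_op Q S = \sum_(j < d) Q`_j *: S ^+ j.
Proof.
move=> Qd; rewrite /poly_op (big_ord_widen _ (fun j => Q`_j *: S ^+ j) Qd) big_mkcond /=.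
apply: eq_bigr => j _; case: ltnP => // Qj.
by rewrite nth_default // scale0r.
Qed.

Lemma poly_opD P Q S : poly_op (P + Q) S = poly_op P S + poly_op Q S.
Proof.
pose d := maxn (size P) (size Q).
rewrite (@poly_op_pad P S d) ?leq_maxl // (@poly_op_pad Q S d) ?leq_maxr //.
rewrite (@poly_op_pad _ S d) ?size_polyD // -big_split; apply: eq_bigr => j _.
by rewrite coefD scalerDl.
Qed.

Lemma poly_opZ c Q S : poly_op (c *: Q) S = c *: poly_op Q S.
Proof.
rewrite (@poly_op_pad (c *: Q) S (size Q)) ?size_scale_leq // scaler_sumr.
by apply: eq_bigr => j _; rewrite coefZ scalerA.
Qed.

Lemma poly_op1 S : poly_op 1 S = 1.
Proof. by rewrite /poly_op size_poly1 big_ord1 coef1 scale1r. Qed.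

Lemma poly_op_mulX Q S : poly_op (Q * 'X) S = S * poly_op Q S.
Proof.
rewrite (@poly_op_pad _ S (size Q).+1) ?(leq_trans (size_polyMleq _ _)) ?size_polyX ?addn2 //.
rewrite big_ord_recl coefMX /= scale0r add0r mulr_sumr; apply: eq_bigr => j _.
by rewrite coefMX /= /bump /= add1n scale_opMr exprS.
Qed.

Lemma poly_opM P Q S : poly_op (P * Q) S = poly_op P S * poly_op Q S.
Proof.
elim/poly_ind: P => [|P c IH].
  by rewrite mul0r /poly_op size_poly0 big_ord0 mul0r.
rewrite mulrDl mul_polyC poly_opD poly_opZ mulrAC poly_op_mulX IH.
by rewrite poly_opD poly_op_mulX -alg_polyC poly_opZ poly_op1 mulrDl mulrA scale_opM mul1r.
Qed.

Lemma poly_opX P n S : poly_op (P ^+ n) S = poly_op P S ^+ n.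
Proof. by elim: n => [|n IH]; rewrite ?expr0 ?poly_op1 // !exprS poly_opM IH. Qed.

Lemma poly_op_affine c S : poly_op (1 - c *: 'X) S = 1 - c *: S.
Proof.
have -> : (1 - c *: 'X : {poly R[i]}) = 1 + (- c) *: (1 * 'X).
  by rewrite mul1r scaleNr.
by rewrite poly_opD poly_op1 poly_opZ poly_op_mulX poly_op1 mulr1 scaleNr.
Qed.

End PolyEval.

Section Numeric.
Variable R : realType.

Lemma bernoulli_sub (x : R) n : 0 <= x <= 1 -> 1 - n%:R * x <= (1 - x) ^+ n.
Proof.
move=> /andP[x0 x1]; elim: n => [|n IH]; first by rewrite mul0r subr0 expr0.
have x1' : 0 <= 1 - x by rewrite subr_ge0.
rewrite exprS -natr1; apply: le_trans (ler_wpM2l x1' IH).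
have : 0 <= n%:R * (x * x) by rewrite mulr_ge0 // mulr_ge0.
lra.
Qed.

(** Comparison with [(1 - x)^n]: the product is at most 1, and Bernoulli's inequality bounds
    [(1 - x)^n] below by 1/2. *)
Lemma expr1D_le2 (x : R) n : 0 <= x -> n%:R * x <= 1 / 2 -> (1 + x) ^+ n <= 2.
Proof.
move=> x0 nx; case: n nx => [|n] nx; first by rewrite expr0; lra.
have x1 : x <= 1.
  apply: le_trans (_ : n.+1%:R * x <= 1); last by lra.
  by rewrite ler_peMl // ler1n.
have h1 : 1 / 2 <= (1 - x) ^+ n.+1.
  by apply: le_trans (bernoulli_sub n.+1 _); [lra|rewrite x0].
have h2 : ((1 + x) * (1 - x)) ^+ n.+1 <= 1.
  apply: exprn_ile1; first by rewrite mulr_ge0 //; lra.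
  have : 0 <= x * x by rewrite mulr_ge0.
  by lra.
rewrite exprMn in h2.
have h3 : 0 <= (1 + x) ^+ n.+1 by rewrite exprn_ge0 //; lra.
have := ler_wpM2l h3 h1; lra.
Qed.

End Numeric.

Section Localizer.
Variables (R : realType).

Section Poly.
Variables (a s : R) (L N : nat).
Let b := (1 + a) / 2.

Definition geo_poly : {poly R[i]} := \sum_(j < L) (s%:C *: 'X) ^+ j.

(* A truncation of [(1 + tau B)^N], where [B = (1 + s z) / (1 - s z)] and
   [a = (1 - tau) / (1 + tau)], an approximation of [exp (N tau B)]. *)
Definition localizer : {poly R[i]} :=
  (b^-1%:C *: ((1 - (a * s)%:C *: 'X) * geo_poly)) ^+ N.

Lemma geo_polyM : (1 - s%:C *: 'X) * geo_poly = 1 - (s%:C *: 'X) ^+ L.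
Proof. by rewrite -opprB mulNr -subrX1 opprB. Qed.

(** [gearhart] is applied to [y = G^N x], where [G] truncates the inverse of [1 - s S]. Then [A^N y]
    is [b^N] times the value of the localizer, and [B^N y] is [b^N (1 - (s S)^L)^N x], of norm at
    least [3/4 b^N |x|]. The factor 8 leaves 6, more than 3. *)
Lemma localizer_lower (H : hilbertType R) (S : bounded_op H H) (c : R) m x :
  opnorm S <= 1 -> ritt_lower c S -> 0 < c -> 0 < s < 1 -> 0 <= a < 1 ->
  N = (4 * m)%N -> 13 <= c * (1 - a) / 4 * m%:R -> N%:R * s ^+ L <= 1 / 4 ->
  3 * rnorm x <= rnorm (poly_op localizer S x).
Proof.
move=> S1 cS c0 /andP[s0 s1] /andP[a0 a1] NE mP NL.
have b0 : 0 < b by rewrite /b; lra.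
have bn : b%:C != 0 :> R[i] by rewrite -cabs_gt0 cabs_real normr_gt0 gt_eqF.
pose pA : {poly R[i]} := 1 - (a * s)%:C *: 'X.
pose pB : {poly R[i]} := b%:C *: (1 - s%:C *: 'X).
pose A := poly_op pA S; pose B := poly_op pB S; pose G := poly_op geo_poly S.
have S1' : opnorm (s%:C *: S) <= 1.
  rewrite -rnorm_op rnormZc cabs_real gtr0_norm //.
  by apply: mulr_ile1; rewrite ?rnorm_ge0 // ltW.
have cS' := ritt_lower_scale cS (ltW c0) (introT andP (conj s0 s1)).
have AE y : A y = y - a%:C *: (s%:C *: S) y.
  by rewrite /A /pA poly_op_affine sub_opE !scale_opE scalerA -rmorphM.
have BE y : B y = b%:C *: (y - (s%:C *: S) y).
  by rewrite /B /pB poly_opZ poly_op_affine !scale_opE sub_opE scale_opE.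
have AB : A * B = B * A by rewrite -!poly_opM mulrC.
have a01 : 0 <= a < 1 by rewrite a0.
have := @gearhart _ _ A B (c / 2 * (1 - a) / 2) m AB.
have h1 y : rnorm (B y) <= rnorm (A y) by rewrite AE BE; exact: cayley_contr.
have h2 w : cabs w = 1 -> forall y, c / 2 * (1 - a) / 2 * rnorm (A y) <= rnorm (w *: A y - B y).
  by move=> w1 y; rewrite AE BE; apply: cayley_lower => //; rewrite divr_ge0 // ltW.
move=> /(_ h1 h2).
have k0 : 0 < c / 2 * (1 - a) / 2 by rewrite !mulr_gt0 // subr_gt0.
have mP' : 13 <= c / 2 * (1 - a) / 2 * m%:R by lra.
move=> /(_ k0 mP' ((G ^+ N) x)); rewrite -NE.
have -> : (A ^+ N) ((G ^+ N) x) = b%:C ^+ N *: poly_op localizer S x.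
  rewrite /localizer exprZn poly_opZ scale_opE scalerA -exprMn -rmorphM divff ?gt_eqF //.
  by rewrite rmorph1 expr1n scale1r exprMn poly_opM !poly_opX.
have -> : (B ^+ N) ((G ^+ N) x) = b%:C ^+ N *: (((1 - (s%:C *: S) ^+ L) ^+ N) x).
  rewrite -mul_opE -!poly_opX -poly_opM -exprMn /pB -scalerAl geo_polyM exprZn poly_opZ.
  rewrite scale_opE poly_opX; congr (_ *: (_ ^+ N : bounded_op H H) x).
  rewrite exprZn -['X^L]mul1r.
  have -> : (1 - s%:C ^+ L *: (1 * 'X^L) : {poly R[i]}) = 1 + (- s%:C ^+ L) *: 'X^L.
    by rewrite mul1r scaleNr.
  rewrite poly_opD poly_op1 poly_opZ poly_opX scaleNr scale_opX.
  have := poly_op_mulX 1 S; rewrite mul1r poly_op1 mulr1 => -> //.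
rewrite !rnormZc mulrCA ler_pM2l; last by rewrite cabsX exprn_gt0 // cabs_gt0.
move=> h3.
set t := s ^+ L in NL.
have t0 : 0 <= t by rewrite exprn_ge0 // ltW.
have t1 : t <= 1 by rewrite exprn_ile1 // ltW.
have h4 : (1 - t) ^+ N * rnorm x <= rnorm (((1 - (s%:C *: S) ^+ L) ^+ N) x).
  elim: (N) => [|n IH]; first by rewrite !expr0 mul1r.
  rewrite expS_opE exprS -mulrA; set y := bounded_op_fun (_ ^+ n) x in IH *.
  apply: le_trans (ler_wpM2l _ IH) _; first by rewrite subr_ge0.
  rewrite sub_opE one_opE scale_opX scale_opE.
  have := rnorm_leBD y (s%:C ^+ L *: (S ^+ L) y); rewrite rnormZc cabsX cabs_real gtr0_norm //.
  have := ler_wpM2l t0 (contrX_le L y S1); rewrite -/t; lra.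
have h5 : 3 / 4 <= (1 - t) ^+ N.
  by apply: le_trans (bernoulli_sub N _); rewrite ?t0 //; lra.
have := ler_wpM2r (rnorm_ge0 x) h5; have := rnorm_ge0 x; lra.
Qed.

(** Off 1 the function [B] is nearly imaginary on the circle, so [1 + tau B] exceeds modulus 1 only
    to second order in [1 - a]: this is the term [x]. The choice of [s] makes the real part of [B]
    of order [1 - a], so that its contribution is of second order too. *)
Lemma localizer_upper (z : R[i]) (eta : R) : cabs z = 1 -> 0 < eta <= cabs (z - 1) ->
  1 / 2 <= a < 1 -> s = 1 - (1 - a) / 2 -> 0 < s < 1 ->
  N%:R * (32 * (1 - a) ^+ 2 / eta ^+ 2) <= 1 / 2 -> N%:R * s ^+ L <= 1 / 4 ->
  cabs localizer.[z] <= 2.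
Proof.
move=> z1 /andP[e0 ez] /andP[a0 a1] sE /andP[s0 s1] N1 N2.
set x := 32 * _ / _ in N1; set t := s ^+ L in N2.
have x0 : 0 <= x by rewrite divr_ge0 // ?sqr_ge0 // mulr_ge0 // sqr_ge0.
have t0 : 0 <= t by rewrite exprn_ge0 // ltW.
have b0 : 3 / 4 <= b by rewrite /b; lra.
have bp : 0 < b by lra.
pose g := geo_poly.[z]; pose u := 1 - (a * s)%:C * z.
rewrite /localizer horner_exp cabsX.
have e1 : (b^-1%:C *: ((1 - (a * s)%:C *: 'X) * geo_poly)).[z] = b^-1%:C * (u * g).
  by rewrite hornerZ hornerM !hornerE.
rewrite e1 -(ler_pXn2r (n := 2)) ?nnegrE ?exprn_ge0 ?cabs_ge0 // -exprM mulnC exprM.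
have gE : (1 - s%:C * z) * g = 1 - (s%:C * z) ^+ L.
  have := congr1 (horner^~ z) geo_polyM; rewrite hornerM !hornerE.
  by [].
have gle : cabs (1 - s%:C * z) * cabs g <= 1 + t.
  rewrite -cabsM gE; apply: le_trans (cabsD _ _) _.
  by rewrite cabsN cabs1 cabsX cabsM z1 mulr1 cabs_real gtr0_norm.
have sz : eta / 2 <= cabs (1 - s%:C * z).
  have h1 := cabsD (z - s%:C * z) (s%:C * z - 1); rewrite addrA subrK in h1.
  rewrite [cabs (s%:C * z - 1)]cabsB in h1.
  have h2 : cabs (z - s%:C * z) = 1 - s.
    have -> : z - s%:C * z = (1 - s)%:C * z by rewrite rmorphB rmorph1 mulrBl mul1r.
    by rewrite cabsM z1 mulr1 cabs_real ger0_norm // subr_ge0 ltW.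
  have h3 := cabsBD 1 (s%:C * z); rewrite cabs1 cabsM z1 cabs_real gtr0_norm // mulr1 in h3.
  lra.
have ule : cabs u ^+ 2 <= b ^+ 2 * (1 + x) * cabs (1 - s%:C * z) ^+ 2.
  have sz2 : (eta / 2) ^+ 2 <= cabs (1 - s%:C * z) ^+ 2.
    by rewrite ler_pXn2r ?nnegrE ?cabs_ge0 //; lra.
  have k1 : 9 / 16 <= b ^+ 2.
    have -> : 9 / 16 = (3 / 4) ^+ 2 :> R by field.
    by rewrite ler_pXn2r ?nnegrE //; lra.
  have k2 : 2 * (1 - a) ^+ 2 <= b ^+ 2 * x * cabs (1 - s%:C * z) ^+ 2.
    apply: le_trans (_ : 9 / 16 * x * (eta / 2) ^+ 2 <= _); last first.
      apply: ler_pM => //; [|exact: sqr_ge0|exact: ler_wpM2r].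
      by apply: mulr_ge0 => //; lra.
    have -> : 9 / 16 * x * (eta / 2) ^+ 2 = 9 / 2 * (1 - a) ^+ 2.
      by rewrite /x; field; rewrite gt_eqF.
    by have := sqr_ge0 (1 - a); lra.
  rewrite mulrDr mulr1 mulrDl; apply: le_trans (lerD (lexx _) k2).
  rewrite /u !cabs_sqr; have := cabs_sqr z; rewrite z1 expr1n.
  have := cabs_Re z; rewrite z1 => /ler_normlP[u2 u1].
  case: z z1 ez u1 u2 {e1 g gE gle sz sz2 k2 u} => p q /= _ _ p1 p2 pq.
  rewrite !mul0r !subr0 !sub0r !addr0 !sqrrN.
  have vE : q ^+ 2 = 1 - p ^+ 2 by rewrite pq; ring.
  rewrite !exprMn vE -subr_ge0 /b.
  rewrite [leRHS](_ : _ = (1 - a) / 4 * (8 * (1 - a) -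
    (2 + 2 * a) * (1 - s ^+ 2) - (1 - a) * (1 + s ^+ 2 + 2 * s * p))); last by field.
  have sp : s * p <= 1 by nra.
  have s2 : s ^+ 2 <= 1 by rewrite exprn_ile1 // ltW.
  have k3 : (2 + 2 * a) * (1 - s ^+ 2) <= 4 * (1 - a).
    have -> : 1 - s ^+ 2 = (1 - s) * (1 + s) by ring.
    have : (1 - s) * (1 + s) <= 1 - a by nra.
    have : 0 <= (1 - s) * (1 + s) by apply: mulr_ge0; lra.
    by nra.
  have k4 : (1 - a) * (1 + s ^+ 2 + 2 * s * p) <= (1 - a) * 4.
    by rewrite ler_wpM2l ?subr_ge0 ?(ltW a1) //; lra.
  by apply: mulr_ge0; lra.
have key : cabs (b^-1%:C * (u * g)) ^+ 2 <= (1 + x) * (1 + t) ^+ 2.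
  rewrite !cabsM cabs_real gtr0_norm ?invr_gt0 // !exprMn exprVn.
  rewrite ler_pdivrMl ?exprn_gt0 //.
  apply: le_trans (ler_wpM2r (sqr_ge0 _) ule) _.
  have := ler_pXn2r (n := 2) isT; move=> /(_ R (cabs (1 - s%:C * z) * cabs g) (1 + t)).
  rewrite !nnegrE mulr_ge0 ?cabs_ge0 // addr_ge0 // => /(_ isT isT); rewrite gle exprMn => h.
  by rewrite -[leLHS]mulrA -[leLHS]mulrA ler_wpM2l ?sqr_ge0 // ler_wpM2l ?addr_ge0.
apply: le_trans (_ : ((1 + x) * (1 + t) ^+ 2) ^+ N <= _).
  by rewrite lerXn2r ?nnegrE ?sqr_ge0 ?mulr_ge0 ?addr_ge0.
rewrite exprMn -exprM.
have -> : (2 : R) ^+ 2 = 2 * 2 by [].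
apply: ler_pM; rewrite ?exprn_ge0 ?addr_ge0 //; first exact: expr1D_le2.
by apply: expr1D_le2 => //; rewrite natrM; lra.
Qed.

End Poly.

(** The lower bound needs [N (1 - a)] of order [1 / c], the upper one [N (1 - a)^2] of order
    [eta^2]; hence [h = 1 - a] is taken of order [c eta^2]. *)
Lemma localizer_ex (c eta : R) : 0 < c <= 1 -> 0 < eta -> exists Q : {poly R[i]},
  (forall z, cabs z = 1 -> eta <= cabs (z - 1) -> cabs Q.[z] <= 2) /\
  (forall (H : hilbertType R) (S : bounded_op H H), opnorm S <= 1 -> ritt_lower c S ->
     forall x, 3 * rnorm x <= rnorm (poly_op Q S x)).
Proof.
move=> /andP[c0 c1] e0.
(* Rounding [m] up gives [c h m <= 53], so [N h^2 <= 212 h / c], which must not exceed [eta^2 / 64];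
   and [212 * 64 = 53 * 256]. *)
have [K [K0 KE]] : exists K : R, 0 < K /\ K = 53 * 256 by exists (53 * 256); split; first lra.
pose h := Num.min (1 / 2) (c * eta ^+ 2 / K).
have e2 : 0 < eta ^+ 2 by rewrite exprn_gt0.
have h0 : 0 < h.
  rewrite lt_min; apply/andP; split; first by lra.
  by rewrite divr_gt0 // mulr_gt0.
have h1 : h <= 1 / 2 by rewrite ge_min lexx.
have h2 : h * K <= c * eta ^+ 2 by rewrite -ler_pdivlMr // ge_min lexx orbT.
have ch0 : 0 < c * h by rewrite mulr_gt0.
have ch1 : c * h <= 1 by apply: mulr_ile1; lra.
pose m := (Num.trunc (52 / (c * h))).+1.
have q0 : 0 <= 52 / (c * h) by rewrite divr_ge0 // ltW.
have m1 : 52 <= c * h * m%:R.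
  by rewrite mulrC -ler_pdivrMr // ltW // /m truncnS_gt.
have m2 : c * h * m%:R <= 53.
  have : m%:R <= 52 / (c * h) + 1 by rewrite /m -natr1 lerD2r truncn_le.
  move=> /(ler_wpM2l (ltW ch0)); rewrite mulrDr [_ * (52 / _)]mulrC divfK ?gt_eqF //; lra.
pose N := (4 * m)%N; have NE : (N%:R : R) = 4 * m%:R by rewrite natrM.
have N0 : (0 : R) < N%:R by rewrite ltr0n /N muln_gt0.
pose a := 1 - h; pose s := 1 - h / 2.
have s01 : 0 < s < 1 by rewrite /s; lra.
have [L LP] := @expr_small R s (1 / 4 / N%:R) ltac:(by case/andP: s01 => ? ?; rewrite ltW)
  ltac:(by rewrite divr_gt0).
rewrite ler_pdivlMr // mulrC in LP.
have ah : 1 - a = h by rewrite /a; lra.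
exists (localizer a s L N); split.
  move=> z z1 ez; apply: (@localizer_upper a s L N z eta) => //; rewrite ?e0 ?ah //.
  - by rewrite /a; lra.
  - rewrite NE mulrA ler_pdivrMr //.
    have : c * h * m%:R * h * 128 <= 53 * h * 128 by rewrite !ler_wpM2r // ltW.
    have : c * (4 * m%:R * (32 * h ^+ 2)) = c * h * m%:R * h * 128 by ring.
    move=> E1 E2; rewrite -(ler_pM2l c0) E1.
    by rewrite KE in h2; lra.
move=> H S S1 cS x; apply: (@localizer_lower a s L N H S c m) => //.
- by rewrite /a; lra.
- by rewrite ah; lra.
Qed.

End Localizer.

(** * The operator-valued disc algebra *)

Section Bisection.
Variable R : realType.

Lemma half_pow_small (e : R) : 0 < e -> exists n, (1 / 2 : R) ^+ n <= e.
Proof. by apply: expr_small; lra. Qed.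

(* [P n s t] speaks of the dyadic square with side [2^-n] and lower left corner
   [(s, t)]. *)
Lemma unit_square_bisect (P : nat -> R -> R -> Prop) :
  (forall n s t, let h := (1 / 2) ^+ n.+1 in P n.+1 s t -> P n.+1 (s + h) t ->
     P n.+1 s (t + h) -> P n.+1 (s + h) (t + h) -> P n s t) ->
  (forall s t, 0 <= s <= 1 -> 0 <= t <= 1 -> exists2 d, 0 < d &
     forall n s' t', let h := (1 / 2) ^+ n in
       0 <= s' -> s' <= s <= s' + h -> 0 <= t' -> t' <= t <= t' + h -> h <= d ->
       s' + h <= 1 -> t' + h <= 1 -> P n s' t') ->
  P 0%N 0 0.
Proof.
move=> sub loc; apply: contrapT => nP.
have hp n : 0 < (1 / 2 : R) ^+ n by apply: exprn_gt0; lra.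
have child (np : nat * (R * R)) : exists q : R * R, ~ P np.1 np.2.1 np.2.2 ->
    [/\ ~ P np.1.+1 q.1 q.2, np.2.1 <= q.1 <= np.2.1 + (1 / 2) ^+ np.1.+1 &
        np.2.2 <= q.2 <= np.2.2 + (1 / 2) ^+ np.1.+1].
  case: np => n [s t] /=; set h := (1 / 2) ^+ n.+1; have h0 : 0 < h := hp _.
  have [?|n1] := pselect (P n.+1 s t); last by exists (s, t) => _ /=; split => //; lra.
  have [?|n2] := pselect (P n.+1 (s + h) t); last by exists (s + h, t) => _ /=; split => //; lra.
  have [?|n3] := pselect (P n.+1 s (t + h)); last by exists (s, t + h) => _ /=; split => //; lra.
  have [?|n4] := pselect (P n.+1 (s + h) (t + h)).
    by exists (s, t) => nPn; exfalso; apply: nPn; exact: sub.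
  by exists (s + h, t + h) => _ /=; split => //; lra.
have [f fP] := choice child.
pose p := fix p n := if n is n'.+1 then f (n', p n') else (0 : R, 0 : R).
have pP n : ~ P n (p n).1 (p n).2 by elim: n => // n /(fP (n, p n))[].
have ps n : (p n).1 <= (p n.+1).1 <= (p n).1 + (1 / 2) ^+ n.+1.
  by have [] := fP (n, p n) (pP n).
have pt n : (p n).2 <= (p n.+1).2 <= (p n).2 + (1 / 2) ^+ n.+1.
  by have [] := fP (n, p n) (pP n).
have nested (u : nat -> R) : (forall n, u n <= u n.+1 <= u n + (1 / 2) ^+ n.+1) ->
    u 0%N = 0 -> exists2 l, 0 <= l <= 1 & forall n,
      [/\ 0 <= u n, u n <= l <= u n + (1 / 2) ^+ n & u n + (1 / 2) ^+ n <= 1].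
  move=> uP u0.
  have inc n m : (n <= m)%N -> u n <= u m.
    move=> nm; rewrite -(subnK nm); elim: (m - n)%N => // k IH.
    by rewrite addSn; have := uP (k + n)%N; lra.
  have dec n m : (n <= m)%N -> u m + (1 / 2) ^+ m <= u n + (1 / 2) ^+ n.
    move=> nm; rewrite -(subnK nm); elim: (m - n)%N => // k IH.
    by rewrite addSn; have := uP (k + n)%N; rewrite !exprS in IH *; lra.
  have le1 n : u n + (1 / 2) ^+ n <= 1 by have := dec 0%N n (leq0n _); rewrite u0 expr0; lra.
  have ge0 n : 0 <= u n by rewrite -u0; exact: inc.
  have hs : has_sup (range u).
    split; first by exists (u 0%N), 0%N.
    by exists 1 => _ [n _ <-]; have := le1 n; have := hp n; lra.
  have ul n : u n <= sup (range u) by apply: (ub_le_sup hs.2); exists n.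
  have lu n : sup (range u) <= u n + (1 / 2) ^+ n.
    apply: ge_sup hs.1 _ => _ [m _ <-]; have [nm|/ltnW mn] := leqP n m.
      by have := dec _ _ nm; have := hp m; lra.
    by have := inc _ _ mn; have := hp n; lra.
  exists (sup (range u)) => [|n].
    by have := ul 0%N; have := lu 0%N; rewrite u0 expr0; lra.
  by split => //; rewrite ul lu.
have [s s01 sP] := nested _ ps erefl; have [t t01 tP] := nested _ pt erefl.
have [d d0 dP] := loc s t s01 t01; have [n nd] := half_pow_small d0.
have [? ? ?] := sP n; have [? ? ?] := tP n.
exact: (pP n) (dP n _ _ _ _ _ _ nd _ _).
Qed.

(** Compactness of the disc as an induction principle on its subsets, by bisection of the square
    [[-1, 1]^2]. It yields uniform continuity, boundedness and [spectrum_gap]. *)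
Lemma disc_cover (Q : (R[i] -> Prop) -> Prop) :
  (forall A B : R[i] -> Prop, (forall z, A z -> B z) -> Q B -> Q A) ->
  (forall A B, Q A -> Q B -> Q (fun z => A z \/ B z)) ->
  (forall p, cabs p <= 1 -> exists2 d, 0 < d & Q (fun z => cabs (z - p) <= d /\ cabs z <= 1)) ->
  Q (fun z => cabs z <= 1).
Proof.
move=> Qsub QU Qloc.
have Q0 : Q (fun=> False).
  have [|d d0] := Qloc 0; first by rewrite cabs0.
  exact: Qsub.
pose sq n s t (z : R[i]) := let h := (1 / 2 : R) ^+ n in
  cabs z <= 1 /\ s <= (complex.Re z + 1) / 2 <= s + h /\ t <= (complex.Im z + 1) / 2 <= t + h.
suff : Q (sq 0%N 0 0).
  apply: Qsub => z z1; split=> //; rewrite expr0.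
  have := cabs_Re z; have := cabs_Im z; move=> /ler_normlP[? ?] /ler_normlP[? ?].
  by split; lra.
apply: (unit_square_bisect (P := fun n s t => Q (sq n s t))).
  move=> n s t h q1 q2 q3 q4; apply: Qsub (QU _ _ (QU _ _ q1 q2) (QU _ _ q3 q4)).
  move=> z [z1 []]; rewrite /sq; have -> : (1 / 2 : R) ^+ n = h + h by rewrite /h exprS; lra.
  rewrite -/h; set x := (_ + 1) / 2; set y := (_ + 1) / 2 => hx hy.
  have [xs|xs] := leP x (s + h); have [yt|yt] := leP y (t + h).
  - by left; left; split => //; lra.
  - by right; left; split => //; lra.
  - by left; right; split => //; lra.
  - by right; right; split => //; lra.
move=> s t s01 t01; pose p : R[i] := (2 * s - 1) +i* (2 * t - 1).
have near n s' t' z : let h := (1 / 2 : R) ^+ n in sq n s' t' z ->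
    s' <= s <= s' + h -> t' <= t <= t' + h -> cabs (z - p) <= 4 * h.
  move=> h [z1 [hx hy]] hs ht; apply: le_trans (cabs_ReIm _) _.
  rewrite -/h in hx hy; rewrite /p; case: z z1 hx hy => x y /= _ hx hy.
  suff : `|x - (2 * s - 1)| <= 2 * h /\ `|y - (2 * t - 1)| <= 2 * h by move=> []; lra.
  by split; rewrite ler_norml; lra.
have [p1|p1] := leP (cabs p) 1.
  have [d d0 Qd] := Qloc p p1; exists (d / 4) => [|n s' t' h _ hs _ ht hd _ _]; first by lra.
  apply: Qsub Qd => z sz; split; last by case: sz.
  by have := near _ _ _ _ sz hs ht; rewrite -/h; lra.
(* The limit point of the squares may lie outside the disc; small squares around it then contain no
   point of the disc. *)
exists ((cabs p - 1) / 8) => [|n s' t' h _ hs _ ht hd _ _]; first by lra.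
apply: Qsub Q0 => z sz.
have := near _ _ _ _ sz hs ht; rewrite -/h => zp.
have := cabsBD p z; rewrite cabsB; have [z1 _] := sz; lra.
Qed.

Definition disc_cont (V : normedModType R[i]) (f : R[i] -> V) := forall p, cabs p <= 1 ->
  forall e, 0 < e -> exists2 d, 0 < d &
    forall z, cabs z <= 1 -> cabs (z - p) <= d -> rnorm (f z - f p) <= e.

Lemma disc_unif (V : normedModType R[i]) (f : R[i] -> V) : disc_cont f ->
  forall e, 0 < e -> exists2 d, 0 < d & forall z w, cabs z <= 1 -> cabs w <= 1 ->
    cabs (w - z) <= d -> rnorm (f w - f z) <= e.
Proof.
move=> fc e e0; pose Q (A : R[i] -> Prop) := exists2 d, 0 < d & forall z w, A z ->
  cabs z <= 1 -> cabs w <= 1 -> cabs (w - z) <= d -> rnorm (f w - f z) <= e.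
have [| | |d d0 dP] := @disc_cover Q.
- by move=> A B AB [d d0 dP]; exists d => // z w /AB; exact: dP.
- move=> A B [d d0 dP] [d' d'0 d'P]; exists (Num.min d d'); first by rewrite lt_min d0.
  by move=> z w [Az|Bz] z1 w1; rewrite le_min => /andP[? ?]; [apply: dP|apply: d'P].
- move=> p p1; have [d d0 dP] := fc p p1 (e / 2) ltac:(lra).
  exists (d / 2); first by lra.
  exists (d / 2) => [|z w [zp _] z1 w1 wz]; first by lra.
  have h1 := dP z z1 ltac:(lra).
  have wp := cabsD (w - z) (z - p); rewrite addrA subrK in wp.
  have h2 := dP w w1 ltac:(lra).
  have := rnorm_leD (f w - f p) (f z - f p); rewrite opprB addrA subrK; lra.
by exists d => // z w z1; exact: dP.
Qed.

Lemma disc_bounded (V : normedModType R[i]) (f : R[i] -> V) : disc_cont f ->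
  exists2 M, 0 <= M & forall z, cabs z <= 1 -> rnorm (f z) <= M.
Proof.
move=> fc; pose Q (A : R[i] -> Prop) := exists2 M, 0 <= M &
  forall z, A z -> cabs z <= 1 -> rnorm (f z) <= M.
have [| | |M M0 MP] := @disc_cover Q.
- by move=> A B AB [d d0 dP]; exists d => // z /AB; exact: dP.
- move=> A B [M M0 MP] [M' M'0 M'P]; exists (Num.max M M'); first by rewrite le_max M0.
  move=> z Az z1; rewrite le_max; apply/orP.
  by case: Az => [Az|Bz]; [left; apply: MP|right; apply: M'P].
- move=> p p1; have [d d0 dP] := fc p p1 1 ltr01.
  exists d => //; exists (rnorm (f p) + 1) => [|z [zp _] z1]; first by rewrite addr_ge0 ?rnorm_ge0.
  by have := dP z z1 zp; have := rnorm_leBD (f z) (f p); lra.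
by exists M => // z z1; exact: MP.
Qed.

End Bisection.

Section DiscNorm.
Variables (R : realType) (E F : hilbertType R).
Implicit Types W : R[i]^o -> bounded_op E F.

Lemma disc_algebra_cont W : disc_algebra W -> disc_cont (W : R[i] -> bounded_op E F).
Proof.
move=> [/subspace_continuousP Wc _] p p1 e e0.
have := Wc p; rewrite /closed_unit_disc /= -cabsE lecR => /(_ p1).
move=> /cvgrPdist_le /(_ e%:C); rewrite ltcR => /(_ e0).
rewrite near_withinE => /nbhs_ballP[_ /= /pos_complexP[d d0 ->] dP].
exists (d / 2) => [|z z1 zp]; first by lra.
have := dP z; rewrite -ball_normE /ball_ /= -!cabsE lecR ltcR => /(_ _ z1).
rewrite cabsB => /(_ ltac:(lra)); rewrite -rnormE lecR rnormB; exact.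
Qed.

Definition circle_bounded W := exists M, forall z, cabs z = 1 -> opnorm (W z) <= M.

Lemma disc_norm_lub W c : (forall z, cabs z = 1 -> opnorm (W z) <= c) -> disc_norm W <= c.
Proof.
move=> Wc; apply: ge_sup; last by move=> _ [z /unit_circleE z1 <-]; exact: Wc.
by exists (opnorm (W 1)), 1 => //; rewrite unit_circleE cabs1.
Qed.

Lemma disc_norm_ub W z : circle_bounded W -> cabs z = 1 -> opnorm (W z) <= disc_norm W.
Proof.
move=> [M MP] z1; apply: ub_le_sup; last by exists z => //; rewrite unit_circleE.
by exists M => _ [w /unit_circleE w1 <-]; exact: MP.
Qed.

Lemma disc_norm_gt W c : c < disc_norm W -> exists2 z, cabs z = 1 & c < opnorm (W z).
Proof.
move=> cW; apply: contrapT => no; move: cW; rewrite ltNge disc_norm_lub // => z z1.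
by rewrite leNgt; apply/negP => ?; apply: no; exists z.
Qed.

Lemma disc_algebra_bounded W : disc_algebra W -> circle_bounded W.
Proof.
by move=> /disc_algebra_cont /disc_bounded[M _ MP]; exists M => z z1; apply: MP; rewrite z1.
Qed.

Lemma circle_boundedB W V : circle_bounded W -> circle_bounded V ->
  circle_bounded (fun z => W z - V z).
Proof.
move=> [M MP] [M' M'P]; exists (M + M') => z z1.
rewrite -rnorm_op; apply: le_trans (rnorm_leD _ _) _; rewrite !rnorm_op.
by apply: lerD; [apply: MP|apply: M'P].
Qed.

Lemma op_poly_bounded (p : seq (bounded_op E F)) : circle_bounded (op_poly p).
Proof.
exists (\sum_(j < size p) opnorm p`_j) => z z1; rewrite -rnorm_op.
apply: le_trans (rnorm_sum _ _ _) _; apply: ler_sum => j _.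
by rewrite rnormZc cabsX z1 expr1n mul1r.
Qed.

End DiscNorm.

Section Calculus.
Variables (R : realType) (E F H : hilbertType R).
Variables (EH : hilbert_tensor E H) (FH : hilbert_tensor F H).
Implicit Types (p q : seq (bounded_op E F)) (S : bounded_op H H).
Implicit Types (W : R[i]^o -> bounded_op E F).

Lemma poly_calculus_le p S (c : R) : 0 <= c -> opnorm S <= 1 ->
  (forall z, cabs z = 1 -> opnorm (op_poly p z) <= c) ->
  opnorm (poly_calculus EH FH p S) <= c.
Proof.
move=> c0 S1 pc; apply: op_elem_le => // s.
rewrite -(ler_pXn2r (n := 2)) ?nnegrE ?mulr_ge0 ?rnorm_ge0 // exprMn.
(* An empty second row leaves von Neumann's inequality for [p] alone. *)
have := @column_von_neumann _ _ _ _ _ EH FH EH p [::] (c ^+ 2) S s (sqr_ge0 _) S1.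
rewrite {2}/poly_calculus big_ord0 rnorm0 expr0n addr0; apply=> z z1 e.
rewrite {2}/op_poly big_ord0 rnorm0 expr0n addr0 -exprMn.
rewrite ler_pXn2r ?nnegrE ?mulr_ge0 ?rnorm_ge0 //.
by apply: le_trans (opnorm_bound _ _) _; rewrite ler_wpM2r ?rnorm_ge0 ?pc.
Qed.

Lemma poly_sub p q : exists r : seq (bounded_op E F),
  (forall z, op_poly r z = op_poly p z - op_poly q z) /\
  (forall S, poly_calculus EH FH r S = poly_calculus EH FH p S - poly_calculus EH FH q S).
Proof.
pose d := maxn (size p) (size q).
pose r : seq (bounded_op E F) := mkseq (fun j => p`_j - q`_j) d; exists r.
have sd : (size r <= d)%N.
  by rewrite size_mkseq.
split=> [z|S].
  rewrite (op_poly_pad _ sd) (@op_poly_pad _ _ _ p d) ?leq_maxl //.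
  rewrite (@op_poly_pad _ _ _ q d) ?leq_maxr // -sumrB; apply: eq_bigr => j _.
  by rewrite /r nth_mkseq // scalerBr.
rewrite (poly_calculus_pad _ _ _ sd) (@poly_calculus_pad _ _ _ _ _ _ p d) ?leq_maxl //.
rewrite (@poly_calculus_pad _ _ _ _ _ _ q d) ?leq_maxr // -sumrB; apply: eq_bigr => j _.
rewrite /r nth_mkseq // -scaleN1r tensor_opDl tensor_opZl scaleN1r //.
Qed.

Lemma poly_calculus_dist p q S (c : R) : 0 <= c -> opnorm S <= 1 ->
  (forall z, cabs z = 1 -> opnorm (op_poly p z - op_poly q z) <= c) ->
  opnorm (poly_calculus EH FH p S - poly_calculus EH FH q S) <= c.
Proof.
move=> c0 S1 pq; have [r [rz rS]] := poly_sub p q; rewrite -rS.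
by apply: poly_calculus_le => // z z1; rewrite rz; exact: pq.
Qed.

Lemma approx_bound W (p : seq (bounded_op E F)) (c : R) : circle_bounded W ->
  disc_norm (fun z => op_poly p z - W z) <= c ->
  forall z, cabs z = 1 -> opnorm (op_poly p z - W z) <= c.
Proof.
move=> Wb pc z z1; apply: le_trans pc.
apply: (disc_norm_ub (W := fun z => op_poly p z - W z)) z1.
exact: circle_boundedB (op_poly_bounded p) Wb.
Qed.

Lemma disc_norm_ge0 (V : R[i]^o -> bounded_op E F) : circle_bounded V -> 0 <= disc_norm V.
Proof.
by move=> Vb; apply: le_trans (opnorm_ge0 (V 1)) (disc_norm_ub Vb (cabs1 R)).
Qed.

Lemma rcvg_disc W (p : nat -> seq (bounded_op E F)) :
  disc_norm (fun z => op_poly (p n) z - W z) @[n --> \oo] --> (0 : R) ->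
  forall e : R, 0 < e -> exists N, forall n, (N <= n)%N ->
    disc_norm (fun z => op_poly (p n) z - W z) <= e.
Proof.
move=> /cvgrPdist_le pW e e0; have [N _ NP] := pW e e0; exists N => n Nn.
by have := NP n Nn; rewrite /= sub0r normrN; apply: le_trans; exact: ler_norm.
Qed.

(** Made for upper bounds on the calculus, which the default value 0 satisfies trivially. *)
Lemma calculus_cases W S : calculus EH FH W S = 0 \/
  exists p : nat -> seq (bounded_op E F),
    (forall e : R, 0 < e -> exists N, forall n, (N <= n)%N ->
       disc_norm (fun z => op_poly (p n) z - W z) <= e) /\
    rcvg (fun n => poly_calculus EH FH (p n) S) (calculus EH FH W S).
Proof.
rewrite /calculus; case: xgetP => [A _ [p [pW pA]]|_]; last by left.
by right; exists p; split; [exact: rcvg_disc|apply/rcvgP].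
Qed.

(** Von Neumann's inequality makes the images of the approximants a Cauchy sequence, so the set of
    limits is inhabited and the default value is excluded. *)
Lemma calculus_exists W S : opnorm S <= 1 -> circle_bounded W ->
  (forall e : R, 0 < e -> exists p, disc_norm (fun z => op_poly p z - W z) <= e) ->
  exists p : nat -> seq (bounded_op E F),
    (forall e : R, 0 < e -> exists N, forall n, (N <= n)%N ->
       disc_norm (fun z => op_poly (p n) z - W z) <= e) /\
    rcvg (fun n => poly_calculus EH FH (p n) S) (calculus EH FH W S).
Proof.
move=> S1 Wb dense.
have [p pP] : {p : nat -> seq (bounded_op E F) & forall n,
    disc_norm (fun z => op_poly (p n) z - W z) <= (1 / 2) ^+ n}.
  suff h n : exists q, disc_norm (fun z => op_poly q z - W z) <= (1 / 2 : R) ^+ n.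
    exact: (choice h).
  by apply: dense; apply: exprn_gt0; lra.
have hdec n m : (n <= m)%N -> (1 / 2 : R) ^+ m <= (1 / 2) ^+ n.
  by move=> nm; apply: ler_wiXn2l => //; lra.
have small e : 0 < e -> exists N, forall n, (N <= n)%N ->
    disc_norm (fun z => op_poly (p n) z - W z) <= e.
  move=> e0; have [N NP] := half_pow_small e0; exists N => n Nn.
  exact: le_trans (pP n) (le_trans (hdec _ _ Nn) NP).
have [|A AP] := @op_cauchy _ _ _ (fun n => poly_calculus EH FH (p n) S).
  move=> e e0; have [N NP] := small (e / 2) ltac:(lra); exists N => m n Nm Nn.
  apply: (poly_calculus_dist _ S1); first exact: ltW.
  move=> z z1; have h1 := approx_bound Wb (NP m Nm) z1; have h2 := approx_bound Wb (NP n Nn) z1.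
  have := rnorm_leD (op_poly (p m) z - W z) (op_poly (p n) z - W z).
  rewrite opprB addrA subrK !rnorm_op => h; apply: (le_trans h).
  by rewrite (splitr e); exact: lerD h1 h2.
have ex : [set A : bounded_op EH FH |
    exists p : nat -> seq (bounded_op E F),
      disc_norm (fun z => op_poly (p n) z - W z) @[n --> \oo] --> (0 : R) /\
      poly_calculus EH FH (p n) S @[n --> \oo] --> A] A.
  exists p; split; last by apply/rcvgP.
  apply/cvgrPdist_le => e e0; have [N NP] := small e e0; exists N => // n /= Nn.
  rewrite sub0r normrN ger0_norm ?NP // disc_norm_ge0 //.
  exact: circle_boundedB (op_poly_bounded _) Wb.
rewrite /calculus; case: xgetP => [B _ [q [qW qB]]|/(_ A)//].
by exists q; split; [exact: rcvg_disc|apply/rcvgP].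
Qed.

Lemma calculus_close W S p (e : R) : opnorm S <= 1 -> circle_bounded W -> 0 <= e ->
  (forall e' : R, 0 < e' -> exists q, disc_norm (fun z => op_poly q z - W z) <= e') ->
  disc_norm (fun z => op_poly p z - W z) <= e ->
  opnorm (poly_calculus EH FH p S - calculus EH FH W S) <= e.
Proof.
move=> S1 Wb e0 dense pe; have [q [qW qA]] := calculus_exists S1 Wb dense.
apply/ler_addgt0Pr => e' e'0.
have [N NP] := qW (e' / 2) ltac:(lra); have [M MP] := qA (e' / 2) ltac:(lra).
have := NP _ (leq_maxl N M); have := MP _ (leq_maxr N M); set n := maxn N M => h1 h2.
have h3 : opnorm (poly_calculus EH FH p S - poly_calculus EH FH (q n) S) <= e + e' / 2.
  apply: (poly_calculus_dist _ S1); first by rewrite addr_ge0 // divr_ge0 // ltW.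
  move=> z z1; have k1 := approx_bound Wb pe z1; have k2 := approx_bound Wb h2 z1.
  have := rnorm_leD (op_poly p z - W z) (op_poly (q n) z - W z).
  by rewrite opprB addrA subrK !rnorm_op => h; apply: (le_trans h); exact: lerD k1 k2.
have := rnormD (poly_calculus EH FH p S - poly_calculus EH FH (q n) S)
  (poly_calculus EH FH (q n) S - calculus EH FH W S).
rewrite addrA subrK !rnorm_op => h; apply: (le_trans h).
by rewrite (splitr e') addrA; exact: lerD h3 h1.
Qed.

End Calculus.

(** * The uniform gap for Ritt contractions *)

Section Forward.
Variables (R : realType) (E F H : hilbertType R).
Variables (EH : hilbert_tensor E H) (FH : hilbert_tensor F H).

Definition scalar_list (c : R[i]) (Q : {poly R[i]}) : seq (bounded_op E E) :=
  mkseq (fun j : nat => (c * Q`_j) *: (1 : bounded_op E E)) (size Q).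

Lemma op_poly_scalar c Q z e : op_poly (scalar_list c Q) z e = (c * Q.[z]) *: e.
Proof.
rewrite (@op_poly_pad _ _ _ _ (size Q)) ?size_mkseq // sum_opE horner_coef mulr_sumr.
rewrite scaler_suml; apply: eq_bigr => j _; rewrite nth_mkseq // !scale_opE one_opE scalerA.
by congr (_ *: _); rewrite mulrCA [z ^+ j * _]mulrC.
Qed.

Lemma poly_calculus_scalar c Q (S : bounded_op H H) :
  poly_calculus EH EH (scalar_list c Q) S = tensor_op EH EH 1 (c *: poly_op Q S).
Proof.
rewrite (@poly_calculus_pad _ _ _ _ _ _ _ (size Q)) ?size_mkseq //.
apply: op_elem_eq => e h; rewrite sum_opE tensor_opE scale_opE /poly_op sum_opE.
rewrite linearZr_LR raddf_sum scaler_sumr; apply: eq_bigr => j _.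
rewrite /scalar_list nth_mkseq // tensor_opZl scale_opE tensor_opE scale_opE /= linearZr_LR.
by rewrite scalerA.
Qed.

(** The Schur product of [<,>] on [E] with [<A, A> - m^2 <,>] on [H]. *)
Lemma tensor_op_lower (A : bounded_op H H) (m : R) s : 0 <= m ->
  (forall h, m * rnorm h <= rnorm (A h)) ->
  m * rnorm (elem EH s) <= rnorm (tensor_op EH EH 1 A (elem EH s)).
Proof.
move=> m0 mA; rewrite -(ler_pXn2r (n := 2)) ?nnegrE ?mulr_ge0 ?rnorm_ge0 // exprMn.
have DP : psd (fun x y : H => inner (A x) (A y) - (m ^+ 2)%:C * inner x y).
  apply: psd_sub; first by apply: psd_pull; exact: inner_psd.
    by apply: psd_scale; rewrite ?sqr_ge0 //; exact: inner_psd.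
  move=> x; rewrite -!rnorm_sqr -rmorphM lecR -exprMn ler_pXn2r ?nnegrE ?rnorm_ge0 //.
  by rewrite mulr_ge0 ?rnorm_ge0.
have h := schur_ge0 (inner_psd E) DP s.
rewrite tensor_op_elem -subr_ge0 -ler0c.
have -> (a b c : R) : (a - b * c)%:C = a%:C - b%:C * c%:C by rewrite rmorphB rmorphM.
rewrite !rnorm_sqr !inner_elem; move: h; congr (0 <= _).
rewrite /elem_map big_map mulr_sumr -sumrB; apply: eq_bigr => x _.
rewrite big_map mulr_sumr -sumrB; apply: eq_bigr => y _ /=; ring.
Qed.

(* Off the arc [|z - 1| <= eta] the function [Q] is smaller than its lower
   bound on [S], so that the column [(p, beta Q)] forces a loss for [p]. *)
Lemma poly_calculus_gap (p : seq (bounded_op E F)) (Q : {poly R[i]}) (S : bounded_op H H)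
    (eta M rho QM e beta : R) :
  opnorm S <= 1 -> 0 <= e -> 0 <= rho -> rho <= M -> 0 <= beta ->
  (forall z, cabs z = 1 -> opnorm (op_poly p z) <= M + e) ->
  (forall z, cabs z = 1 -> cabs (z - 1) <= eta -> opnorm (op_poly p z) <= rho + e) ->
  (forall z, cabs z = 1 -> eta <= cabs (z - 1) -> cabs Q.[z] <= 2) ->
  (forall z, cabs z = 1 -> cabs Q.[z] <= QM) ->
  beta ^+ 2 * QM ^+ 2 <= M ^+ 2 - rho ^+ 2 ->
  (forall h, 3 * rnorm h <= rnorm (poly_op Q S h)) -> 
  forall s, rnorm (poly_calculus EH FH p S (elem EH s)) ^+ 2 <=
    ((M + e) ^+ 2 - 5 * beta ^+ 2) * rnorm (elem EH s) ^+ 2.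
Proof.
move=> S1 e0 r0 rM b0 pM pr Q2 QQ bQ QS s.
pose q := scalar_list beta%:C Q.
have M0 : 0 <= M by exact: le_trans rM.
have bb : 0 <= beta ^+ 2 by exact: sqr_ge0.
have c0 : 0 <= (M + e) ^+ 2 + 4 * beta ^+ 2 by rewrite addr_ge0 ?sqr_ge0 // mulr_ge0.
have := @column_von_neumann _ _ _ _ _ EH FH EH p q _ S s c0 S1.
rewrite poly_calculus_scalar.
have low : 3 * beta * rnorm (elem EH s) <=
    rnorm (tensor_op EH EH 1 (beta%:C *: poly_op Q S) (elem EH s)).
  apply: tensor_op_lower => [|h]; first by rewrite mulr_ge0.
  rewrite scale_opE rnormZc cabs_real ger0_norm //.
  by rewrite (_ : 3 * beta * rnorm h = beta * (3 * rnorm h)) ?ler_wpM2l //; ring.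
have low2 : 9 * beta ^+ 2 * rnorm (elem EH s) ^+ 2 <=
    rnorm (tensor_op EH EH 1 (beta%:C *: poly_op Q S) (elem EH s)) ^+ 2.
  have : (3 * beta * rnorm (elem EH s)) ^+ 2 <=
      rnorm (tensor_op EH EH 1 (beta%:C *: poly_op Q S) (elem EH s)) ^+ 2.
    by rewrite ler_pXn2r ?nnegrE ?rnorm_ge0 // !mulr_ge0 ?rnorm_ge0.
  by rewrite !exprMn; congr (_ * _ * _ <= _); ring.
(* The second row contributes at least [9 beta^2] to a column bounded by [(M + e)^2 + 4 beta^2],
   which leaves [p] with a loss of [5 beta^2]. *)
move=> h; suff : rnorm (poly_calculus EH FH p S (elem EH s)) ^+ 2 +
    rnorm (tensor_op EH EH 1 (beta%:C *: poly_op Q S) (elem EH s)) ^+ 2 <=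
    ((M + e) ^+ 2 + 4 * beta ^+ 2) * rnorm (elem EH s) ^+ 2 by lra.
apply: h => z z1 v.
rewrite op_poly_scalar rnormZc cabsM cabs_real ger0_norm // !exprMn.
have v0 : 0 <= rnorm v ^+ 2 by exact: sqr_ge0.
have pv : rnorm (op_poly p z v) ^+ 2 <= opnorm (op_poly p z) ^+ 2 * rnorm v ^+ 2.
  rewrite -exprMn ler_pXn2r ?nnegrE ?mulr_ge0 ?rnorm_ge0 ?opnorm_ge0 //.
  exact: opnorm_bound.
apply: le_trans (lerD pv (lexx _)) _; rewrite -mulrDl ler_wpM2r //.
have pge := opnorm_ge0 (op_poly p z); have qge := cabs_ge0 Q.[z].
(* On the arc the room [M^2 - rho^2] pays for [beta^2 QM^2]; off the arc [|Q| <= 2] costs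
   [4 beta^2]. *)
have [near|far] := leP (cabs (z - 1)) eta.
  have h1 : opnorm (op_poly p z) ^+ 2 <= (rho + e) ^+ 2.
    by rewrite ler_pXn2r ?nnegrE ?pr // addr_ge0.
  have h2 : cabs Q.[z] ^+ 2 <= QM ^+ 2.
    by rewrite ler_pXn2r ?nnegrE ?QQ //; apply: le_trans qge (QQ z z1).
  have h3 := ler_wpM2l bb h2.
  have h4 : rho * e <= M * e by rewrite ler_wpM2r.
  have : (rho + e) ^+ 2 = rho ^+ 2 + 2 * (rho * e) + e ^+ 2 by ring.
  have : (M + e) ^+ 2 = M ^+ 2 + 2 * (M * e) + e ^+ 2 by ring.
  by lra.
have h1 : opnorm (op_poly p z) ^+ 2 <= (M + e) ^+ 2.
  by rewrite ler_pXn2r ?nnegrE ?pM // addr_ge0.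
have h2 : cabs Q.[z] ^+ 2 <= 2 ^+ 2 by rewrite ler_pXn2r ?nnegrE ?Q2 // ltW.
have := ler_wpM2l bb h2; lra.
Qed.

Theorem ritt_calculus_gap (T : bounded_op H H) (W : R[i]^o -> bounded_op E F) :
  contraction_op T -> disc_algebra W -> opnorm (W 1) < disc_norm W -> ritt T ->
  (ereal_sup [set (opnorm (calculus EH FH W (T ^+ n)))%:E
              | n in [set n : nat | (1 <= n)%N]] < (disc_norm W)%:E)%E.
Proof.
move=> T1 WD W1 rT; set M := disc_norm W in W1 *.
have Wb := disc_algebra_bounded WD; have Wc := disc_algebra_cont WD.
have M0 : 0 < M by apply: le_lt_trans W1; exact: opnorm_ge0.
pose rho := (opnorm (W 1) + M) / 2.
have r0 : 0 <= rho by have := opnorm_ge0 (W 1); rewrite /rho; lra.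
have rM : rho < M by rewrite /rho; lra.
have [eta eta0 etaP] := Wc 1 ltac:(by rewrite cabs1) ((M - opnorm (W 1)) / 2) ltac:(lra).
have Wnear z : cabs z = 1 -> cabs (z - 1) <= eta -> opnorm (W z) <= rho.
  move=> z1 ze; have := etaP z ltac:(by rewrite z1) ze.
  by have := rnorm_leBD (W z) (W 1); rewrite !rnorm_op /rho; lra.
have [c [c01 cT]] := ritt_lower_of_ritt T1 rT.
(* [Q] is fixed before [n]: all powers of [T] share the constant [c / 12]. This makes the gap
   uniform. *)
have [Q [Q2 QS]] := @localizer_ex R (c / 12) eta ltac:(lra) eta0.
(* The summand 3 gives [9 beta^2 <= M^2 - rho^2], which keeps [M^2 - 5 beta^2] positive. *)
pose QM := 3 + \sum_(j < size Q) cabs Q`_j.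
have QM3 : 3 <= QM by rewrite lerDl sumr_ge0 // => j _; exact: cabs_ge0.
have QQ z : cabs z = 1 -> cabs Q.[z] <= QM.
  move=> z1; rewrite horner_coef; apply: le_trans (cabs_sum _ _ _) _.
  apply: le_trans (_ : \sum_(j < size Q) cabs Q`_j <= _); last by rewrite lerDr.
  by apply: ler_sum => j _; rewrite cabsM cabsX z1 expr1n mulr1.
have D0 : 0 < M ^+ 2 - rho ^+ 2 by rewrite subr_gt0 ltr_pXn2r ?nnegrE // ltW.
pose beta := Num.sqrt (M ^+ 2 - rho ^+ 2) / QM.
have QM0 : 0 < QM by lra.
have b0 : 0 < beta by rewrite divr_gt0 // sqrtr_gt0.
have bQ : beta ^+ 2 * QM ^+ 2 = M ^+ 2 - rho ^+ 2.
  by rewrite -exprMn divfK ?gt_eqF // sqr_sqrtr // ltW.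
have b5 : 5 * beta ^+ 2 < M ^+ 2.
  have : beta ^+ 2 * 9 <= beta ^+ 2 * QM ^+ 2.
    rewrite ler_wpM2l ?sqr_ge0 //; have -> : 9 = 3 ^+ 2 :> R by ring.
    by rewrite ler_pXn2r ?nnegrE // ltW.
  have : 0 < beta ^+ 2 by rewrite exprn_gt0.
  have : 0 < M ^+ 2 by rewrite exprn_gt0.
  by have := sqr_ge0 rho; lra.
pose sigma := Num.sqrt (M ^+ 2 - 5 * beta ^+ 2).
have sM : sigma < M.
  rewrite -(ltr_pXn2r (n := 2)) ?nnegrE ?sqrtr_ge0 ?(ltW M0) // sqr_sqrtr.
    by have := exprn_gt0 2 b0; lra.
  by rewrite subr_ge0 ltW.
apply: le_lt_trans (_ : sigma%:E < _)%E; last by rewrite lte_fin.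
apply: ge_ereal_sup => _ [n /= n1 <-]; rewrite lee_fin.
have Tn1 := contrX n T1.
have [->|[p [pW pA]]] := calculus_cases EH FH W (T ^+ n).
  by rewrite -rnorm_op rnorm0 sqrtr_ge0.
have cTn : ritt_lower (c / 12) (T ^+ n) by apply: ritt_lower_pow.
apply/ler_addgt0Pr => d d0.
have [N1 N1P] := pA (d / 2) ltac:(lra).
(* e small enough for sqrt ((M + e)^2 - 5 beta^2) <= sigma + d / 2 *)
pose e := Num.min 1 (d ^+ 2 / 4 / (2 * M + 1)).
have M21 : 0 < 2 * M + 1 by lra.
have e0 : 0 < e by rewrite lt_min ltr01 /= !divr_gt0 // exprn_gt0.
have e1 : e <= 1 by rewrite ge_min lexx.
have eM : e * (2 * M + 1) <= d ^+ 2 / 4 by rewrite -ler_pdivlMr // ge_min lexx orbT.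
have [N2 N2P] := pW e e0.
have := N1P _ (leq_maxl N1 N2); have := N2P _ (leq_maxr N1 N2); set k := maxn N1 N2.
move=> pk Ak; rewrite rnorm_op in Ak.
have pz z : cabs z = 1 -> opnorm (op_poly (p k) z) <= opnorm (W z) + e.
  move=> z1; have := approx_bound Wb pk z1; rewrite -!rnorm_op.
  by have := rnorm_leBD (op_poly (p k) z) (W z); lra.
have pM z : cabs z = 1 -> opnorm (op_poly (p k) z) <= M + e.
  by move=> z1; apply: le_trans (pz z z1) _; rewrite lerD2r; exact: (disc_norm_ub Wb z1).
have pr z : cabs z = 1 -> cabs (z - 1) <= eta -> opnorm (op_poly (p k) z) <= rho + e.
  by move=> z1 ze; apply: le_trans (pz z z1) _; rewrite lerD2r; exact: Wnear.
have bQ' : beta ^+ 2 * QM ^+ 2 <= M ^+ 2 - rho ^+ 2 by rewrite bQ.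
have gap := poly_calculus_gap Tn1 (ltW e0) r0 (ltW rM) (ltW b0) pM pr Q2 QQ bQ'
  (QS _ _ Tn1 cTn).
have norm_p : opnorm (poly_calculus EH FH (p k) (T ^+ n)) <= sigma + d / 2.
  have s0 : 0 <= sigma := sqrtr_ge0 _.
  have sd0 : 0 <= sigma + d / 2 by rewrite addr_ge0 // divr_ge0 // ltW.
  apply: op_elem_le => // s.
  rewrite -(ler_pXn2r (n := 2)) ?nnegrE ?rnorm_ge0 //; last by rewrite mulr_ge0 ?rnorm_ge0.
  apply: le_trans (gap s) _.
  rewrite [leRHS]exprMn ler_wpM2r ?sqr_ge0 //.
  have : sigma ^+ 2 = M ^+ 2 - 5 * beta ^+ 2 by rewrite sqr_sqrtr // subr_ge0 ltW.
  have : 0 <= sigma * d by rewrite mulr_ge0 // ltW.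
  have : e * e <= e by rewrite ler_piMr // ltW.
  have -> : (sigma + d / 2) ^+ 2 = sigma ^+ 2 + sigma * d + d ^+ 2 / 4 by field.
  have -> : (M + e) ^+ 2 = M ^+ 2 + 2 * (e * M) + e * e by ring.
  by lra.
have := rnorm_leBD (calculus EH FH W (T ^+ n)) (poly_calculus EH FH (p k) (T ^+ n)).
by rewrite rnormB !rnorm_op; lra.
Qed.

End Forward.

(** * Cauchy's theorem along roots of unity *)

Section Primitive.
Variable R : realType.

Definition between (x y t : R) := (x <= t <= y) \/ (y <= t <= x).

(* Increments of the primitive are compared with those of the primitive of an
   affine function, which is what Goursat's argument needs. *)
Lemma antiderivative_real (g : R -> R) (B : R) : continuous g ->
  exists G : R -> R, forall x y a b (e : R), `|x| <= B -> `|y| <= B ->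
    (forall t, between x y t -> `|g t - (a + b * t)| <= e) ->
    `|G y - G x - (a * (y - x) + b * (y ^+ 2 - x ^+ 2) / 2)| <= e * `|y - x|.
Proof.
move=> gc; pose l := - B - 1; pose u := B + 1.
pose G (x : R) := (\int[lebesgue_measure]_(t in [set` `[l, x]]) g t)%R.
have gi : lebesgue_measure.-integrable `[l, u] (EFin \o g).
  apply: continuous_compact_integrable; first exact: segment_compact.
  exact: continuous_subspaceT.
have Gd x : l < x < u -> is_derive x 1 G (g x).
  move=> /andP[lx xu].
  have [d dE] := continuous_FTC1_closed xu gi lx (gc x).
  by apply: DeriveDef; [exact: d|rewrite -dE derive1E].
exists G => x y a b e.
wlog xy : x y / x <= y => [H xB yB gE|xB yB gE].
  have [|/ltW] := leP x y => le; first exact: H.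
  have := H y x le yB xB (fun t tb => gE t (match tb with or_introl h => or_intror h | or_intror h => or_introl h end)).
  rewrite distrC [`|x - y|]distrC; congr (`| _ | <= _); ring.
have /ler_normlP[x1 x2] := xB; have /ler_normlP[y1 y2] := yB.
pose h (t : R) := G t - (a * t + b / 2 * t ^+ 2).
have hd t : l < t < u -> is_derive t 1 h (g t - (a + b * t)).
  move=> tlu; have := Gd t tlu => ?.
  by apply: is_derive_eq; rewrite /GRing.scale /=; field.
have hc : {within `[x, y], continuous h}.
  apply: continuous_in_subspaceT => t; rewrite inE /= in_itv /= => /andP[xt ty].
  apply: differentiable_continuous; apply/derivable1_diffP.
  by have [] := hd t ltac:(rewrite /l /u; lra).
have [|c cxy E] := @MVT_segment R h (fun t => g t - (a + b * t)) x y xy _ hc.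
  by move=> t; rewrite in_itv /= => /andP[xt ty]; apply: hd; rewrite /l /u; lra.
have -> : G y - G x - (a * (y - x) + b * (y ^+ 2 - x ^+ 2) / 2) = h y - h x.
  by rewrite /h; field.
rewrite E normrM ler_wpM2r // gE //; left.
by move: cxy; rewrite in_itv.
Qed.

Definition ccont (f : R[i] -> R[i]) := forall p (e : R), 0 < e -> exists2 d : R, 0 < d &
  forall z, cabs (z - p) <= d -> cabs (f z - f p) <= e.

(** The factor 2 comes from adding the errors of the real and imaginary parts. *)
Lemma antiderivative (g : R -> R[i]) (B : R) :
  (forall x (e : R), 0 < e -> exists2 d : R, 0 < d & forall t, `|t - x| <= d -> cabs (g t - g x) <= e) ->
  exists G : R -> R[i], forall x y (a b : R[i]) (e : R), `|x| <= B -> `|y| <= B ->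
    (forall t, between x y t -> cabs (g t - (a + b * t%:C)) <= e) ->
    cabs (G y - G x - (a * (y - x)%:C + b * ((y ^+ 2 - x ^+ 2) / 2)%:C)) <= 2 * e * `|y - x|.
Proof.
move=> gc.
have RB (z w : R[i]) : complex.Re (z - w) = complex.Re z - complex.Re w by case: z w => [? ?] [? ?].
have IB (z w : R[i]) : complex.Im (z - w) = complex.Im z - complex.Im w by case: z w => [? ?] [? ?].
have Rc : continuous (fun t => complex.Re (g t)).
  move=> x; apply/cvgrPdist_le => e e0; have [d d0 dP] := gc x e e0.
  exists d => //= t; rewrite /= => /ltW xt; rewrite -RB; apply: le_trans (cabs_Re _) _.
  by rewrite cabsB; apply: dP; rewrite distrC.
have Ic : continuous (fun t => complex.Im (g t)).
  move=> x; apply/cvgrPdist_le => e e0; have [d d0 dP] := gc x e e0.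
  exists d => //= t; rewrite /= => /ltW xt; rewrite -IB; apply: le_trans (cabs_Im _) _.
  by rewrite cabsB; apply: dP; rewrite distrC.
have [G1 G1P] := antiderivative_real B Rc; have [G2 G2P] := antiderivative_real B Ic.
exists (fun x => G1 x +i* G2 x) => x y [a1 a2] [b1 b2] e xB yB ge.
have h1 := G1P x y a1 b1 e xB yB; have h2 := G2P x y a2 b2 e xB yB.
apply: le_trans (cabs_ReIm _) _.
have -> : 2 * e * `|y - x| = e * `|y - x| + e * `|y - x| by ring.
apply: lerD => /=.
  have : `|G1 y - G1 x - (a1 * (y - x) + b1 * (y ^+ 2 - x ^+ 2) / 2)| <= e * `|y - x|.
    apply: h1 => t tb; apply: le_trans (ge t tb); apply: le_trans (cabs_Re _).
    by rewrite RB /= le_eqVlt; apply/orP; left; apply/eqP; congr (`| _ |); ring.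
  by congr (`| _ | <= _); field.
have : `|G2 y - G2 x - (a2 * (y - x) + b2 * (y ^+ 2 - x ^+ 2) / 2)| <= e * `|y - x|.
  apply: h2 => t tb; apply: le_trans (ge t tb); apply: le_trans (cabs_Im _).
  by rewrite IB /= le_eqVlt; apply/orP; left; apply/eqP; congr (`| _ |); ring.
by congr (`| _ | <= _); field.
Qed.

Definition cdiff (f : R[i] -> R[i]) (p : R[i]) := exists f' : R[i],
  forall e : R, 0 < e -> exists2 d : R, 0 < d &
    forall z, cabs (z - p) <= d -> cabs (f z - f p - f' * (z - p)) <= e * cabs (z - p).

Lemma cabs_i : cabs ('i : R[i]) = 1.
Proof.
apply/eqP; rewrite -(eqrXn2 (n := 2)) ?cabs_ge0 // cabs_sqr /= expr0n add0r.
by rewrite !expr1n.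
Qed.

Lemma mulii : 'i * 'i = -1 :> R[i].
Proof. by rewrite -expr2 sqr_i. Qed.

Lemma betweenC x y t : between x y t -> between y x t.
Proof. by case; [right|left]. Qed.

Lemma le0_of_small (c k : R) : 0 <= k -> (forall e : R, 0 < e -> c <= e * k) -> c <= 0.
Proof.
move=> k0 small; have [//|c0] := leP c 0.
have e0 : 0 < c / (k + 1) by apply: divr_gt0 => //; lra.
have := small _ e0; rewrite mulrAC ler_pdivlMr; last by lra.
by rewrite ler_pM2l //; lra.
Qed.

Section Goursat.
Variables (f : R[i] -> R[i]) (B : R).

Let pt (x y : R) : R[i] := x%:C + 'i * y%:C.

Let pt_dist x y x' y' : cabs (pt x y - pt x' y') <= `|x - x'| + `|y - y'|.
Proof.
rewrite /pt; have -> : x%:C + 'i * y%:C - (x'%:C + 'i * y'%:C) =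
   (x - x')%:C + 'i * (y - y')%:C by rewrite !rmorphB; ring.
by apply: le_trans (cabsD _ _) _; rewrite cabsM cabs_i mul1r !cabs_real.
Qed.

(** [Hh u] stands for a primitive of [f] along the horizontal line at height [u], [Vv u] for one
    along the vertical line at abscissa [u]. *)
Variables (Hh Vv : R -> R -> R[i]).
Hypothesis HP : forall u x y (a b : R[i]) (e : R), `|x| <= B -> `|y| <= B ->
    (forall t, between x y t -> cabs (f (pt t u) - (a + b * t%:C)) <= e) ->
    cabs (Hh u y - Hh u x - (a * (y - x)%:C + b * ((y ^+ 2 - x ^+ 2) / 2)%:C)) <= 2 * e * `|y - x|.
Hypothesis VP : forall u x y (a b : R[i]) (e : R), `|x| <= B -> `|y| <= B ->
    (forall t, between x y t -> cabs (f (pt u t) - (a + b * t%:C)) <= e) ->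
    cabs (Vv u y - Vv u x - (a * (y - x)%:C + b * ((y ^+ 2 - x ^+ 2) / 2)%:C)) <= 2 * e * `|y - x|.

(** The integral of [f dz] counterclockwise along the boundary of a rectangle, with [dz = 'i dy] on
    the vertical sides. *)
Definition rect_int (x1 x2 y1 y2 : R) : R[i] :=
  (Hh y1 x2 - Hh y1 x1) + 'i * (Vv x2 y2 - Vv x2 y1) -
  (Hh y2 x2 - Hh y2 x1) - 'i * (Vv x1 y2 - Vv x1 y1).

(** The boundary integral of the affine function vanishes exactly, so only the errors of the four
    sides remain. *)
Lemma rect_int_small x1 x2 y1 y2 (p f0 f' : R[i]) (e : R) :
  `|x1| <= B -> `|x2| <= B -> `|y1| <= B -> `|y2| <= B ->
  (forall x y, between x1 x2 x -> between y1 y2 y ->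
     cabs (f (pt x y) - (f0 + f' * (pt x y - p))) <= e) ->
  cabs (rect_int x1 x2 y1 y2) <= 4 * e * (`|x2 - x1| + `|y2 - y1|).
Proof.
move=> xB1 xB2 yB1 yB2 fe.
have bl (u v : R) : between u v u by rewrite /between; have [|/ltW] := leP u v; [left|right]; lra.
have br (u v : R) : between u v v by exact/betweenC/bl.
pose ah u := f0 + f' * ('i * u%:C - p).
pose av u := f0 + f' * (u%:C - p).
have h1 := HP xB1 xB2 (a := ah y1) (b := f') (e := e) (u := y1).
have h2 := HP xB1 xB2 (a := ah y2) (b := f') (e := e) (u := y2).
have h3 := VP yB1 yB2 (a := av x1) (b := f' * 'i) (e := e) (u := x1).
have h4 := VP yB1 yB2 (a := av x2) (b := f' * 'i) (e := e) (u := x2).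
have hh u t : f (pt t u) - (ah u + f' * t%:C) = f (pt t u) - (f0 + f' * (pt t u - p)).
  by rewrite /ah /pt; ring.
have vv u t : f (pt u t) - (av u + f' * 'i * t%:C) = f (pt u t) - (f0 + f' * (pt u t - p)).
  by rewrite /av /pt; ring.
have {}h1 := h1 (fun t tb => ltac:(rewrite hh; exact: fe)).
have {}h2 := h2 (fun t tb => ltac:(rewrite hh; exact: fe)).
have {}h3 := h3 (fun t tb => ltac:(rewrite vv; exact: fe)).
have {}h4 := h4 (fun t tb => ltac:(rewrite vv; exact: fe)).
move: h1 h2 h3 h4.
set X := x2 - x1; set Y := y2 - y1; set X2 := (x2 ^+ 2 - x1 ^+ 2) / 2; set Y2 := (y2 ^+ 2 - y1 ^+ 2) / 2.
set E1 := _ - (_ * _ + _); set E2 := _ - (_ * _ + _).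
set E3 := _ - (_ * _ + _); set E4 := _ - (_ * _ + _) => h1 h2 h3 h4.
have -> : rect_int x1 x2 y1 y2 = E1 + 'i * E4 - E2 - 'i * E3.
  rewrite /rect_int /E1 /E2 /E3 /E4 /ah /av.
  have XE : X%:C = x2%:C - x1%:C by rewrite /X rmorphB.
  have YE : Y%:C = y2%:C - y1%:C by rewrite /Y rmorphB.
  rewrite XE YE.
  transitivity (Hh y1 x2 - Hh y1 x1 + 'i * (Vv x2 y2 - Vv x2 y1) -
    (Hh y2 x2 - Hh y2 x1) - 'i * (Vv x1 y2 - Vv x1 y1) + 0 * ('i * 'i - -1)); first by ring.
  by rewrite mulii; have := mulii => ii; ring: ii.
apply: le_trans (cabsD _ _) _; rewrite cabsN cabsM cabs_i mul1r.
have k1 := cabsD (E1 + 'i * E4) (- E2); rewrite cabsN in k1.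
have k2 := cabsD E1 ('i * E4); rewrite cabsM cabs_i mul1r in k2.
by lra.
Qed.

Lemma rect_intD x1 x2 x3 y1 y2 y3 : rect_int x1 x3 y1 y3 =
  rect_int x1 x2 y1 y2 + rect_int x2 x3 y1 y2 +
  rect_int x1 x2 y2 y3 + rect_int x2 x3 y2 y3.
Proof. by rewrite /rect_int; ring. Qed.

(** The bound [4 e (K h)^2] adds up under division into four. On a small rectangle around a point of
    differentiability the affine error is at most [e h K] and [|h a| + |h b| = h K], which gives the
    bound there. *)
Lemma goursat x1 x2 y1 y2 : `|x1| <= B -> `|x2| <= B -> `|y1| <= B -> `|y2| <= B ->
  (forall x y, between x1 x2 x -> between y1 y2 y -> cdiff f (pt x y)) ->
  rect_int x1 x2 y1 y2 = 0.
Proof.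
move=> xB1 xB2 yB1 yB2 fd.
pose a := x2 - x1; pose b := y2 - y1; pose K := `|a| + `|b|.
have K0 : 0 <= K by rewrite addr_ge0.
have bet (u v : R) (s : R) : 0 <= s <= 1 -> between u v (u + s * (v - u)).
  move=> s01; have [uv|/ltW vu] := leP u v.
    by left; have : 0 <= v - u by [lra]; nra.
  by right; have : v - u <= 0 by [lra]; nra.
have betB (u v t : R) : `|u| <= B -> `|v| <= B -> between u v t -> `|t| <= B.
  by rewrite !ler_norml => ? ? [] ?; lra.
suff small (e : R) : 0 < e -> cabs (rect_int x1 x2 y1 y2) <= e * (4 * K ^+ 2).
  apply/eqP; rewrite -cabs_eq0 eq_le cabs_ge0 andbT.
  by apply: le0_of_small small; rewrite mulr_ge0 // sqr_ge0.
move=> e0.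
pose P n s t := let h := (1 / 2 : R) ^+ n in
  cabs (rect_int (x1 + s * a) (x1 + (s + h) * a) (y1 + t * b) (y1 + (t + h) * b))
    <= e * (4 * K ^+ 2) * h ^+ 2.
have : P 0%N 0 0; last first.
  rewrite /P !expr0 expr1n mulr1 !mul0r !addr0 !add0r !mul1r /a /b.
  by rewrite [x1 + _]addrC [y1 + _]addrC !subrK.
apply: (unit_square_bisect (P := fun n s t => is_true (P n s t))).
  move=> n s t h; rewrite /P.
  have -> : (1 / 2 : R) ^+ n = h + h by rewrite /h exprS; lra.
  rewrite -/h => p1 p2 p3 p4.
  rewrite (rect_intD _ (x1 + (s + h) * a) _ _ (y1 + (t + h) * b)) [s + (h + h)]addrA [t + (h + h)]addrA.
  have -> : e * (4 * K ^+ 2) * (h + h) ^+ 2 = e * (4 * K ^+ 2) * h ^+ 2 + e * (4 * K ^+ 2) * h ^+ 2 +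
     e * (4 * K ^+ 2) * h ^+ 2 + e * (4 * K ^+ 2) * h ^+ 2 by ring.
  apply: le_trans (cabsD _ _) (lerD _ p4).
  apply: le_trans (cabsD _ _) (lerD _ p3).
  exact: le_trans (cabsD _ _) (lerD p1 p2).
move=> s t s01 t01.
pose x0 := x1 + s * a; pose y0 := y1 + t * b; pose p := pt x0 y0.
have [f' f'P] := fd _ _ (bet x1 x2 s s01) (bet y1 y2 t t01).
have [d d0 dP] := f'P e e0.
exists (d / (K + 1)); first by apply: divr_gt0 => //; lra.
move=> n s' t' h s'0 hs t'0 ht hd sh th.
have h0 : 0 <= h by lra.
have hK : h * K <= d.
  rewrite ler_pdivlMr in hd; last by lra.
  by apply: le_trans hd; rewrite ler_wpM2l //; lra.
have B1 (u v r : R) : `|u| <= B -> `|v| <= B -> 0 <= r <= 1 -> `|u + r * (v - u)| <= B.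
  by move=> uB vB r01; apply: betB uB vB (bet _ _ _ r01).
have near (u v r r' z : R) : r' <= r <= r' + h ->
    between (u + r' * v) (u + (r' + h) * v) z -> `|z - (u + r * v)| <= h * `|v|.
  move=> hr zb; rewrite -[h]ger0_norm // -normrM ler_norml.
  have [v0|/ltW v0] := leP 0 v.
    rewrite ger0_norm ?mulr_ge0 //; case: zb => zb; apply/andP; split; nra.
  rewrite ler0_norm ?mulr_ge0_le0 //; case: zb => zb; apply/andP; split; nra.
rewrite /P -/h.
have -> : e * (4 * K ^+ 2) * h ^+ 2 = 4 * (e * (h * K)) * (`|h * a| + `|h * b|).
  by rewrite !normrM ger0_norm // -mulrDr -/K; ring.
have -> : h * a = x1 + (s' + h) * a - (x1 + s' * a) by ring.
have -> : h * b = y1 + (t' + h) * b - (y1 + t' * b) by ring.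
apply: (@rect_int_small _ _ _ _ p (f p) f'); try by apply: B1 => //; lra.
move=> x y xb yb.
have dist : cabs (pt x y - p) <= h * K.
  apply: le_trans (pt_dist _ _ _ _) _; rewrite /K mulrDr.
  by apply: lerD; [exact: near xb|exact: near yb].
rewrite opprD addrA; apply: le_trans (dP _ (le_trans dist hK)) _.
by rewrite ler_wpM2l // ltW.
Qed.

(** The integral of [f] from 0 to [x] along the real axis and then vertically to [x + 'i y]. *)
Definition primitive (x y : R) : R[i] := Hh 0 x - Hh 0 0 + 'i * (Vv x y - Vv x 0).

Let ptE x y : pt x y = x +i* y.
Proof. by rewrite /pt [RHS]complexE. Qed.

Let pt_le a b a' b' : `|a| <= `|a'| -> `|b| <= `|b'| -> cabs (pt a b) <= cabs (pt a' b').
Proof.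
move=> aa bb; rewrite -ler_sqr ?nnegrE ?cabs_ge0 // !cabs_sqr !ptE /=.
rewrite -(real_normK (num_real a)) -(real_normK (num_real b)).
rewrite -(real_normK (num_real a')) -(real_normK (num_real b')).
by apply: lerD; rewrite ler_sqr ?nnegrE.
Qed.

Let between_dist x y t : between x y t -> `|t - x| <= `|y - x|.
Proof. by case=> h; [rewrite !ger0_norm|rewrite !ler0_norm]; lra. Qed.

Let between_abs x t : between 0 x t -> `|t| <= `|x|.
Proof. by move/between_dist; rewrite !subr0. Qed.

Let pt_coord x y : `|x| <= cabs (pt x y) /\ `|y| <= cabs (pt x y).
Proof. by rewrite ptE; split; [apply: (cabs_Re (x +i* y))|apply: (cabs_Im (x +i* y))]. Qed.

(** Goursat's theorem on the rectangle between the real axis and height [y] moves the horizontal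
    step from the axis up to [w]; what remains is an integral over two segments close to [w]. The
    condition on [r] keeps that rectangle in the disc where [f] is differentiable. *)
Lemma primitiveB (r : R) x y x' y' (e : R) : r <= B ->
  (forall z, cabs z <= r -> cdiff f z) ->
  cabs (pt x y) + cabs (pt x' y' - pt x y) <= r ->
  (forall z, cabs (z - pt x y) <= cabs (pt x' y' - pt x y) -> cabs (f z - f (pt x y)) <= e) ->
  cabs (primitive x' y' - primitive x y - f (pt x y) * (pt x' y' - pt x y))
    <= 4 * e * cabs (pt x' y' - pt x y).
Proof.
move=> rB fd wr fe; set w := pt x y; set D := cabs (pt x' y' - w).
have ptB u v u' v' : pt u v - pt u' v' = pt (u - u') (v - v').
  by rewrite /pt !rmorphB; ring.
have [xD yD] : `|x' - x| <= D /\ `|y' - y| <= D by rewrite /D /w ptB; exact: pt_coord.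
have D0 : 0 <= D := cabs_ge0 _.
have w0 := cabs_ge0 w.
have [xw yw] := pt_coord x y; rewrite -/w in xw yw.
have [xw' yw'] := pt_coord x' y'.
have w'r : cabs (pt x' y') <= r.
  by apply: le_trans wr; rewrite addrC -[pt x' y'](subrK w); apply: le_trans (cabsD _ _) _; rewrite subrK.
have wr' : cabs w <= r by rewrite -/w -/D in wr; lra.
have [xB yB x'B y'B] : [/\ `|x| <= B, `|y| <= B, `|x'| <= B & `|y'| <= B] by split; lra.
have B0 : `|0 : R| <= B by rewrite normr0; lra.
have rect0 : rect_int x x' 0 y = 0.
  apply: goursat => // a b ab /between_abs bb; apply: fd; apply: le_trans wr.
  apply: le_trans (pt_le (lexx _) bb) _.
  apply: le_trans (cabsBD _ w) _; rewrite lerD2l /w ptB subrr.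
  by apply: le_trans (pt_le (between_dist ab) (b' := y' - y) _) _; rewrite ?normr0 // ptB.
have h1 := HP (u := y) (a := f w) (b := 0) (e := e) xB x'B.
have h2 := VP (u := x') (a := f w) (b := 0) (e := e) yB y'B.
have {}h1 := h1 (fun t tb => ltac:(rewrite mul0r addr0; apply: fe;
  rewrite !ptB subrr; apply: pt_le; [exact: between_dist|rewrite normr0 //])).
have {}h2 := h2 (fun t tb => ltac:(rewrite mul0r addr0; apply: fe;
  rewrite !ptB; apply: pt_le; [exact: lexx|exact: between_dist])).
rewrite !mul0r !addr0 in h1 h2.
have -> : primitive x' y' - primitive x y - f w * (pt x' y' - w) =
   (Hh y x' - Hh y x - f w * (x' - x)%:C) + 'i * (Vv x' y' - Vv x' y - f w * (y' - y)%:C) + rect_int x x' 0 y.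
  by rewrite /w ptB /pt /primitive /rect_int; ring.
rewrite rect0 addr0; apply: le_trans (cabsD _ _) _; rewrite cabsM cabs_i mul1r.
have e0 : 0 <= e by apply: le_trans (cabs_ge0 _) (fe w _); rewrite subrr cabs0.
have k1 := ler_wpM2l e0 xD; have k2 := ler_wpM2l e0 yD.
apply: le_trans (lerD h1 h2) _; lra.
Qed.

End Goursat.

Lemma goursat_primitive (f : R[i] -> R[i]) (r : R) :
  ccont f -> (forall z, cabs z <= r -> cdiff f z) ->
  exists F : R[i] -> R[i], forall w w' (e : R), cabs w + cabs (w' - w) <= r ->
    (forall z, cabs (z - w) <= cabs (w' - w) -> cabs (f z - f w) <= e) ->
    cabs (F w' - F w - f w * (w' - w)) <= 4 * e * cabs (w' - w).
Proof.
move=> fc fd.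
have hc (u x : R) (e : R) : 0 < e -> exists2 d : R, 0 < d &
    forall t, `|t - x| <= d -> cabs (f (t%:C + 'i * u%:C) - f (x%:C + 'i * u%:C)) <= e.
  move=> e0; have [d d0 dP] := fc (x%:C + 'i * u%:C) e e0; exists d => // t td; apply: dP.
  have -> : t%:C + 'i * u%:C - (x%:C + 'i * u%:C) = (t - x)%:C by rewrite rmorphB; ring.
  by rewrite cabs_real.
have vc (u x : R) (e : R) : 0 < e -> exists2 d : R, 0 < d &
    forall t, `|t - x| <= d -> cabs (f (u%:C + 'i * t%:C) - f (u%:C + 'i * x%:C)) <= e.
  move=> e0; have [d d0 dP] := fc (u%:C + 'i * x%:C) e e0; exists d => // t td; apply: dP.
  have -> : u%:C + 'i * t%:C - (u%:C + 'i * x%:C) = 'i * (t - x)%:C by rewrite rmorphB; ring.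
  by rewrite cabsM cabs_i mul1r cabs_real.
have [Hh HP] := choice (fun u => antiderivative r (hc u)).
have [Vv VP] := choice (fun u => antiderivative r (vc u)).
exists (fun w => primitive Hh Vv (complex.Re w) (complex.Im w)) => w w' e wr fe.
have ptw z : z = (complex.Re z)%:C + 'i * (complex.Im z)%:C :> R[i] by exact: complexE.
have := @primitiveB f r Hh Vv HP VP r (complex.Re w) (complex.Im w) (complex.Re w') (complex.Im w') e (lexx _) fd.
by rewrite -(ptw w) -(ptw w'); apply.
Qed.

(* A Riemann sum for the integral of [f] over the circle: the primitive of [f]
   telescopes along the roots of unity. *)
Lemma cauchy_discrete (f : R[i] -> R[i]) (r d e : R) (M : nat) (w : R[i]) :
  ccont f -> (forall z, cabs z <= r -> cdiff f z) ->
  w ^+ M = 1 -> w != 1 -> cabs w = 1 -> cabs (w - 1) <= d -> 1 + d <= r ->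
  (forall z z', cabs z = 1 -> cabs (z' - z) <= d -> cabs (f z' - f z) <= e) ->
  cabs (\sum_(j < M) w ^+ j * f (w ^+ j)) <= 4 * e * M%:R.
Proof.
move=> fc fd wM wn1 w1 wd dr fe.
have [F FP] := goursat_primitive fc fd.
have c0 : 0 < cabs (w - 1) by rewrite cabs_gt0 subr_eq0.
have tel : \sum_(j < M) (F (w ^+ j.+1) - F (w ^+ j)) = 0.
  by rewrite -(big_mkord xpredT (fun j => F (w ^+ j.+1) - F (w ^+ j))) telescope_sumr // wM expr0 subrr.
have step (j : nat) : cabs (F (w ^+ j.+1) - F (w ^+ j) - (w - 1) * (w ^+ j * f (w ^+ j))) <= 4 * e * cabs (w - 1).
  have wj : cabs (w ^+ j) = 1 by rewrite cabsX w1 expr1n.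
  have E : w ^+ j.+1 - w ^+ j = w ^+ j * (w - 1) by rewrite exprSr; ring.
  have cE : cabs (w ^+ j.+1 - w ^+ j) = cabs (w - 1) by rewrite E cabsM wj mul1r.
  have := FP (w ^+ j) (w ^+ j.+1) e; rewrite cE wj E.
  have -> : f (w ^+ j) * (w ^+ j * (w - 1)) = (w - 1) * (w ^+ j * f (w ^+ j)) by ring.
  apply; first by apply: le_trans dr; rewrite lerD2l.
  by move=> z zw; apply: fe => //; exact: le_trans zw wd.
rewrite -(ler_pM2l c0) -cabsM mulr_sumr.
have -> : \sum_(j < M) (w - 1) * (w ^+ j * f (w ^+ j)) =
    - \sum_(j < M) (F (w ^+ j.+1) - F (w ^+ j) - (w - 1) * (w ^+ j * f (w ^+ j))).
  by rewrite [in RHS]big_split /= tel add0r sumrN opprK.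
rewrite cabsN; apply: le_trans (cabs_sum _ _ _) _.
apply: le_trans (ler_sum _ (fun (j : 'I_M) _ => step j)) _.
by rewrite sumr_const card_ord -mulr_natr; lra.
Qed.

(** As [|cis t - 1| = 2 |sin (t / 2)|], it suffices that [sin^2 u <= u^2]. The mean value theorem
    bounds [sin] from above; a negative sine cannot occur for [0 <= u < 1], and [u >= 1] is
    trivial. *)
Lemma cabs_cis_sub1 (t : R) : cabs (cis t - 1) <= `|t|.
Proof.
have sl (u : R) : 0 <= u -> sin u <= u.
  move=> u0.
  have [c _] := @MVT_segment R sin cos 0 u u0 _ (continuous_subspaceT (@continuous_sin R)).
  by rewrite sin0 !subr0 => ->; rewrite ler_piMl // cos_le1.
have sl2 (u : R) : sin u ^+ 2 <= u ^+ 2.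
  wlog u0 : u / 0 <= u => [hw|].
    have [|/ltW u0] := leP 0 u; first exact: hw.
    by rewrite -(sqrrN u) -(sqrrN (sin u)) -sinN; apply: hw; lra.
  have [s0|s1] := leP 0 (sin u); first by rewrite ler_sqr ?nnegrE ?sl.
  have [u1|u1] := leP 1 u.
    by apply: (@le_trans _ _ 1); [have := cos2Dsin2 u; have := sqr_ge0 (cos u); lra|rewrite exprn_ege1].
  have [u00|un0] := eqVneq u 0; first by rewrite u00 sin0.
  by have := @sin2_gt0 R u ltac:(rewrite lt_neqAle eq_sym un0 u0 /=; lra); lra.
rewrite -ler_sqr ?nnegrE ?cabs_ge0 // cabs_sqr real_normK ?num_real //.
have -> : t = (t / 2) *+ 2 by rewrite -mulr_natr; field.
rewrite /cis /= cos_mulr2n sin_mulr2n subr0.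
have := sl2 (t / 2); have := cos2Dsin2 (t / 2).
move: (cos _) (sin _) => c s cs sl'.
have -> : (c ^+ 2 *+ 2 - 1 - 1) ^+ 2 + ((c * s) *+ 2) ^+ 2 = 4 * s ^+ 2.
  have c2 : c ^+ 2 = 1 - s ^+ 2 by rewrite -cs addrK.
  by rewrite -(mulr_natr (c ^+ 2)) -(mulr_natr (c * s)) !exprMn c2; ring.
by rewrite -(mulr_natr (t / 2)) exprMn; lra.
Qed.

End Primitive.

(** * Density of polynomials *)

Section Holomorphy.
Variable R : realType.

Definition hol_at (V : normedModType R[i]) (f : R[i] -> V) (p : R[i]) := exists f' : V,
  forall e : R, 0 < e -> exists2 d : R, 0 < d &
    forall z, cabs (z - p) <= d -> rnorm (f z - f p - (z - p) *: f') <= e * cabs (z - p).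

Lemma derivable_hol (V : normedModType R[i]) (f : R[i]^o -> V) (p : R[i]) :
  derivable f p 1 -> hol_at f p.
Proof.
move=> /cvg_ex[/= l /cvgrPdist_le fl]; exists l => e e0.
have := fl e%:C; rewrite ltcR => /(_ e0) [_ /= /pos_complexP[d d0 ->] dP].
exists (d / 2) => [|z zd]; first by lra.
have [->|zp] := eqVneq z p; first by rewrite !subrr scale0r subrr rnorm0 cabs0 mulr0.
have h0 : z - p != 0 by rewrite subr_eq0.
have := dP (z - p) _ h0; rewrite /= sub0r normrN -cabsE ltcR => /(_ ltac:(lra)).
have -> : (z - p)%:A + p = z by rewrite [_%:A]mulr1 subrK.
rewrite -rnormE lecR rnormB => le.
have -> : f z - f p - (z - p) *: l = (z - p) *: ((z - p)^-1 *: (f z - f p) - l).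
  by rewrite scalerBr scalerA mulfV // scale1r.
by rewrite rnormZc mulrC ler_wpM2r // cabs_ge0.
Qed.

Lemma hol_at_scale (V : normedModType R[i]) (f : R[i] -> V) p :
  hol_at f p -> hol_at (fun z => z *: f z) p.
Proof.
move=> [f' f'P]; exists (p *: f' + f p) => e e0.
pose k := cabs p + 2 + rnorm f'.
have k0 : 0 < k by have := cabs_ge0 p; have := rnorm_ge0 f'; rewrite /k; lra.
have ek : 0 < e / k by exact: divr_gt0.
have [d d0 dP] := f'P _ ek; exists (Num.min d (Num.min 1 (e / k))).
  by rewrite !lt_min d0 ek ltr01.
move=> z; rewrite !le_min => /and3P[zd z1 ze].
have -> : z *: f z - p *: f p - (z - p) *: (p *: f' + f p) =
   z *: (f z - f p - (z - p) *: f') + (z - p) *: ((z - p) *: f').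
  rewrite !scalerBr scalerDr.
  have -> : z *: ((z - p) *: f') = (z - p) *: (p *: f') + (z - p) *: ((z - p) *: f').
    by rewrite !scalerA -scalerDl; congr (_ *: _); ring.
  have -> : z *: f p = (z - p) *: f p + p *: f p by rewrite -scalerDl subrK.
  rewrite [in RHS](opprD (_ *: (p *: f'))) addrA subrK -addrA -opprD -addrA -opprD.
  by congr (_ - _); rewrite [_ + (z - p) *: f p]addrC addrA [p *: f p + _]addrC.
apply: le_trans (rnormD _ _) _; rewrite !rnormZc.
have zz : cabs z <= cabs p + 1 by apply: le_trans (cabsBD z p) _; rewrite lerD2l.
have c0 := cabs_ge0 (z - p).
have -> : e * cabs (z - p) = (cabs p + 2) * (e / k * cabs (z - p)) + cabs (z - p) * ((e / k) * rnorm f').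
  have : e = e / k * (cabs p + 2 + rnorm f') by rewrite divfK // lt0r_neq0.
  by move=> {1}->; ring.
apply: lerD.
  apply: le_trans (ler_wpM2r (rnorm_ge0 _) zz) _.
  apply: ler_pM (dP z zd); rewrite ?rnorm_ge0 //; have := cabs_ge0 p; lra.
by rewrite ler_wpM2l // ler_wpM2r // rnorm_ge0.
Qed.

Lemma hol_at_inner (E F : hilbertType R) (f : R[i] -> bounded_op E F) (a p : R[i]) e v :
  hol_at f (a * p) -> cdiff (fun z => inner (f (a * z) e) v) p.
Proof.
move=> [f' f'P]; exists (a * inner (f' e) v) => c c0.
pose k := cabs a * rnorm e * rnorm v + 1.
have k0 : 0 < k by rewrite ltr_pwDr // !mulr_ge0 ?cabs_ge0 ?rnorm_ge0.
have [d d0 dP] := f'P (c / k) (divr_gt0 c0 k0).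
have a1 : 0 < cabs a + 1 by have := cabs_ge0 a; lra.
exists (d / (cabs a + 1)); first exact: divr_gt0.
move=> z; rewrite ler_pdivlMr // => zd.
have ad : cabs (a * z - a * p) = cabs a * cabs (z - p) by rewrite -mulrBr cabsM.
have := dP (a * z); rewrite ad => /(_ ltac:(have := cabs_ge0 (z - p); lra)) le.
have -> : inner (f (a * z) e) v - inner (f (a * p) e) v - a * inner (f' e) v * (z - p) =
    inner ((f (a * z) - f (a * p) - (a * z - a * p) *: f') e) v.
  rewrite !sub_opE scale_opE !(psdBl (inner_psd F)) (psdZl (inner_psd F)); ring.
apply: le_trans (inner_CS _ _) _.
apply: le_trans (ler_wpM2r (rnorm_ge0 _) (opnorm_bound _ _)) _.
rewrite -rnorm_op -mulrA.
apply: le_trans (ler_wpM2r (mulr_ge0 (rnorm_ge0 _) (rnorm_ge0 _)) le) _.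
have -> : c / k * (cabs a * cabs (z - p)) * (rnorm e * rnorm v) =
  c * cabs (z - p) * ((cabs a * rnorm e * rnorm v) / k) by field; exact: lt0r_neq0.
rewrite ler_piMr //; first by rewrite mulr_ge0 ?cabs_ge0 // ltW.
by rewrite ler_pdivrMr // mul1r /k lerDl.
Qed.

(* The radial retraction onto the closed disc: values of [f \o clamp] are
   controlled on the whole plane, where [antiderivative] needs continuity. *)
Definition clamp (z : R[i]) : R[i] := z / (Num.max 1 (cabs z))%:C.

Lemma cabs_clamp z : cabs (clamp z) <= 1.
Proof.
have m0 : 0 < Num.max 1 (cabs z) by rewrite lt_max ltr01.
rewrite /clamp cabsM cabsV cabs_real ger0_norm; last exact: ltW.
by rewrite ler_pdivrMr // mul1r le_max lexx orbT.
Qed.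

Lemma clamp_id z : cabs z <= 1 -> clamp z = z.
Proof. by move=> z1; rewrite /clamp max_l // rmorph1 divr1. Qed.

Lemma clamp_lip z w : cabs (clamp z - clamp w) <= 2 * cabs (z - w).
Proof.
pose m (u : R[i]) := Num.max 1 (cabs u).
have m1 u : 1 <= m u by rewrite le_max lexx.
have mu0 u : (m u)%:C != 0 by rewrite fmorph_eq0 gt_eqF //; have := m1 u; lra.
have -> : clamp z - clamp w = (z - w) / (m z)%:C + clamp w * (((m w)%:C - (m z)%:C) / (m z)%:C).
  by rewrite /clamp -/(m z) -/(m w); field; rewrite !mu0.
have dm : cabs ((m w)%:C - (m z)%:C) <= cabs (z - w).
  rewrite -rmorphB cabs_real.
  have h1 := cabsBD z w; have h2 := cabsBD w z; rewrite cabsB in h2.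
  have c0 := cabs_ge0 (z - w).
  rewrite ler_norml /m.
  by case: (leP 1 (cabs w)) => ?; case: (leP 1 (cabs z)) => ?; apply/andP; lra.
have mV x : cabs (x / (m z)%:C) <= cabs x.
  rewrite cabsM cabsV cabs_real ger0_norm; last by have := m1 z; lra.
  by rewrite ler_pdivrMr; have := m1 z; have := cabs_ge0 x; [nra|lra].
apply: le_trans (cabsD _ _) _; rewrite mulr_natl mulr2n; apply: lerD; first exact: mV.
rewrite cabsM -[leRHS]mul1r; apply: ler_pM; rewrite ?cabs_ge0 ?cabs_clamp //.
exact: le_trans (mV _) dm.
Qed.

Lemma cabs_innerB (E F : hilbertType R) (A B : bounded_op E F) e v (c : R) :
  rnorm (A - B) <= c -> cabs (inner (A e) v - inner (B e) v) <= c * (rnorm e * rnorm v).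
Proof.
move=> le; rewrite -(psdBl (inner_psd F)) -sub_opE.
apply: le_trans (inner_CS _ _) _.
apply: le_trans (ler_wpM2r (rnorm_ge0 _) (opnorm_bound _ _)) _.
by rewrite -rnorm_op -mulrA ler_wpM2r // mulr_ge0 ?rnorm_ge0.
Qed.

Lemma cdiff_local (f g : R[i] -> R[i]) (p : R[i]) (d : R) : 0 < d ->
  (forall z, cabs (z - p) <= d -> g z = f z) -> cdiff f p -> cdiff g p.
Proof.
move=> d0 fg [f' f'P]; exists f' => e e0; have [d' d'0 d'P] := f'P e e0.
exists (Num.min d d'); first by rewrite lt_min d0.
move=> z; rewrite le_min => /andP[zd zd'].
by rewrite (fg z zd) (fg p) ?subrr ?cabs0 ?(ltW d0) //; exact: d'P.
Qed.

Lemma ccont_inner (E F : hilbertType R) (f : R[i] -> bounded_op E F) (a : R[i]) e v :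
  cabs a <= 1 -> disc_cont f -> ccont (fun z => inner (f (clamp (a * z)) e) v).
Proof.
move=> a1 fc p c c0.
pose k := rnorm e * rnorm v + 1.
have k0 : 0 < k by rewrite ltr_pwDr // mulr_ge0 ?rnorm_ge0.
have [d d0 dP] := fc _ (cabs_clamp (a * p)) (c / k) (divr_gt0 c0 k0).
exists (d / 2) => [|z zd]; first by lra.
have := dP _ (cabs_clamp (a * z)).
have -> : cabs (clamp (a * z) - clamp (a * p)) <= d.
  apply: le_trans (clamp_lip _ _) _; rewrite -mulrBr cabsM.
  have := ler_wpM2r (cabs_ge0 (z - p)) a1; lra.
move=> /(_ isT) le; apply: le_trans (cabs_innerB e v le) _.
have -> : c / k * (rnorm e * rnorm v) = c * ((rnorm e * rnorm v) / k) by ring.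
by apply: ler_piMr (ltW c0) _; rewrite ler_pdivrMr // mul1r lerDl.
Qed.

(** [cauchy_discrete] is applied to [z -> <f(r z) x, y>] with [y] the value at [x] of the sum to be
    bounded. The dilation [r = 1 - eta] makes this function holomorphic up to radius [1 + eta], and
    the threshold on [M] does not depend on [x]. *)
Lemma cauchy_op (E F : hilbertType R) (f : R[i] -> bounded_op E F) :
  disc_cont f -> (forall z, cabs z < 1 -> hol_at f z) ->
  forall e : R, 0 < e -> exists M0 : nat, forall M, (M0 <= M)%N ->
    opnorm (\sum_(j < M) uroot R M ^+ j *: f (uroot R M ^+ j)) <= e * M%:R.
Proof.
move=> fc fh e e0.
(* Four fifths of [e] go to [cauchy_discrete], one fifth to replacing [f(w^j)] by [f(r w^j)]. *)
have [d d0 dP] := disc_unif fc (e := e / 5) ltac:(lra).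
pose eta := Num.min (1 / 2) d.
have [eta0 eta1 etad] : [/\ 0 < eta, eta <= 1 / 2 & eta <= d].
  by rewrite /eta lt_min d0 !ge_min !lexx orbT andbT; split => //; lra.
(* The half compensates the Lipschitz constant 2 of [clamp]. *)
pose d' := Num.min eta (d / 2).
have d2 : 0 < d / 2 by lra.
have [d'0 d'1 d'd] : [/\ 0 < d', d' <= eta & d' <= d / 2].
  by split; [rewrite lt_min eta0 d2|rewrite ge_min lexx|rewrite ge_min lexx orbT].
pose r := (1 - eta)%:C.
have rE : cabs r = 1 - eta by rewrite cabs_real ger0_norm //; lra.
exists (maxn 2 (Num.bound (pi *+ 2 / d'))) => M; rewrite geq_max => /andP[M2 MB].
have Mp : (0 : R) < M%:R by rewrite ltr0n; exact: leq_trans M2.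
set w := uroot R M; have w1 : cabs w = 1 := cabs_uroot R M.
have wj j : cabs (w ^+ j) = 1 by rewrite cabsX w1 expr1n.
have pi0 : 0 <= (pi : R) *+ 2 by rewrite mulrn_wge0 // pi_ge0.
have wd : cabs (w - 1) <= d'.
  apply: le_trans (cabs_cis_sub1 _) _; rewrite ger0_norm; last by rewrite divr_ge0 // ltW.
  rewrite ler_pdivrMr // mulrC -ler_pdivrMr //; apply: ltW.
  by apply: lt_le_trans (archi_boundP (divr_ge0 pi0 (ltW d'0))) _; rewrite ler_nat.
apply: opnorm_le_bound => [|x]; first by rewrite mulr_ge0 ?ltW.
set X := \sum_(j < M) _; set y := X x.
have [y0|y0] := eqVneq (rnorm y) 0.
  by rewrite y0 mulr_ge0 ?rnorm_ge0 ?mulr_ge0 // ltW.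
have {}y0 : 0 < rnorm y by rewrite lt_neqAle eq_sym y0 rnorm_ge0.
pose g z := inner (f (clamp (r * z)) x) y.
pose e1 := e / 5 * (rnorm x * rnorm y).
have gd z : cabs z <= 1 + eta -> cdiff g z.
  move=> z1; have rz : cabs (r * z) < 1.
    rewrite cabsM rE; apply: le_lt_trans (ler_wpM2l _ z1) _; first by lra.
    have := mulr_gt0 eta0 eta0; lra.
  have dz : 0 < 1 - cabs (r * z) by rewrite subr_gt0.
  apply: (cdiff_local (f := fun z => inner (f (r * z) x) y) dz); last exact/hol_at_inner/fh.
  move=> z' zz'; rewrite /g clamp_id //; apply: le_trans (cabsBD _ (r * z)) _.
  have : cabs (r * z' - r * z) <= cabs (z' - z).
    by rewrite -mulrBr cabsM ler_piMl ?cabs_ge0 // rE; lra.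
  lra.
have go z z' : cabs z = 1 -> cabs (z' - z) <= d' -> cabs (g z' - g z) <= e1.
  move=> z1 zd; apply: cabs_innerB; apply: dP; rewrite ?cabs_clamp //.
  apply: le_trans (clamp_lip _ _) _; rewrite -mulrBr cabsM rE.
  apply: (@le_trans _ _ (2 * cabs (z' - z))); last by lra.
  by rewrite ler_pM2l // ler_piMl ?cabs_ge0 //; lra.
have wn1 : w != 1 by have := @uroot_neq1 R M 1; rewrite expr1; apply.
have w1M : w ^+ M = 1 by apply: uroot_expr; exact: leq_trans M2.
have r1 : cabs r <= 1 by rewrite rE; lra.
have main : cabs (\sum_(j < M) w ^+ j * g (w ^+ j)) <= 4 * e1 * M%:R.
  apply: (cauchy_discrete (r := 1 + eta) (d := d') (ccont_inner x y r1 fc)) => //.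
  lra.
have yE : rnorm y ^+ 2 = cabs (\sum_(j < M) w ^+ j * inner (f (w ^+ j) x) y).
  have -> : \sum_(j < M) w ^+ j * inner (f (w ^+ j) x) y = inner y y.
    have yX : y = \sum_(j < M) w ^+ j *: f (w ^+ j) x by rewrite /y /X sum_opE.
    transitivity (inner (\sum_(j < M) w ^+ j *: f (w ^+ j) x) y); last by rewrite -yX.
    rewrite (psd_suml (inner_psd F)); apply: eq_bigr => j _.
    by rewrite (psdZl (inner_psd F)).
  by rewrite -rnorm_sqr cabs_real ger0_norm ?sqr_ge0.
have diff : cabs (\sum_(j < M) w ^+ j * inner (f (w ^+ j) x) y - \sum_(j < M) w ^+ j * g (w ^+ j)) <= e1 * M%:R.
  rewrite -sumrB; apply: le_trans (cabs_sum _ _ _) _.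
  rewrite mulr_natr -[in leRHS](card_ord M) -sumr_const; apply: ler_sum => j _.
  rewrite -mulrBr cabsM wj mul1r; apply: cabs_innerB.
  have wr : cabs (r * w ^+ j) <= 1 by rewrite cabsM wj mulr1.
  rewrite clamp_id // rnormB; apply: dP => //; rewrite ?wj //.
  have -> : r * w ^+ j - w ^+ j = - (eta%:C * w ^+ j) by rewrite /r rmorphB rmorph1; ring.
  by rewrite cabsN cabsM wj mulr1 cabs_real ger0_norm // ltW.
have := cabsBD (\sum_(j < M) w ^+ j * inner (f (w ^+ j) x) y) (\sum_(j < M) w ^+ j * g (w ^+ j)).
rewrite -yE => le; rewrite -(ler_pM2r y0) -expr2.
apply: le_trans (le_trans le (lerD main diff)) _.
by rewrite /e1 le_eqVlt; apply/orP; left; apply/eqP; field.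
Qed.

End Holomorphy.

Section Fejer.
Variables (R : realType) (V : normedModType R[i]).

(** The Dirichlet kernel at [z conj(w)]; its squared modulus divided by [N] is the Fejer kernel. *)
Definition dirichlet (N : nat) (z w : R[i]) : R[i] := \sum_(n < N) z ^+ n * Num.conj (w ^+ n).

Lemma dirichlet_far N z w (d : R) : cabs z = 1 -> cabs w = 1 -> 0 < d -> d <= cabs (w - z) ->
  cabs (dirichlet N z w) ^+ 2 <= 4 / d ^+ 2.
Proof.
move=> z1 w1 d0 dzw; pose x := z * Num.conj w.
have x1 : cabs x = 1 by rewrite cabsM cabs_conj z1 w1 mulr1.
have DE : dirichlet N z w = \sum_(n < N) x ^+ n.
  by apply: eq_bigr => n _; rewrite /x exprMn rmorphXn.
have xw : cabs (x - 1) = cabs (w - z).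
  rewrite cabsB -[LHS]mulr1 -w1 -cabsM /x (conj_unit w1) mulrBl mul1r divfK //.
  by rewrite -cabs_gt0 w1 ltr01.
have : cabs (x - 1) * cabs (dirichlet N z w) <= 2.
  rewrite -cabsM DE -subrX1; apply: le_trans (cabsD _ _) _.
  by rewrite cabsX x1 expr1n cabsN cabs1.
rewrite xw => le; rewrite ler_pdivlMr ?exprn_gt0 // -exprMn -[4](_ : 2 ^+ 2 = _); last by ring.
rewrite ler_sqr ?nnegrE ?mulr_ge0 ?cabs_ge0 ?(ltW d0) // mulrC.
by apply: le_trans le; rewrite ler_wpM2r ?cabs_ge0.
Qed.

Lemma dirichlet_sum N M z : (N <= M)%N -> cabs z = 1 ->
  \sum_(j < M) cabs (dirichlet N z (uroot R M ^+ j)) ^+ 2 = M%:R * N%:R.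
Proof.
move=> NM z1; pose a n := if (n < N)%N then Num.conj (z ^+ n) else 0.
have := parseval_scalar M a.
have -> : \sum_(n < M) cabs (a n) ^+ 2 = N%:R :> R.
  have -> : N%:R = \sum_(n < N) (1 : R) by rewrite sumr_const card_ord.
  rewrite (big_ord_widen M (fun=> 1 : R)) // [RHS]big_mkcond; apply: eq_bigr => n _.
  by rewrite /a; case: ltnP; rewrite ?cabs0 ?expr0n // cabs_conj cabsX z1 !expr1n.
move=> <-; apply: eq_bigr => j _; rewrite -cabs_conj; congr (cabs _ ^+ 2).
rewrite rmorph_sum /= (big_ord_widen M (fun n => Num.conj (z ^+ n * Num.conj ((uroot R M ^+ j) ^+ n)))) //.
rewrite [LHS]big_mkcond; apply: eq_bigr => n _; rewrite /a; case: ltnP; rewrite ?mulr0 // => _.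
by rewrite rmorphM /= conjCK -exprM mulrC.
Qed.

Lemma sum_const2 (N : nat) (c : R) : \sum_(n < N) \sum_(l < N) c = c * N%:R * N%:R.
Proof. by rewrite !big_const_ord !iter_addr_0 !mulr_natr. Qed.

(* By hypothesis the discrete Fourier coefficients of negative frequency are
   negligible; dropping them from the discrete Fejer mean leaves a polynomial. *)
Lemma fejer_approx (f : R[i] -> V) : disc_cont f ->
  (forall (m : nat) (e : R), 0 < e -> exists M0 : nat, forall M, (M0 <= M)%N ->
     rnorm (\sum_(j < M) uroot R M ^+ (j * m.+1) *: f (uroot R M ^+ j)) <= e * M%:R) ->
  forall e : R, 0 < e -> exists (N : nat) (c : nat -> V), forall z, cabs z = 1 ->
    rnorm (\sum_(k < N) z ^+ k *: c k - f z) <= e.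
Proof.
move=> fc neg e e0.
have [B B0 BP] := disc_bounded fc.
have [d d0 dP] := disc_unif fc (e := e / 3) ltac:(lra).
have d2 : 0 < d ^+ 2 := exprn_gt0 2 d0.
(* Far from [z] the squared kernel is at most [4 / d^2] and [f] varies by at most [2 B]; this [N]
   makes that share at most [e / 3]. *)
pose N := (Num.bound (24 * B / (d ^+ 2 * e))).+1.
have N0 : (0 : R) < N%:R by rewrite ltr0n.
have NB : 8 * B / d ^+ 2 <= e / 3 * N%:R.
  have : 24 * B / (d ^+ 2 * e) < N%:R.
    by apply: lt_le_trans (archi_boundP _) _; rewrite ?ler_nat // !(mulr_ge0, invr_ge0) // ltW.
  rewrite ltr_pdivrMr ?mulr_gt0 // => /ltW le; rewrite ler_pdivrMr //.
  by have -> : e / 3 * N%:R * d ^+ 2 = N%:R * (d ^+ 2 * e) / 3; [ring|rewrite ler_pdivlMr //; lra].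
(* At most [N^2] terms of negative frequency are dropped; after division by [M N] they contribute at
   most [e / 3]. *)
have [M0 M0P] := choice (fun m => neg m (e / (3 * N%:R)) ltac:(by apply: divr_gt0 => //; apply: mulr_gt0)).
pose M := maxn N (\max_(m < N) M0 m).
have NM : (N <= M)%N by exact: leq_maxl.
have Mp : (0 : R) < M%:R by rewrite ltr0n; apply: leq_trans NM.
have M0M m : (m < N)%N -> (M0 m <= M)%N.
  by move=> mN; apply: leq_trans (leq_maxr _ _); exact: (leq_bigmax (Ordinal mN)).
set w := uroot R M; have w1 : cabs w = 1 := cabs_uroot R M.
have wX k : cabs (w ^+ k) = 1 by rewrite cabsX w1 expr1n.
(* [M] times the discrete Fourier coefficient of [f] at frequency [n - l]. *)
pose A n l := \sum_(j < M) (Num.conj (w ^+ (j * n)) * w ^+ (j * l)) *: f (w ^+ j).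
pose K : R[i] := (M%:R * N%:R).
have K0 : K != 0 by rewrite mulf_neq0 // pnatr_eq0 -lt0n // (leq_trans _ NM).
exists N, (fun k => K^-1 *: \sum_(n < N) \sum_(l < N | (l <= n)%N && (n - l == k)%N) A n l) => z z1.
have zX k : cabs (z ^+ k) = 1 by rewrite cabsX z1 expr1n.
set P := \sum_(k < N) _.
pose S := \sum_(n < N) \sum_(l < N) (z ^+ n * Num.conj (z ^+ l)) *: A n l.
have SE : S = \sum_(j < M) (cabs (dirichlet N z (w ^+ j)) ^+ 2)%:C *: f (w ^+ j).
  transitivity (\sum_(n < N) \sum_(l < N) \sum_(j < M)
      ((z ^+ n * Num.conj ((w ^+ j) ^+ n)) * (Num.conj (z ^+ l) * (w ^+ j) ^+ l)) *: f (w ^+ j)).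
    apply: eq_bigr => n _; apply: eq_bigr => l _; rewrite scaler_sumr; apply: eq_bigr => j _.
    by rewrite scalerA !exprM; congr (_ *: _); ring.
  under eq_bigr do rewrite exchange_big; rewrite exchange_big; apply: eq_bigr => j _ /=.
  rewrite rmorphXn /= cabsE normCK rmorph_sum /= mulr_suml scaler_suml; apply: eq_bigr => n _.
  rewrite mulr_sumr scaler_suml; apply: eq_bigr => l _.
  by rewrite [in RHS]rmorphM /= conjCK.
have SP : rnorm (S - K *: P) <= N%:R * M%:R * (e / 3).
  have KP : K *: P = \sum_(n < N) \sum_(l < N | (l <= n)%N) z ^+ (n - l) *: A n l.
    rewrite /P scaler_sumr.
    under eq_bigr do rewrite !scalerA mulrAC mulfV // mul1r scaler_sumr.
    rewrite exchange_big; apply: eq_bigr => n _ /=.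
    under eq_bigr do rewrite scaler_sumr.
    rewrite (exchange_big_dep (fun l : 'I_N => (l <= n)%N)) /=; last by move=> k l _ /andP[].
    apply: eq_bigr => l ln; have lt : (n - l < N)%N by apply: leq_ltn_trans (leq_subr _ _) _.
    rewrite (big_pred1 (Ordinal lt)) // => k /=.
    by rewrite ln /= eq_sym.
  have -> : S - K *: P = \sum_(n < N) \sum_(l < N | ~~ (l <= n)%N) (z ^+ n * Num.conj (z ^+ l)) *: A n l.
    rewrite KP -sumrB; apply: eq_bigr => n _.
    rewrite (bigID (fun l : 'I_N => (l <= n)%N)) /= addrC.
    rewrite [X in _ + X - _](_ : _ = \sum_(l < N | (l <= n)%N) z ^+ (n - l) *: A n l) ?addrK //.
    apply: eq_bigr => l ln; congr (_ *: _).
    by rewrite (conj_unit (zX l)) -{1}(subnK ln) exprD mulfK // -cabs_gt0 zX ltr01.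
  have c0 : 0 <= e / (3 * N%:R) * M%:R by rewrite !(mulr_ge0, invr_ge0) // ltW.
  have bound (n l : 'I_N) : ~~ (l <= n)%N ->
      rnorm ((z ^+ n * Num.conj (z ^+ l)) *: A n l) <= e / (3 * N%:R) * M%:R.
    rewrite -ltnNge => nl; rewrite rnorm_scale1; last by rewrite cabsM cabs_conj !zX mulr1.
    have kE : (l - n)%N = (l - n).-1.+1 by rewrite prednK // subn_gt0.
    have kN : ((l - n).-1 < N)%N by rewrite -kE; apply: leq_trans (leq_subr _ _) (ltnW _).
    have := M0P _ _ (M0M _ kN); rewrite -kE; apply: le_trans.
    rewrite le_eqVlt; apply/orP; left; apply/eqP; congr rnorm; apply: eq_bigr => j _.
    congr (_ *: _); rewrite (conj_unit (wX _)) -{1}(subnK (ltnW nl)) mulnDr exprD mulrC mulfK //.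
    by rewrite -cabs_gt0 wX ltr01.
  have -> : N%:R * M%:R * (e / 3) = \sum_(n < N) \sum_(l < N) (e / (3 * N%:R) * M%:R).
    have gen (a b : R) : 0 < a -> a * b * (e / 3) = e / (3 * a) * b * a * a.
      by move=> a0; field; rewrite gt_eqF.
    by rewrite sum_const2 -gen.
  apply: le_trans (rnorm_sum _ _ _) _; apply: ler_sum => n _.
  apply: le_trans (rnorm_sum _ _ _) _; rewrite big_mkcond; apply: ler_sum => l _.
  by case: ifP => // /bound.
have Sf : rnorm (S - K *: f z) <= M%:R * N%:R * (e / 3) + M%:R * (8 * B / d ^+ 2).
  have KE : K = \sum_(j < M) (cabs (dirichlet N z (w ^+ j)) ^+ 2)%:C.
    by rewrite -rmorph_sum dirichlet_sum // rmorphM /= !rmorph_nat.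
  rewrite SE KE scaler_suml -sumrB; apply: le_trans (rnorm_sum _ _ _) _.
  rewrite -(dirichlet_sum NM z1) mulr_suml.
  have -> : M%:R * (8 * B / d ^+ 2) = \sum_(j < M) (8 * B / d ^+ 2) :> R.
    by rewrite sumr_const card_ord mulr_natl.
  rewrite -big_split; apply: ler_sum => j _ /=.
  rewrite -scalerBr rnormZc cabs_real ger0_norm ?sqr_ge0 //.
  have D0 := sqr_ge0 (cabs (dirichlet N z (w ^+ j))).
  have b0 : 0 <= 8 * B / d ^+ 2 by rewrite divr_ge0 ?mulr_ge0 // ltW.
  have [near|far] := leP (cabs (w ^+ j - z)) d.
    have h := dP z (w ^+ j); rewrite z1 wX lexx in h.
    by rewrite -[leLHS]addr0; apply: lerD b0; rewrite ler_wpM2l // h.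
  rewrite -[leLHS]add0r; apply: lerD; first by rewrite mulr_ge0 //; lra.
  have -> : 8 * B / d ^+ 2 = 4 / d ^+ 2 * (B + B) by field; rewrite gt_eqF.
  apply: ler_pM => //; first exact: rnorm_ge0.
    exact: dirichlet_far (ltW far).
  by apply: le_trans (rnorm_leD _ _) _; apply: lerD; apply: BP; rewrite ?wX ?z1.
have : rnorm (K *: (P - f z)) <= M%:R * N%:R * e.
  have -> : K *: (P - f z) = (S - K *: f z) - (S - K *: P).
    by rewrite scalerBr opprB [RHS]addrC addrA subrK.
  apply: le_trans (rnorm_leD _ _) _; apply: le_trans (lerD Sf SP) _.
  have := ler_wpM2l (ltW Mp) NB; lra.
rewrite rnormZc; have -> : cabs K = M%:R * N%:R.
  by rewrite /K -natrM -[_%:R](rmorph_nat (real_complex R)) cabs_real natrM ger0_norm // mulr_ge0 // ltW.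
by rewrite ler_pM2l // mulr_gt0.
Qed.

End Fejer.

Section Density.
Variables (R : realType) (E F : hilbertType R).

Lemma disc_cont_scale (V : normedModType R[i]) (f : R[i] -> V) :
  disc_cont f -> disc_cont (fun z => z *: f z).
Proof.
move=> fc p p1 e e0; have [d d0 dP] := fc p p1 (e / 2) ltac:(lra).
have k0 : 0 < 2 * (rnorm (f p) + 1) by have := rnorm_ge0 (f p); lra.
exists (Num.min d (e / (2 * (rnorm (f p) + 1)))); first by rewrite lt_min d0 divr_gt0.
move=> z z1; rewrite le_min => /andP[zd ze].
have -> : z *: f z - p *: f p = z *: (f z - f p) + (z - p) *: f p.
  by rewrite scalerBr scalerBl addrA subrK.
apply: le_trans (rnormD _ _) _; rewrite !rnormZc [e](splitr e); apply: lerD.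
  apply: le_trans (dP z z1 zd); rewrite -[leRHS]mul1r ler_wpM2r ?rnorm_ge0 //.
rewrite ler_pdivlMr // in ze.
have := cabs_ge0 (z - p); lra.
Qed.

Lemma poly_dense (W : R[i]^o -> bounded_op E F) (e : R) : disc_algebra W -> 0 < e ->
  exists p, disc_norm (fun z => op_poly p z - W z) <= e.
Proof.
move=> HW e0; have Wc := disc_algebra_cont HW.
have [|N [c cP]] := fejer_approx Wc _ e0; last first.
  exists (mkseq c N); apply: disc_norm_lub => z z1; rewrite -rnorm_op.
  apply: le_trans (cP z z1); rewrite /op_poly size_mkseq le_eqVlt; apply/orP; left; apply/eqP.
  by congr (rnorm (_ - _)); apply: eq_bigr => j _; rewrite nth_mkseq.
(* The coefficient of [W] at frequency [- (m + 1)] is the discrete Cauchy integral of [z^m W]. *)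
move=> m {}e {}e0; pose V z := z ^+ m *: W z.
have [Vc Vh] : disc_cont V /\ forall z, cabs z < 1 -> hol_at V z.
  rewrite /V; elim: m {V} => [|m [IHc IHh]].
    have -> : (fun z : R[i] => z ^+ 0 *: W z) = W by apply/funext => z; rewrite expr0 scale1r.
    split => // z z1; apply: derivable_hol; apply: HW.2; rewrite /unit_disc /= -cabsE.
    by rewrite ltcR.
  have -> : (fun z : R[i] => z ^+ m.+1 *: W z) = (fun z => z *: (z ^+ m *: W z)).
    by apply/funext => z; rewrite scalerA exprS.
  by split=> [|z z1]; [exact: disc_cont_scale|exact/hol_at_scale/IHh].
have [M0 M0P] := cauchy_op Vc Vh e0; exists M0 => M /M0P; rewrite -rnorm_op.
apply: le_trans; rewrite le_eqVlt; apply/orP; left; apply/eqP; congr rnorm.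
by apply: eq_bigr => j _; rewrite /V scalerA exprM exprS.
Qed.

End Density.

(** * Approximate eigenvectors *)

Section Resolvent.
Variables (R : realType) (H : hilbertType R).
Implicit Types (T S : bounded_op H H).

Lemma rcvg_eval (A : nat -> bounded_op H H) S (x : H) :
  rcvg A S -> rcvg (fun n => A n x) (S x).
Proof.
move=> AS e e0; have k0 : 0 < rnorm x + 1 by rewrite ltr_wpDl ?rnorm_ge0.
have [N NP] := AS _ (divr_gt0 e0 k0); exists N => n /NP.
rewrite rnorm_op ler_pdivlMr // -sub_opE => le; apply: le_trans (opnorm_bound _ _) _.
by apply: le_trans le; rewrite ler_wpM2l ?opnorm_ge0 // lerDl.
Qed.

Lemma rcvg_apply S (u : nat -> H) (x : H) : rcvg u x -> rcvg (fun n => S (u n)) (S x).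
Proof.
move=> ux e e0; have k0 : 0 < opnorm S + 1 by rewrite ltr_wpDl ?opnorm_ge0.
have [N NP] := ux _ (divr_gt0 e0 k0); exists N => n /NP.
rewrite ler_pdivlMr // -opB => le; apply: le_trans (opnorm_bound _ _) _.
by apply: le_trans le; rewrite mulrC ler_wpM2l ?rnorm_ge0 // lerDl.
Qed.

Lemma neumann T (z : R[i]) : contraction_op T -> 1 < cabs z ->
  exists S, is_inverse S (z *: (1 : bounded_op H H) - T).
Proof.
move=> T1 z1; set q := (cabs z)^-1.
have q01 : 0 <= q < 1 by rewrite invr_ge0 cabs_ge0 invf_lt1 //; lra.
have z0 : z != 0 by rewrite -cabs_gt0; lra.
pose A n : bounded_op H H := \sum_(k < n) z^-1 ^+ k.+1 *: T ^+ k.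
set D := z *: (1 : bounded_op H H) - T.
have DE (y : H) : D y = z *: y - T y by [].
have AD n (x : H) : A n (D x) = x - z^-1 ^+ n *: (T ^+ n) x.
  elim: n => [|n IH]; first by rewrite /A big_ord0 expr0 scale1r expr0 one_opE subrr.
  have -> : A n.+1 = A n + z^-1 ^+ n.+1 *: T ^+ n by rewrite /A big_ord_recr.
  rewrite add_opE IH scale_opE DE opB bounded_opZ scalerBr scalerA.
  rewrite -{1}[T]expr1 -mul_opE -exprSr [z^-1 ^+ n.+1]exprSr divfK //.
  by rewrite addrA subrK.
have AC n : D * A n = A n * D.
  rewrite /A mulr_sumr mulr_suml; apply: eq_bigr => k _.
  rewrite scale_opMr scale_opM; congr (_ *: _).
  by rewrite /D mulrBl mulrBr scale_opM scale_opMr mul1r mulr1 -exprS -exprSr.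
have DA n (x : H) : D (A n x) = x - z^-1 ^+ n *: (T ^+ n) x.
  by rewrite -mul_opE AC mul_opE AD.
have tail n (x : H) : rnorm (z^-1 ^+ n *: (T ^+ n) x) <= q ^+ n * rnorm x.
  rewrite rnormZc cabsX cabsV; apply: ler_wpM2l; last exact: contrX_le.
  by apply: exprn_ge0; case/andP: q01.
have qn : `|q| < 1 by rewrite ger0_norm; lra.
have qsmall e : 0 < e -> exists N, forall k, (N <= k)%N -> q ^+ k <= e.
  move=> e0; have /cvgrPdist_le /(_ _ e0) [N _ NP] := cvg_expr qn; exists N => k /NP.
  by rewrite /= sub0r normrN ger0_norm // exprn_ge0 //; lra.
have [|S SA] := op_cauchy (A := A).
  move=> e e0; pose e' := e * (cabs z - 1) / 2.
  have e'0 : 0 < e' by rewrite divr_gt0 // mulr_gt0 //; lra.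
  have [N NP] := qsmall _ e'0.
  exists N => m n Nm Nn; apply: opnorm_le_bound => [|x]; first exact: ltW.
  have x0 := rnorm_ge0 x.
  have dx (u v : H) : x - u - (x - v) = v - u by rewrite opprB addrC addrA subrK.
  (* The lower bound for [z - T] turns the small difference of the [D (A n x)] into a Cauchy
     estimate for the partial sums [A n]. *)
  have := contr_lower z ((A m - A n) x) T1; rewrite -DE sub_opE opB !DA dx => le.
  have {}le := le_trans le (rnorm_leD _ _).
  have h1 := le_trans (tail n x) (ler_wpM2r x0 (NP _ Nn)).
  have h2 := le_trans (tail m x) (ler_wpM2r x0 (NP _ Nm)).
  have zp : 0 < cabs z - 1 by lra.
  rewrite -(ler_pM2l zp); apply: le_trans le _.
  have -> : (cabs z - 1) * (e * rnorm x) = e' * rnorm x + e' * rnorm x by rewrite /e'; field.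
  exact: lerD.
have rest (x : H) : rcvg (fun n => x - z^-1 ^+ n *: (T ^+ n) x) x.
  move=> e e0; have k0 : 0 < rnorm x + 1 by rewrite ltr_wpDl ?rnorm_ge0.
  have [N NP] := qsmall _ (divr_gt0 e0 k0); exists N => n /NP.
  rewrite ler_pdivlMr // addrAC subrr add0r rnormN => le; apply: le_trans (tail _ _) _.
  by apply: le_trans le; rewrite ler_wpM2l ?exprn_ge0 ?lerDl //; lra.
exists S; split; apply: opP => x; rewrite mul_opE one_opE.
  apply: rcvg_unique (rest x); have := rcvg_eval (D x) SA.
  by under eq_fun do rewrite AD.
apply: rcvg_unique (rest x); have := rcvg_apply D (rcvg_eval x SA).
by under eq_fun do rewrite DA.
Qed.

Lemma ritt_of_lower T (c : R) : contraction_op T -> 0 < c ->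
  (forall z x, 1 < cabs z -> c * cabs (z - 1) * rnorm x <= rnorm (z *: x - T x)) -> ritt T.
Proof.
move=> T1 c0 low; split.
  move=> z no; rewrite /= -cabsE lecR leNgt; apply/negP => z1.
  by apply: no; exact: neumann.
exists c^-1; move=> _ [z /= z1 <-]; rewrite -/(cabs (z - 1)).
rewrite -cabsE ltcR in z1.
have [U UP] := neumann T1 z1.
have [_ rE] : is_inverse (resolvent T z) (z *: (1 : bounded_op H H) - T).
  by rewrite /resolvent; case: xgetP => [V _ //|/(_ U)].
have cz : 0 < cabs (z - 1).
  rewrite cabs_gt0 subr_eq0; apply/eqP => zE; move: z1; rewrite zE cabs1 ltxx //.
rewrite mulrC -ler_pdivlMr //; apply: opnorm_le_bound => [|y].
  by rewrite divr_ge0 ?invr_ge0 // ltW.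
have yE : z *: resolvent T z y - T (resolvent T z y) = y.
  by have := congr1 (fun V : bounded_op H H => V y) rE.
have := low _ (resolvent T z y) z1; rewrite yE => le.
by rewrite -invfM [leRHS]mulrC ler_pdivlMr ?mulr_gt0 // mulrC.
Qed.

(** Local bounds are patched by [disc_cover]: they are vacuous around interior points and around 1,
    and elsewhere on the circle the inverse of [p - T] provides them. *)
Lemma spectrum_gap T (d : R) : contraction_op T ->
  spectrum T `&` @unit_circle R `<=` [set 1] -> 0 < d ->
  exists2 c : R, 0 < c & forall z x, cabs z = 1 -> d <= cabs (z - 1) ->
    c * rnorm x <= rnorm (z *: x - T x).
Proof.
move=> T1 sp d0; pose Q (A : R[i] -> Prop) := exists2 c : R, 0 < c &
  forall z x, A z -> cabs z = 1 -> d <= cabs (z - 1) -> c * rnorm x <= rnorm (z *: x - T x).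
have [| | |c c0 cP] := @disc_cover R Q.
- by move=> A B AB [c c0 cP]; exists c => // z x /AB; exact: cP.
- move=> A B [c c0 cP] [c' c'0 c'P]; exists (Num.min c c'); first by rewrite lt_min c0.
  move=> z x [Az|Bz] z1 zd.
    by apply: le_trans (cP z x Az z1 zd); rewrite ler_wpM2r ?rnorm_ge0 // ge_min lexx.
  by apply: le_trans (c'P z x Bz z1 zd); rewrite ler_wpM2r ?rnorm_ge0 // ge_min lexx orbT.
- move=> p p1; have [pe|pn] := eqVneq (cabs p) 1; last first.
    have pl : cabs p < 1 by rewrite lt_neqAle pn.
    exists ((1 - cabs p) / 2); first by lra.
    exists 1 => // z x [zp _] z1 _.
    by have := cabsBD z p; rewrite z1; lra.
  have [pE|pn1] := eqVneq p 1.
    exists (d / 2); first by lra.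
    by exists 1 => // z x [zp _] z1 zd; rewrite pE in zp; lra.
  have [U [UP _]] : exists U, is_inverse U (p *: (1 : bounded_op H H) - T).
    apply: contrapT => no; have /eqP : p = 1 by apply: sp; split; [exact: no|exact/unit_circleE].
    by rewrite (negbTE pn1).
  pose k := (opnorm U + 1)^-1.
  have U0 := opnorm_ge0 U.
  have k0 : 0 < k by rewrite invr_gt0; lra.
  have low x : k * rnorm x <= rnorm (p *: x - T x).
    have xE : U (p *: x - T x) = x.
      by have := congr1 (fun V : bounded_op H H => V x) UP.
    rewrite mulrC ler_pdivrMr; last by lra.
    rewrite -{1}xE; apply: le_trans (opnorm_bound _ _) _.
    by rewrite mulrC ler_wpM2l ?rnorm_ge0 // lerDl.
  exists (k / 2); first by lra.
  exists (k / 2) => [|z x [zp _] z1 zd]; first by lra.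
  have := rnorm_leBD (p *: x - T x) (z *: x - T x).
  have -> : p *: x - T x - (z *: x - T x) = (p - z) *: x.
    by rewrite opprB addrA subrK scalerBl.
  rewrite rnormZc cabsB => le; have := ler_wpM2r (rnorm_ge0 x) zp; have := low x; lra.
by exists c => // z x z1; apply: cP; rewrite // z1.
Qed.

(* The resolvent bound can only fail near the circle because [T] is a
   contraction, and only near 1 because of the spectral hypothesis. *)
Lemma approx_eigen T (e : R) : contraction_op T ->
  spectrum T `&` @unit_circle R `<=` [set 1] -> ~ ritt T -> 0 < e ->
  exists (z : R[i]) (x : H), [/\ cabs z = 1, rnorm x = 1, z != 1, cabs (z - 1) <= e &
    rnorm (z *: x - T x) <= e * cabs (z - 1)].
Proof.
move=> T1 sp nr e0; have [c c0 cP] := spectrum_gap T1 sp e0.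
(* Moving [z] to [w = z / |z|] gives a defect of at most [4 e' |w - 1|]. Here 1/2 yields
   [|z - 1| <= 2 |w - 1|], [e / 4] the final bound, and [c / 9] contradicts [spectrum_gap] if
   [|w - 1| > e], since then [c <= 8 e']. *)
pose e' := Num.min (1 / 2) (Num.min (e / 4) (c / 9)).
have [e'0 e'1 e'2 e'3] : [/\ 0 < e', e' <= 1 / 2, e' <= e / 4 & e' <= c / 9].
  have h2 : 0 < e / 4 by lra.
  have h3 : 0 < c / 9 by lra.
  have h1 : (0 : R) < 1 / 2 by lra.
  split; first by rewrite !lt_min h1 h2 h3.
  - by rewrite ge_min lexx.
  - by rewrite ge_min; apply/orP; right; rewrite ge_min lexx.
  - by rewrite ge_min; apply/orP; right; rewrite ge_min lexx orbT.
have [z [x0 [z1 zx]]] : exists (z : R[i]) (x : H), 1 < cabs z /\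
    rnorm (z *: x - T x) < e' * cabs (z - 1) * rnorm x.
  apply: contrapT => no; apply: nr; apply: (ritt_of_lower T1 e'0) => z x z1.
  by rewrite leNgt; apply/negP => lt; apply: no; exists z, x.
have xp : 0 < rnorm x0.
  rewrite lt_neqAle rnorm_ge0 andbT eq_sym; apply/eqP => x00.
  by move: zx; rewrite x00 mulr0 ltNge rnorm_ge0.
pose x := (rnorm x0)^-1%:C *: x0.
have x1 : rnorm x = 1.
  by rewrite rnormZc cabs_real ger0_norm ?invr_ge0 ?rnorm_ge0 // mulVf // gt_eqF.
have {zx} zx : rnorm (z *: x - T x) <= e' * cabs (z - 1).
  rewrite /x bounded_opZ scalerA mulrC -scalerA -scalerBr rnormZc cabs_real.
  by rewrite ger0_norm ?invr_ge0 ?rnorm_ge0 // mulrC ler_pdivrMr // ltW.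
have zc := contr_lower z x T1; rewrite x1 mulr1 in zc.
pose r := cabs z; pose w := z / r%:C.
have r0 : 0 < r by rewrite /r; lra.
have rC : r%:C != 0 by rewrite fmorph_eq0 gt_eqF.
have w1 : cabs w = 1 by rewrite cabsM cabsV cabs_real (gtr0_norm r0) mulfV // gt_eqF.
have zw : z - w = (r - 1)%:C * w by rewrite rmorphB rmorph1 /w; field.
have zwc : cabs (z - w) = r - 1.
  by rewrite zw cabsM w1 mulr1 cabs_real ger0_norm // /r; lra.
have c1 := cabs_ge0 (z - 1).
have zb : cabs (z - 1) <= 2 * cabs (w - 1).
  have : cabs (z - 1) <= cabs (w - 1) + cabs (z - w).
    by apply: le_trans (cabsBD _ (w - 1)) _; rewrite opprB addrA subrK.
  have := ler_wpM2r c1 e'1; rewrite zwc; rewrite /r; lra.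
have low : rnorm (w *: x - T x) <= 4 * e' * cabs (w - 1).
  have := rnorm_leBD (w *: x - T x) (z *: x - T x).
  have -> : w *: x - T x - (z *: x - T x) = (w - z) *: x.
    by rewrite opprB addrA subrK scalerBl.
  rewrite rnormZc x1 mulr1 cabsB zwc; have := ler_wpM2l (ltW e'0) zb; rewrite /r; lra.
have w0 := cabs_ge0 (w - 1).
exists w, x; split => //.
- apply/eqP => wE; move: zb; rewrite wE subrr cabs0 mulr0 => z10.
  have : cabs (z - 1) = 0 by apply/le_anti; rewrite z10 c1.
  by move/eqP; rewrite cabs_eq0 subr_eq0 => /eqP zE; rewrite zE cabs1 ltxx in z1.
- rewrite leNgt; apply/negP => lt; have := cP w x w1 (ltW lt); rewrite x1 mulr1 => cw.
  have w2 : cabs (w - 1) <= 2.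
    by apply: le_trans (cabsD _ _) _; rewrite w1 cabsN cabs1; lra.
  have : 4 * e' * cabs (w - 1) <= 4 * e' * 2 by rewrite ler_wpM2l //; lra.
  lra.
apply: le_trans low _; rewrite ler_wpM2r //; lra.
Qed.

Lemma contr_pow_approx T (z : R[i]) x (e : R) : opnorm T <= 1 -> cabs z = 1 ->
  rnorm (T x - z *: x) <= e -> forall n, rnorm ((T ^+ n) x - z ^+ n *: x) <= n%:R * e.
Proof.
move=> T1 z1 Tx; elim=> [|n IH].
  by rewrite !expr0 one_opE scale1r subrr rnorm0 mul0r.
rewrite expS_opE; set y := bounded_op_fun (T ^+ n) x in IH *.
have -> : T y - z ^+ n.+1 *: x = T (y - z ^+ n *: x) + z ^+ n *: (T x - z *: x).
  by rewrite opB bounded_opZ scalerBr scalerA -exprSr addrA subrK.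
apply: le_trans (rnormD _ _) _; rewrite -natr1 mulrDl mul1r; apply: lerD.
  exact: le_trans (contr_le _ T1) IH.
by rewrite rnorm_scale1 // cabsX z1 expr1n.
Qed.

Lemma cis_small (e : R) : 0 < e -> exists2 d : R, 0 < d &
  forall t, `|t| <= pi -> cabs (cis t - 1) <= d -> `|t| <= e.
Proof.
move=> e0; pose e' := Num.min e pi.
have e'0 : 0 < e' by rewrite lt_min e0 pi_gt0.
have e'pi : e' <= pi by rewrite ge_min lexx orbT.
have ep : e' <= e by rewrite ge_min lexx.
have ci u : 0 <= u <= pi -> u \in `[0, (pi : R)] by rewrite in_itv.
have c1 : cos e' < 1.
  by rewrite -[ltRHS]cos0 ltr_cos // ci ?lexx ?pi_ge0 // ltW.
exists ((1 - cos e') / 2) => [|t tpi]; first by lra.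
have := cabs_Re (cis t - 1); rewrite /cis /= => h1 h2.
rewrite leNgt; apply/negP => lt.
have : cos `|t| < cos e' by rewrite ltr_cos ?ci ?normr_ge0 ?tpi ?(ltW e'0) //; exact: le_lt_trans ep lt.
rewrite cos_norm => h3; have := ler_norm (- (cos t - 1)); rewrite normrN; lra.
Qed.

(* Multiples of [t] with the sign of an argument of [z] come within [|t|] of it
   before their modulus exceeds [3 pi]. *)
Lemma cis_pow_close (t : R) (z : R[i]) : t != 0 -> `|t| <= pi -> cabs z = 1 ->
  exists n, [/\ (1 <= n)%N, n%:R * `|t| <= 3 * pi & cabs (cis t ^+ n - z) <= `|t|].
Proof.
move=> t0 tpi /cis_onto[s0 s0pi ->].
have pi0 := pi_gt0 R.
have [s [sE sb st]] : exists s, [/\ cis s0 = cis s, `|s| <= 2 * pi & 0 <= s / t].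
  have p2 : 2 * pi = pi *+ 2 :> R by rewrite mulr_natl.
  have cisp : cis (s0 + 2 * pi) = cis s0 by rewrite p2 cisD cis2pi mulr1.
  have cism : cis (s0 - 2 * pi) = cis s0.
    transitivity (cis (s0 - 2 * pi) * cis (2 * pi)); first by rewrite p2 cis2pi mulr1.
    by rewrite -cisD subrK.
  move: s0pi; rewrite ler_norml => /andP[b1 b2].
  have [tp|tn] := ltP 0 t.
    have [sp|sn] := leP 0 s0.
      by exists s0; split; rewrite ?divr_ge0 ?(ltW tp) // ger0_norm //; lra.
    by exists (s0 + 2 * pi); split; rewrite ?cisp ?divr_ge0 ?(ltW tp) // ?ger0_norm //; lra.
  have tn' s : s <= 0 -> 0 <= s / t.
    by move=> s0'; rewrite -mulrNN -invrN divr_ge0 ?oppr_ge0.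
  have [sp|sn] := leP s0 0.
    by exists s0; split; rewrite ?tn' // ler0_norm //; lra.
  by exists (s0 - 2 * pi); split; rewrite ?cism ?tn' // ?ler0_norm //; lra.
have tp : 0 < `|t| by rewrite normr_gt0.
pose n := (Num.truncn (s / t)).+1.
have h1 : n%:R <= s / t + 1 by rewrite /n -natr1 lerD2r truncn_le.
have h2 : s / t < n%:R by rewrite /n truncnS_gt.
have near : `|t * n%:R - s| <= `|t|.
  have -> : t * n%:R - s = t * (n%:R - s / t) by field.
  by rewrite normrM ler_piMr // ger0_norm; lra.
exists n; split=> //.
  have -> : n%:R * `|t| = `|t * n%:R| by rewrite normrM mulrC [`|n%:R|]ger0_norm.
  have := ler_normD (t * n%:R - s) s; rewrite subrK; lra.
rewrite sE cisX -mulr_natr.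
have -> : cis (t * n%:R) - cis s = (cis (t * n%:R - s) - 1) * cis s.
  by rewrite mulrBl -cisD subrK mul1r.
by rewrite cabsM cabs_cis mulr1; apply: le_trans (cabs_cis_sub1 _) near.
Qed.

(** The defect of the eigenvector is small relative to [|z - 1| <= |t|]. Errors add along the orbit,
    and [n |t| <= 3 pi] steps accumulate at most [3 pi * e / (6 pi) = e / 2]. *)
Lemma orbit_approx T (w : R[i]) (e : R) : contraction_op T ->
  spectrum T `&` @unit_circle R `<=` [set 1] -> ~ ritt T -> cabs w = 1 -> 0 < e ->
  exists (n : nat) (x : H), [/\ (1 <= n)%N, rnorm x = 1 & rnorm ((T ^+ n) x - w *: x) <= e].
Proof.
move=> T1 sp nr w1 e0; have pi0 := pi_gt0 R.
have [d d0 dP] := @cis_small (e / 2) ltac:(lra).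
have k0 : 0 < e / (6 * pi) by rewrite divr_gt0 // mulr_gt0.
pose e' := Num.min d (e / (6 * pi)).
have e'0 : 0 < e' by rewrite lt_min d0.
have [z [x [z1 x1 zn1 zd zx]]] := approx_eigen T1 sp nr e'0.
have [t tpi zE] := cis_onto z1.
have td : `|t| <= e / 2.
  by apply: dP => //; rewrite -zE; apply: le_trans zd _; rewrite ge_min lexx.
have t0 : t != 0 by apply/eqP => tE; move: zn1; rewrite zE tE cis0 eqxx.
have [n [n1 nt nz]] := cis_pow_close t0 tpi w1; rewrite -zE in nz.
exists n, x; split=> //.
have Tx : rnorm (T x - z *: x) <= e / (6 * pi) * `|t|.
  rewrite rnormB; apply: le_trans zx _; apply: ler_pM; rewrite ?cabs_ge0 ?(ltW e'0) //.
    by rewrite ge_min lexx orbT.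
  by rewrite zE; exact: cabs_cis_sub1.
have h1 := contr_pow_approx T1 z1 Tx n.
have h2 : n%:R * (e / (6 * pi) * `|t|) <= e / 2.
  have -> : n%:R * (e / (6 * pi) * `|t|) = (n%:R * `|t|) * (e / (6 * pi)) by ring.
  apply: le_trans (ler_wpM2r (ltW k0) nt) _.
  have -> : 3 * pi * (e / (6 * pi)) = e / 2.
    by move: (pi : R) pi0 => a a0; field; exact: lt0r_neq0.
  exact: lexx.
have -> : (T ^+ n) x - w *: x = ((T ^+ n) x - z ^+ n *: x) + (z ^+ n - w) *: x.
  by rewrite scalerBl addrA subrK.
apply: le_trans (rnormD _ _) _; rewrite rnormZc x1 mulr1 [e](splitr e).
by apply: lerD; [exact: le_trans h1 h2|exact: le_trans nz td].
Qed.

End Resolvent.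

(** * The gap forces the Ritt condition *)

Section Backward.
Variables (R : realType) (E F H : hilbertType R).
Variables (EH : hilbert_tensor E H) (FH : hilbert_tensor F H).

(** On the elementary tensor of [e] and [x], [p(S)] acts nearly as [p(z)] on the first factor,
    because [S^j x] is within [j d] of [z^j x]. *)
Lemma poly_calculus_eigen (p : seq (bounded_op E F)) (S : bounded_op H H) (z : R[i]) e x (d : R) :
  opnorm S <= 1 -> cabs z = 1 -> rnorm x = 1 -> rnorm e <= 1 -> 0 <= d ->
  rnorm (S x - z *: x) <= d ->
  rnorm (op_poly p z e) <= opnorm (poly_calculus EH FH p S) + (\sum_(j < size p) opnorm p`_j * j%:R) * d.
Proof.
move=> S1 z1 x1 e1 d0 Sx; pose u := tensor EH e x.
have -> : rnorm (op_poly p z e) = rnorm (tensor FH (op_poly p z e) x).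
  by rewrite rnorm_tensor x1 mulr1.
set v := tensor FH _ x.
apply: le_trans (rnorm_leBD _ (poly_calculus EH FH p S u)) _; apply: lerD.
  apply: le_trans (opnorm_bound _ _) _; rewrite rnorm_tensor x1 mulr1.
  by rewrite ler_piMr ?opnorm_ge0.
have -> : v - poly_calculus EH FH p S u =
    \sum_(j < size p) tensor FH (p`_j e) (z ^+ j *: x - (S ^+ j) x).
  rewrite /v /op_poly /poly_calculus !sum_opE linear_sumlz /= -sumrB; apply: eq_bigr => j _.
  rewrite tensor_opE linearBr /= linearZr_LR /=; congr (_ - _).
  exact: (linearZl_LR (tensor FH) x (z ^+ j) (p`_j e)).
apply: le_trans (rnorm_sum _ _ _) _; rewrite mulr_suml; apply: ler_sum => j _.
rewrite rnorm_tensor -mulrA; apply: ler_pM; rewrite ?rnorm_ge0 //.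
  by apply: le_trans (opnorm_bound _ _) _; rewrite ler_piMr ?opnorm_ge0.
by rewrite rnormB; exact: contr_pow_approx.
Qed.

Lemma calculus_gap_ritt (T : bounded_op H H) (W : R[i]^o -> bounded_op E F) :
  contraction_op T -> spectrum T `&` @unit_circle R `<=` [set 1] -> disc_algebra W ->
  (ereal_sup [set (opnorm (calculus EH FH W (T ^+ n)))%:E
              | n in [set n : nat | (1 <= n)%N]] < (disc_norm W)%:E)%E -> ritt T.
Proof.
move=> T1 sp WD; set s := ereal_sup _ => sW.
have Wb := disc_algebra_bounded WD.
have dense e' (e'0 : 0 < e') := poly_dense WD e'0.
have sub n : (1 <= n)%N -> ((opnorm (calculus EH FH W (T ^+ n)))%:E <= s)%E.
  by move=> n1; apply: ereal_sup_ubound; exists n.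
have sfin : s \is a fin_num.
  rewrite fin_numE; apply/andP; split; apply/eqP => sE.
    by have := sub 1%N isT; rewrite sE leeNy_eq.
  by rewrite sE in sW.
pose c := fine s; pose M := disc_norm W.
have cM : c < M by rewrite -lte_fin fineK.
have cP n : (1 <= n)%N -> opnorm (calculus EH FH W (T ^+ n)) <= c.
  by move=> /sub; rewrite -lee_fin fineK.
have absurd (a b : R) : 0 < b -> ~ (a + b < a + b / 8 + b / 8 + b / 8) by lra.
apply: contrapT => nr; pose g := (M - c) / 2; have g0 : 0 < g by rewrite /g; lra.
have [z z1 zc] := @disc_norm_gt _ _ _ W (c + g) ltac:(rewrite -/M /g; lra).
have [e [e1 ec]] : exists e : E, rnorm e <= 1 /\ c + g < rnorm (W z e).
  apply: contrapT => no; move: zc; rewrite ltNge opnorm_lub // => e e1.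
  by rewrite leNgt; apply/negP => ?; apply: no; exists e; rewrite rnorm_le1.
(* Three errors of size [g / 8] arise: from [W] to [p] at [z], from [z] to [T^n], and from [p] back
   to [W] at [T^n]. Together they stay below [g]. *)
have [p pW] := dense (g / 8) ltac:(lra).
pose L := \sum_(j < size p) opnorm p`_j * j%:R.
have L0 : 0 <= L by apply: sumr_ge0 => j _; rewrite mulr_ge0 ?opnorm_ge0.
have d0 : 0 < g / (8 * (L + 1)) by rewrite divr_gt0 // mulr_gt0 //; lra.
have [n [x [n1 x1 nx]]] := orbit_approx T1 sp nr z1 d0.
have Tn := contrX n T1.
have h1 := poly_calculus_eigen p Tn z1 x1 e1 (ltW d0) nx; rewrite -/L in h1.
have g8 : 0 <= g / 8 by lra.
have h2 := calculus_close EH FH Tn Wb g8 dense pW.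
have h3 : opnorm (poly_calculus EH FH p (T ^+ n)) <= c + g / 8.
  rewrite -rnorm_op; apply: le_trans (rnorm_leBD _ (calculus EH FH W (T ^+ n))) _.
  by rewrite !rnorm_op; exact: lerD (cP n n1) h2.
have h4 : rnorm (W z e) <= rnorm (op_poly p z e) + g / 8.
  apply: le_trans (rnorm_leBD _ (op_poly p z e)) _; rewrite lerD2l -sub_opE.
  apply: le_trans (opnorm_bound _ _) _; have := approx_bound Wb pW z1.
  rewrite -rnorm_op rnormB rnorm_op => le; apply: le_trans le.
  by rewrite ler_piMr ?opnorm_ge0.
have h5 : L * (g / (8 * (L + 1))) <= g / 8.
  have -> : L * (g / (8 * (L + 1))) = g / 8 * (L / (L + 1)) by field; rewrite gt_eqF //; lra.
  by rewrite ler_piMr // ler_pdivrMr; lra.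
have : c + g < c + g / 8 + g / 8 + g / 8.
  apply: lt_le_trans ec _; apply: le_trans h4 _; rewrite lerD2r.
  exact: le_trans h1 (lerD h3 h5).
exact: absurd.
Qed.

End Backward.

Theorem theorem10p5 (R : realType) (H : hilbertType R) (T : bounded_op H H)
    (HT : contraction_op T)
    (HspecT : spectrum T `&` @unit_circle R `<=` [set 1])
    (E F : hilbertType R) (EH : hilbert_tensor E H) (FH : hilbert_tensor F H)
    (W : R[i]^o -> bounded_op E F) (HW : disc_algebra W)
    (HW1 : opnorm (W 1) < disc_norm W) :
  ritt T <->
  (ereal_sup [set (opnorm (calculus EH FH W (T ^+ n)))%:E
              | n in [set n : nat | (1 <= n)%N]] < (disc_norm W)%:E)%E.
Proof.
by split=> [|gap]; [exact: ritt_calculus_gap|exact: calculus_gap_ritt gap].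
Qed.
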